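(* Let $d\ge1$ be an integer and let $\alpha\in\mathbb{R}$ with $\alpha<\frac{d+2}{2}$. Then the following hold. (1) $K_\alpha,K_\alpha^+:L^2\to L^2$ are Hilbert–Schmidt operators. (2) Moreover, if $d=1$ and $0<\alpha<\frac32$, then $$\mathrm{Tr}(K_\alpha^*K_\alpha)=\|K_{2\alpha}^+\|_{L^\infty\to L^1}=\frac{1}{(\alpha-1)^2}\left(\frac{\Gamma(3-2\alpha)}{\Gamma^2(2-\alpha)}-1\right),$$ where, when $\alpha=1$, the quantity on the right-hand side is to be interpreted as $\frac{\pi^2}{6}$.
   Context: $\mathbb{B}^d$ is the open unit ball of $\mathbb{C}^d$ with Lebesgue measure $dv$ normalized so that $v(\mathbb{B}^d)=1$; $\langle z,w\rangle=\sum_j z_j\overline{w_j}$; $L^p=L^p(\mathbb{B}^d,dv)$. For $\alpha\in\mathbb{R}$ and $f\in L^1(\mathbb{B}^d,dv)$, $$K_\alpha f(z)=\int_{\mathbb{B}^d}\frac{f(w)}{(1-\langle z,w\rangle)^\alpha}\,dv(w),\qquad K_\alpha^+f(z)=\int_{\mathbb{B}^d}\frac{f(w)}{|1-\langle z,w\rangle|^\alpha}\,dv(w),\qquad z\in\mathbb{B}^d$$ (principal branch of the power). $\Gamma$ is the usual Gamma function, $\mathrm{Tr}$ is the operator trace on $L^2$, and $\|T\|_{L^p\to L^q}$ is the operator norm. *)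

(* Defs.v *)
From HB Require Import structures.
From mathcomp Require Import all_boot all_order all_algebra complex.
From mathcomp Require Import all_classical all_reals all_analysis.
From mathcomp Require Import measurable_realfun.

Set Implicit Arguments.
Unset Strict Implicit.
Unset Printing Implicit Defensive.
Import Order.TTheory GRing.Theory Num.Theory.
Import numFieldNormedType.Exports.
Local Open Scope classical_set_scope.
Local Open Scope ring_scope.

HB.instance Definition _ (R : realType) := isPointed.Build R[i] 0.

(* The Borel sigma-algebra of R[i], transported from that of R x R. *)
Section measurable_complex.
Variable R : realType.

Definition complex_of_pair (p : measurableTypeR R * measurableTypeR R) : R[i] :=
  Complex p.1 p.2.

Definition measurable_complex : set (set R[i]) :=
  [set A | measurable (complex_of_pair @^-1` A)].

Let measurable_complex0 : measurable_complex set0.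
Proof. by rewrite /measurable_complex /= preimage_set0. Qed.

Let measurable_complexC A :
  measurable_complex A -> measurable_complex (~` A).
Proof.
by move=> mA; rewrite /measurable_complex /= preimage_setC; exact: measurableC.
Qed.

Let measurable_complex_bigcup (F : (set R[i])^nat) :
  (forall i, measurable_complex (F i)) -> measurable_complex (\bigcup_i (F i)).
Proof.
move=> mF; rewrite /measurable_complex /= preimage_bigcup.
by apply: bigcup_measurable => k _; exact: mF.
Qed.

HB.instance Definition _ := @isMeasurable.Build default_measure_display
  R[i] measurable_complex measurable_complex0 measurable_complexC
  measurable_complex_bigcup.

End measurable_complex.


(* The product measure transported by a measurable isomorphism f with inverse g.
   The last three arguments only serve the inference of the sigma-finite measure
   structure. *)
Section image_product_measure.
Context d1 d2 d (T1 : measurableType d1) (T2 : measurableType d2)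
  (T : measurableType d) (R : realType).
Variables (m1 : {sigma_finite_measure set T1 -> \bar R}).
Variables (m2 : {sigma_finite_measure set T2 -> \bar R}).
Variables (f : T1 * T2 -> T) (g : T -> T1 * T2).
Hypotheses (mf : measurable_fun setT f) (mg : measurable_fun setT g).
Hypothesis fK : cancel f g.

Definition image_product_measure of measurable_fun setT f
  & measurable_fun setT g & cancel f g : set T -> \bar R :=
  pushforward (m1 \x m2)%E f.

Local Notation im := (image_product_measure mf mg fK).

Let im0 : im set0 = 0%E.
Proof. exact: measure0. Qed.

Let im_ge0 A : (0 <= im A)%E.
Proof. exact: measure_ge0. Qed.

Let im_sigma_additive : semi_sigma_additive im.
Proof. exact: measure_semi_sigma_additive. Qed.

HB.instance Definition _ := isMeasure.Build _ _ _ im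
  im0 im_ge0 im_sigma_additive.

Let im_sigma_finite : sigma_finite [set: T] im.
Proof.
have /sigma_finiteP[F [TF ndF Foo]] := sigma_finiteT m1.
have /sigma_finiteP[G [TG ndG Goo]] := sigma_finiteT m2.
exists (fun n => g @^-1` (F n `*` G n)).
  rewrite -preimage_bigcup -[LHS](preimage_setT g); congr (_ @^-1` _).
  rewrite -setXTT TF TG predeqE => -[x y]; split.
    move=> [/= [n _ Fnx] [k _ Gky]]; exists (maxn n k) => //; split.
    - by move: x Fnx; exact/subsetPset/ndF/leq_maxl.
    - by move: y Gky; exact/subsetPset/ndG/leq_maxr.
  by move=> [n _ []/= ? ?]; split; exists n.
move=> n; have [? ?] := Foo n; have [? ?] := Goo n; split.
  by rewrite -[X in measurable X]setTI; apply: mg => //; exact: measurableX.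
rewrite /image_product_measure /pushforward -comp_preimage.
rewrite (_ : g \o f = id); last by apply/funext => x /=; rewrite fK.
by rewrite preimage_id product_measure1E// lte_mul_pinfty// ge0_fin_numE.
Qed.

HB.instance Definition _ := Measure_isSigmaFinite.Build _ _ _ im
  im_sigma_finite.

End image_product_measure.

Section lebesgue_measure_Cn.
Variable R : realType.

Definition pair_of_complex (z : R[i]) : measurableTypeR R * measurableTypeR R :=
  (complex.Re z, complex.Im z).

Lemma complex_of_pairK : cancel (@complex_of_pair R) pair_of_complex.
Proof. by case. Qed.

Lemma measurable_complex_of_pair : measurable_fun setT (@complex_of_pair R).
Proof. by move=> _ A mA; rewrite setTI. Qed.

Lemma measurable_pair_of_complex : measurable_fun setT pair_of_complex.
Proof.
move=> _ A mA; rewrite setTI /measurable/= /measurable_complex /=.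
rewrite -comp_preimage (_ : _ \o _ = id)//.
by apply/funext => -[].
Qed.

Definition lebesgue_measureC : {sigma_finite_measure set R[i] -> \bar R} :=
  image_product_measure (@lebesgue_measure R) (@lebesgue_measure R)
    measurable_complex_of_pair measurable_pair_of_complex complex_of_pairK.

Definition tuple_of_pair n (p : R[i] * n.-tuple R[i]) : n.+1.-tuple R[i] :=
  [tuple of p.1 :: p.2].

Definition pair_of_tuple n (t : n.+1.-tuple R[i]) : R[i] * n.-tuple R[i] :=
  (thead t, [tuple of behead t]).

Lemma tuple_of_pairK n : cancel (@tuple_of_pair n) (@pair_of_tuple n).
Proof. by case=> x t; congr pair; exact: val_inj. Qed.

Lemma measurable_tuple_of_pair n : measurable_fun setT (@tuple_of_pair n).
Proof. exact: measurable_cons. Qed.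

Lemma measurable_pair_of_tuple n : measurable_fun setT (@pair_of_tuple n).
Proof.
apply/measurable_fun_pairP; split.
  exact: measurable_tnth.
exact: measurable_behead.
Qed.

Fixpoint lebesgue_measureCn n :
    {sigma_finite_measure set (n.-tuple R[i]) -> \bar R} :=
  if n is k.+1 then
    image_product_measure lebesgue_measureC (lebesgue_measureCn k)
      (@measurable_tuple_of_pair k) (@measurable_pair_of_tuple k)
      (@tuple_of_pairK k)
  else \d_[tuple of [::]].

End lebesgue_measure_Cn.

Notation normc := ComplexField.Normc.normc.

Section unit_ball.
Variables (R : realType) (d : nat).
Local Notation Cd := (d.-tuple R[i]).

Definition hdot (z w : Cd) : R[i] := \sum_(j < d) tnth z j * conjc (tnth w j).

Definition unit_ball : set Cd :=
  [set z | \sum_(j < d) normc (tnth z j) ^+ 2 < 1].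

Lemma measurable_unit_ball : measurable unit_ball.
Proof.
have mre : measurable_fun setT (@complex.Re R : R[i] -> measurableTypeR R).
  exact: measurableT_comp measurable_fst (@measurable_pair_of_complex R).
have mim : measurable_fun setT (@complex.Im R : R[i] -> measurableTypeR R).
  exact: measurableT_comp measurable_snd (@measurable_pair_of_complex R).
have mn (j : 'I_d) : measurable_fun [set: Cd] (fun z : Cd =>
    normc (tnth z j) ^+ 2 : measurableTypeR R).
  rewrite (_ : (fun _ => _) =
    fun z : Cd => complex.Re (tnth z j) ^+ 2 + complex.Im (tnth z j) ^+ 2).
    by apply: measurable_funD; apply: measurable_funX;
      apply: measurableT_comp => //; exact: measurable_tnth.
  apply/funext => z; case: (tnth z j) => a b /=.
  by rewrite sqr_sqrtr// addr_ge0// sqr_ge0.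
have ms : measurable_fun [set: Cd] (fun z : Cd =>
    \sum_(j < d) normc (tnth z j) ^+ 2 : measurableTypeR R).
  by apply: measurable_sum => j; exact: mn.
rewrite (_ : unit_ball = setT `&` (fun z : Cd =>
  \sum_(j < d) normc (tnth z j) ^+ 2) @^-1` [set` `]-oo, 1[]).
  by apply: ms => //; exact: measurable_itv.
by rewrite setTI; apply/seteqP; split => z /=; rewrite in_itv.
Qed.

Definition ball_volume : R := fine (lebesgue_measureCn R d unit_ball).

Lemma invr_ball_volume_ge0 : 0 <= ball_volume^-1.
Proof. by rewrite invr_ge0 fine_ge0. Qed.

(* Normalized Lebesgue measure dv of the unit ball, as a measure on C^d
   carried by the ball. *)
Definition vball : {measure set Cd -> \bar R} :=
  mscale (NngNum invr_ball_volume_ge0)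
    (mrestr (lebesgue_measureCn R d) measurable_unit_ball).

End unit_ball.
Arguments hdot {R d}.
Arguments unit_ball {R d}.
Arguments vball {R d}.

Section complex_power.
Variable R : realType.

(* Principal argument, in ]-pi, pi]. *)
Definition Arg (u : R[i]) : R :=
  let t := acos (complex.Re u / normc u) in
  if 0 <= complex.Im u then t else - t.

Definition Cexp (u : R[i]) : R[i] :=
  Complex (expR (complex.Re u) * cos (complex.Im u))
          (expR (complex.Re u) * sin (complex.Im u)).

Definition CLog (u : R[i]) : R[i] := Complex (ln (normc u)) (Arg u).

(* Principal branch; only meaningful for u != 0. *)
Definition Cpow (u : R[i]) (a : R) : R[i] := Cexp (a%:C%C * CLog u).

End complex_power.

(* Real Gamma function; only meaningful for 0 < x. *)
Definition Gamma {R : realType} (x : R) : R :=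
  \int[lebesgue_measure]_(t in `]0, +oo[) (t `^ (x - 1) * expR (- t)).

Section operators.
Variables (R : realType) (d : nat).
Local Notation Cd := (d.-tuple R[i]).
Local Notation v := (@vball R d).
Local Notation B := (@unit_ball R d).

Definition ball_integral (f : Cd -> R[i]) : R[i] :=
  Complex (\int[v]_(z in B) complex.Re (f z))
          (\int[v]_(z in B) complex.Im (f z)).

Definition Kalpha (a : R) (f : Cd -> R[i]) (z : Cd) : R[i] :=
  ball_integral (fun w => f w / Cpow (1 - hdot z w) a).

Definition Kalpha_plus (a : R) (f : Cd -> R[i]) (z : Cd) : R[i] :=
  ball_integral (fun w => f w / (normc (1 - hdot z w) `^ a)%:C%C).

(* Elements of L^p are represented by functions, of which only the restriction
   to the ball matters, and equality in L^p is equality almost everywhere. *)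
Definition LpNorm (p : \bar R) (f : Cd -> R[i]) : \bar R :=
  'N[v]_p[(fun z => (normc (f z))%:E) \_ B]%E.

Definition in_Lp (p : \bar R) (f : Cd -> R[i]) : Prop :=
  measurable_fun B f /\ (LpNorm p f < +oo)%E.

Local Notation in_L2 := (in_Lp 2%:E).

(* Equal to +oo unless T maps L^p boundedly into L^q. *)
Definition opnorm (p q : \bar R) (T : (Cd -> R[i]) -> Cd -> R[i]) : \bar R :=
  if `[< forall f, in_Lp p f -> in_Lp q (T f) >] then
    ereal_sup [set LpNorm q (T f) | f in
      [set f | in_Lp p f /\ (LpNorm p f <= 1)%E]]
  else +oo%E.

Definition bounded_linear_L2 (T : (Cd -> R[i]) -> Cd -> R[i]) : Prop :=
  [/\ forall f, in_L2 f -> in_L2 (T f),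
      forall (a : R[i]) f g, in_L2 f -> in_L2 g ->
        {ae v, forall z, T (fun w => a * f w + g w) z = a * T f z + T g z}
    & exists M : R, forall f, in_L2 f ->
        (LpNorm 2%:E (T f) <= M%:E * LpNorm 2%:E f)%E].

Definition inner (f g : Cd -> R[i]) : R[i] :=
  ball_integral (fun z => f z * conjc (g z)).

(* For 0 < d the Hilbert space L^2 is separable and infinite dimensional, so
   its orthonormal bases are indexed by nat. *)
Definition orthonormal_basis (e : nat -> Cd -> R[i]) : Prop :=
  [/\ forall n, in_L2 (e n),
      forall m n, inner (e m) (e n) = (m == n)%:R
    & forall f, in_L2 f ->
        LpNorm 2%:E (fun z => f z - \sum_(k < n) inner f (e k) * e k z)
          @[n --> \oo] --> 0%E].

Definition hilbert_schmidt (T : (Cd -> R[i]) -> Cd -> R[i]) : Prop :=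
  bounded_linear_L2 T /\
  exists2 e, orthonormal_basis e &
    (\sum_(0 <= n <oo) LpNorm 2%:E (T (e n)) ^+ 2 < +oo)%E.

Definition is_adjoint (T S : (Cd -> R[i]) -> Cd -> R[i]) : Prop :=
  bounded_linear_L2 S /\
  forall f g, in_L2 f -> in_L2 g -> inner (T f) g = inner f (S g).

(* The adjoint is unique up to equality almost everywhere, for T bounded. *)
Definition adjoint (T : (Cd -> R[i]) -> Cd -> R[i]) :
    (Cd -> R[i]) -> Cd -> R[i] :=
  @xget ((Cd -> R[i]) -> Cd -> R[i] : choiceType) id [set S | is_adjoint T S].

(* Convergence in every orthonormal basis, hence for every ordering of it, is
   the trace class condition. *)
Definition has_trace (T : (Cd -> R[i]) -> Cd -> R[i]) (t : R[i]) : Prop :=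
  [/\ bounded_linear_L2 T,
      exists e, orthonormal_basis e
    & forall e, orthonormal_basis e ->
        normc (\sum_(k < n) inner (T (e k)) (e k) - t)
          @[n --> \oo] --> (0 : R)].

End operators.

(* Main.v *)
Require Import Defs.
From HB Require Import structures.
From mathcomp Require Import all_boot all_order all_algebra complex.
From mathcomp Require Import all_classical all_reals all_analysis.
From mathcomp Require Import measurable_realfun ess_sup_inf zify ring lra.

Set Implicit Arguments.
Unset Strict Implicit.
Unset Printing Implicit Defensive.
Import Order.TTheory GRing.Theory Num.Theory.
Import numFieldNormedType.Exports.
Local Open Scope classical_set_scope.
Local Open Scope ring_scope.

(* Both kernels have squared modulus |1 - <z, w>|^(-2 alpha), so everything
   reduces to the double integral E(alpha) of that function over the ball: it is
   finite exactly when the operators are Hilbert-Schmidt, it is the trace of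
   K^* K by Parseval's identity in the variable w, and, the kernel of K^+_(2 alpha)
   being nonnegative, it is the L^oo -> L^1 norm of that operator, attained at 1.

   Finiteness for alpha < (d + 2) / 2: put a = 2 alpha / (d + 2) < 1.  If
   |z|^2 <= 1/2 the kernel is bounded.  Otherwise some coordinate z_j is not
   small; |1 - <z, w>|^(-2 alpha) is a product of d + 2 powers
   |1 - <z, w>|^(-a).  One is at most ((1 - |z|^2) / 2)^(-a); each coordinate
   k <> j absorbs one of them through |1 - <z, w>| >= |z_k - w_k|^2 / 2; the
   remaining two make |1 - <z, w>|^(-2a), integrable in w_j because 1 - <z, w>
   is affine in w_j.  All the singularities are of the form |x|^(-a) in one real
   variable.

   For d = 1, the binomial series and the orthogonality of monomials give
   E(alpha) = sum_n ((alpha)_n / (n+1)!)^2.  For alpha <> 1 this is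
   (2F1(a, a; 1; 1) - 1) / a^2 with a = alpha - 1 now, and Gauss's formula is
   obtained by iterating the contiguous relation c -> c + 1; for alpha = 1 it is
   the Basel sum. *)

(** * Abstract Hilbert spaces *)

(** Two circumstances shape the proof. First, elements of L^2 are functions on C^d of which only the
    values on the ball count, up to equality almost everywhere; so the Hilbert space theory is done
    for a semi-inner product and functions are replaced by their extension by zero, [rB]. Both
    [hilbert_schmidt] and [has_trace] ask for an actual orthonormal basis indexed by [nat]:
    Gram-Schmidt builds it from the indicators of finite intersections of rational half-spaces, L^2
    being infinite-dimensional because the ball contains many disjoint boxes. Second, no polar
    coordinates and no Jacobian are available: the bound for E(alpha) uses products of one-variable
    integrals, also for the factor (1 - |z|^2)^(-a) that is left to integrate in z, and the disc
    integrals use shears and dilations. The binomial series enters only through the squared modulus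
    of its partial sums, controlled by a real differential equation. In Gauss's formula, convergence
    at c = 1 is read off from E(alpha) < oo, and the value comes from c tending to infinity along
    the integers, where the series and the Gamma quotient both tend to 1. *)

Section squared_modulus.
Variable R : realType.
Implicit Types (u v : R[i]).

(** A polynomial in the two parts rather than the square of [normc], so that [ring] and [nra]
    apply. *)
Definition sqn u : R := complex.Re u ^+ 2 + complex.Im u ^+ 2.

Lemma sqnE u : sqn u = normc u ^+ 2.
Proof. by case: u => a b /=; rewrite sqr_sqrtr// addr_ge0// sqr_ge0. Qed.

Lemma sqn_ge0 u : 0 <= sqn u.
Proof. by rewrite /sqn addr_ge0// sqr_ge0. Qed.

Lemma sqn0 : sqn 0 = 0.
Proof. by rewrite /sqn /= expr0n /= addr0. Qed.

Lemma sqnM u v : sqn (u * v) = sqn u * sqn v.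
Proof. by case: u v => [a b] [c d]; rewrite /sqn /=; ring. Qed.

Lemma sqnN u : sqn (- u) = sqn u.
Proof. by case: u => a b; rewrite /sqn /=; ring. Qed.

Lemma sqn_conj u : sqn (conjc u) = sqn u.
Proof. by case: u => a b; rewrite /sqn /=; ring. Qed.

Lemma sqn_mulJ u : (sqn u)%:C%C = u * conjc u.
Proof. by case: u => a b; rewrite /sqn /=; congr Complex; ring. Qed.

Lemma sqnD_le u v : sqn (u + v) <= 2 * sqn u + 2 * sqn v.
Proof.
case: u v => [a b] [c d]; rewrite /sqn /=.
have := sqr_ge0 (a - c); have := sqr_ge0 (b - d); nra.
Qed.

Lemma normc_conj u : normc (conjc u) = normc u.
Proof. by case: u => a b /=; rewrite sqrrN. Qed.

Lemma normc_ge0 u : 0 <= normc u.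
Proof. by case: u => a b; exact: sqrtr_ge0. Qed.

Lemma real_mul_conj (a q : R) :
  a%:C%C * conjc (a%:C%C * q%:C%C) = (a * a * q)%:C%C.
Proof.
apply/eqP; rewrite eq_complex /=; apply/andP; split; apply/eqP; ring.
Qed.

Lemma Re_sum (I : Type) (r : seq I) (p : pred I) (F : I -> R[i]) :
  complex.Re (\sum_(i <- r | p i) F i) = \sum_(i <- r | p i) complex.Re (F i).
Proof.
by elim/big_rec2: _ => // i x [a b] _ <-; case: (F i).
Qed.

End squared_modulus.

Section prehilbert.
Variables (R : realType) (T : Type).
Local Notation C := R[i].
Local Notation F := (T -> C).

(** There is no definiteness axiom, since a function vanishing almost everywhere has norm 0. The
    laws are relative to [P] because the integral behind [ip] is meaningful only for
    square-integrable functions. *)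
Record prehilbert (P : F -> Prop) (ip : F -> F -> C) : Prop := PreHilbert {
  ph0 : P (fun=> 0) ;
  ph_lin : forall a f g, P f -> P g -> P (fun x => a * f x + g x) ;
  ph_ipl : forall a f g h, P f -> P g -> P h ->
    ip (fun x => a * f x + g x) h = a * ip f h + ip g h ;
  ph_conj : forall f g, P f -> P g -> ip g f = conjc (ip f g) ;
  ph_ge0 : forall f, P f -> 0 <= complex.Re (ip f f) }.

Variables (P : F -> Prop) (ip : F -> F -> C).
Hypothesis ph : prehilbert P ip.
Implicit Types (f g h : F) (e u : nat -> F) (c : nat -> C) (n : nat).

Definition qn f : R := complex.Re (ip f f).
Definition lincomb n c e : F := fun x => \sum_(k < n) c k * e k x.
Definition orthonormal_upto n e := (forall k, (k < n)%N -> P (e k)) /\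
  forall i j, (i < n)%N -> (j < n)%N -> ip (e i) (e j) = (i == j)%:R.
Definition residual n e f : F :=
  fun x => f x - \sum_(k < n) ip f (e k) * e k x.

Lemma qnE f : P f -> ip f f = (qn f)%:C%C.
Proof.
move=> Pf; have := ph_conj ph Pf Pf; rewrite /qn; case: (ip f f) => a b /=.
by case=> b0; congr Complex; lra.
Qed.

Lemma qn_ge0 f : P f -> 0 <= qn f. Proof. exact: ph_ge0. Qed.

Lemma phZ a f : P f -> P (fun x => a * f x).
Proof.
move=> Pf; have := ph_lin ph a Pf (ph0 ph); congr (P _).
by apply/funext => x; rewrite addr0.
Qed.

Lemma phB f g : P f -> P g -> P (fun x => f x - g x).
Proof.
move=> Pf Pg; have := ph_lin ph (-1) Pg Pf; congr (P _).
by apply/funext => x; rewrite mulN1r addrC.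
Qed.

Lemma ip0l h : P h -> ip (fun=> 0) h = 0.
Proof.
move=> Ph; have := ph_ipl ph 1 (ph0 ph) (ph0 ph) Ph.
have -> : (fun _ : T => 1 * 0 + 0 : C) = (fun=> 0).
  by apply/funext => x; rewrite mulr0 addr0.
by move/eqP; rewrite mul1r -subr_eq subrr eq_sym => /eqP.
Qed.

Lemma ph_ipZ a f h : P f -> P h -> ip (fun x => a * f x) h = a * ip f h.
Proof.
move=> Pf Ph; rewrite -[RHS]addr0 -(ip0l Ph) -(ph_ipl ph)//; last exact: (ph0 ph).
by congr ip; apply/funext => x; rewrite addr0.
Qed.

Lemma ph_ipB f g h : P f -> P g -> P h ->
  ip (fun x => f x - g x) h = ip f h - ip g h.
Proof.
move=> Pf Pg Ph; rewrite addrC -mulN1r -(ph_ipl ph)//.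
by congr ip; apply/funext => x; rewrite mulN1r addrC.
Qed.

Lemma ph_lincomb n c e : (forall k, (k < n)%N -> P (e k)) -> P (lincomb n c e).
Proof.
elim: n => [|n IH] Pe.
  have := ph0 ph; congr (P _).
  by apply/funext => x; rewrite /lincomb big_ord0.
have := ph_lin ph (c n) (Pe n (ltnSn n)) (IH (fun k kn => Pe k (ltnW kn))).
by congr (P _); apply/funext => x; rewrite /lincomb big_ord_recr /= addrC.
Qed.

Lemma ip_lincombl n c e h : (forall k, (k < n)%N -> P (e k)) -> P h ->
  ip (lincomb n c e) h = \sum_(k < n) c k * ip (e k) h.
Proof.
move=> + Ph; elim: n => [|n IH] Pe.
  rewrite big_ord0 -(ip0l Ph).
  by congr ip; apply/funext => x; rewrite /lincomb big_ord0.
have Pe' k : (k < n)%N -> P (e k) by move=> kn; exact/Pe/ltnW.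
rewrite big_ord_recr /= -IH// addrC -(ph_ipl ph) //.
- by congr ip; apply/funext => x; rewrite /lincomb big_ord_recr /= addrC.
- exact: Pe.
- exact: ph_lincomb.
Qed.

Lemma ip_lincombr n c e h : (forall k, (k < n)%N -> P (e k)) -> P h ->
  ip h (lincomb n c e) = \sum_(k < n) conjc (c k) * ip h (e k).
Proof.
move=> Pe Ph; rewrite (ph_conj ph (ph_lincomb c Pe) Ph) ip_lincombl//.
rewrite rmorph_sum; apply: eq_bigr => k _; rewrite rmorphM /=; congr *%R.
by rewrite -(ph_conj ph (Pe k (ltn_ord k)) Ph).
Qed.

Lemma ip_subr f g h : P f -> P g -> P h ->
  ip h (fun x => f x - g x) = ip h f - ip h g.
Proof.
move=> Pf Pg Ph; rewrite (ph_conj ph (phB Pf Pg) Ph) ph_ipB// rmorphB /=.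
by rewrite -!(ph_conj ph).
Qed.

(** Completing the square in each coefficient. The choice [c k = ip f (e k)] gives the norm of the
    residual and Bessel's inequality; a choice that represents f exactly shows that its residual
    vanishes. *)
Lemma qn_sub_lincomb n c e f : orthonormal_upto n e -> P f ->
  qn (fun x => f x - lincomb n c e x) =
  qn f - \sum_(k < n) sqn (ip f (e k)) + \sum_(k < n) sqn (ip f (e k) - c k).
Proof.
move=> [Pe oe] Pf; have Pl := ph_lincomb c Pe.
apply: complexI; rewrite -qnE ?ph_ipB ?ip_subr//; last 2 first.
- exact: phB.
- exact: phB.
rewrite !rmorphD rmorphN /= -qnE// ip_lincombl// ip_lincombr//.
have -> : ip (lincomb n c e) (lincomb n c e) = \sum_(k < n) c k * conjc (c k).
  rewrite ip_lincombl//; apply: eq_bigr => k _; congr *%R.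
  rewrite ip_lincombr//; last exact: Pe.
  rewrite (bigD1 k)//= oe// eqxx mulr1 big1 ?addr0// => i ik.
  by rewrite oe// eq_sym (_ : _ == _ = false) ?mulr0//; apply/negbTE.
rewrite !rmorph_sum /= -!addrA; congr (_ + _).
under [X in _ = _ + X]eq_bigr => k _.
  rewrite sqn_mulJ rmorphB /=.
  have -> : (ip f (e k) - c k) * (conjc (ip f (e k)) - conjc (c k)) =
    ip f (e k) * conjc (ip f (e k)) - conjc (c k) * ip f (e k)
    - (c k * conjc (ip f (e k)) - c k * conjc (c k)).
    by ring.
  over.
rewrite !sumrB; under [in RHS]eq_bigr => k _ do rewrite sqn_mulJ.
have -> : \sum_(k < n) c k * ip (e k) f =
          \sum_(k < n) c k * conjc (ip f (e k)).
  apply: eq_bigr => k _; rewrite -(ph_conj ph)//; exact: Pe.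
by rewrite opprB; ring.
Qed.

Lemma residualE n e f :
  residual n e f = (fun x => f x - lincomb n (fun k => ip f (e k)) e x).
Proof. by []. Qed.

Lemma ph_residual n e f : (forall k, (k < n)%N -> P (e k)) -> P f ->
  P (residual n e f).
Proof. by move=> Pe Pf; rewrite residualE; apply: phB => //; exact: ph_lincomb. Qed.

Lemma qn_residual n e f : orthonormal_upto n e -> P f ->
  qn (residual n e f) = qn f - \sum_(k < n) sqn (ip f (e k)).
Proof.
move=> oe Pf; rewrite residualE qn_sub_lincomb//.
by rewrite [X in _ + X]big1 ?addr0// => k _; rewrite subrr sqn0.
Qed.

Lemma bessel n e f : orthonormal_upto n e -> P f ->
  \sum_(k < n) sqn (ip f (e k)) <= qn f.
Proof.
move=> oe Pf; rewrite -subr_ge0 -qn_residual//; apply: qn_ge0.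
by apply: ph_residual => //; case: oe.
Qed.

(** The parallelogram law for a and -a with the term for -a dropped; it replaces the triangle
    inequality and avoids square roots. *)
Lemma qnD_le a f g : P f -> P g ->
  qn (fun x => a * f x + g x) <= 2 * sqn a * qn f + 2 * qn g.
Proof.
move=> Pf Pg.
have H b : qn (fun x => b * f x + g x) =
    sqn b * qn f + 2 * complex.Re (b * ip f g) + qn g.
  have Pl := ph_lin ph b Pf Pg.
  rewrite {1}/qn (ph_ipl ph)// (ph_conj ph Pl Pf) (ph_conj ph Pl Pg).
  rewrite !(ph_ipl ph)// (qnE Pf) (qnE Pg) (ph_conj ph Pf Pg).
  case: b {Pl} (ip f g) => [b1 b2] [x y]; rewrite /sqn /=; ring.
have := qn_ge0 (ph_lin ph (- a) Pf Pg).
rewrite !H sqnN mulNr.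
have -> : complex.Re (- (a * ip f g)) = - complex.Re (a * ip f g).
  by case: (a * _).
lra.
Qed.

Lemma residual_lin n e a f g : (forall k, (k < n)%N -> P (e k)) ->
  P f -> P g -> residual n e (fun x => a * f x + g x) =
  (fun x => a * residual n e f x + residual n e g x).
Proof.
move=> Pe Pf Pg; apply/funext => x; rewrite /residual.
under eq_bigr => k _ do rewrite (ph_ipl ph _ Pf Pg (Pe k (ltn_ord k))) mulrDl -mulrA.
by rewrite big_split /= -mulr_sumr; ring.
Qed.

Lemma qn_residualD_le n e a f g : orthonormal_upto n e -> P f -> P g ->
  qn (residual n e (fun x => a * f x + g x)) <=
  2 * sqn a * qn (residual n e f) + 2 * qn (residual n e g).
Proof.
move=> [Pe _] Pf Pg; rewrite residual_lin//.
by apply: qnD_le; apply: ph_residual.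
Qed.

(** The residual map is linear and kills the combinations of the [g k] with k < N, so it sees only
    the approximation error, on which it does not increase the norm. The factor 2 comes from
    [qnD_le]. *)
Lemma qn_residual_approx N n c e (g : nat -> F) f :
  orthonormal_upto n e -> (forall k, P (g k)) -> P f ->
  (forall k, (k < N)%N -> qn (residual n e (g k)) = 0) ->
  qn (residual n e f) <= 2 * qn (fun x => f x - lincomb N c g x).
Proof.
move=> oe Pg Pf g0.
have Pl M := @ph_lincomb M c g (fun k _ => Pg k).
have lc0 : qn (residual n e (lincomb N c g)) <= 0.
  elim: N g0 => [|N IH] g0.
    rewrite qn_residual//.
    have -> : lincomb 0 c g = (fun=> 0).
      by apply/funext => x; rewrite /lincomb big_ord0.
    have P0 := ph0 ph; rewrite big1 ?subr0 /qn ?ip0l// => k _.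
    by rewrite ip0l ?sqn0//; case: oe => + _; apply.
  have -> : lincomb N.+1 c g = (fun x => c N * g N x + lincomb N c g x).
    by apply/funext => x; rewrite /lincomb big_ord_recr /= addrC.
  have := qn_residualD_le (c N) oe (Pg N) (Pl N).
  rewrite (g0 N)// mulr0 add0r => /le_trans; apply.
  by rewrite pmulr_rle0// IH// => k kN; rewrite g0// ltnW.
have := qn_residualD_le 1 oe (phB Pf (Pl N)) (Pl N).
rewrite (_ : (fun x => _) = f); last first.
  by apply/funext => x; rewrite mul1r subrK.
have -> : sqn (1 : C) = 1 by rewrite /sqn /= expr1n expr0n /= addr0.
move/le_trans; apply.
have : qn (residual n e (fun x => f x - lincomb N c g x)) <=
    qn (fun x => f x - lincomb N c g x).
  rewrite qn_residual//; last exact: phB.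
  by rewrite lerBlDr lerDl sumr_ge0// => k _; exact: sqn_ge0.
lra.
Qed.

(** * Gram-Schmidt along a total sequence *)

Hypothesis infinite_dim : forall n, exists u, orthonormal_upto n u.
Variable g : nat -> F.
Hypothesis Pg : forall k, P (g k).
Hypothesis total : forall f (eps : R), P f -> 0 < eps ->
  exists n c, qn (fun x => f x - lincomb n c g x) <= eps.

(* If all residuals vanished, an orthonormal system of n+1 vectors would lie in
   the closed span of n orthonormal ones, against Bessel's inequality. *)
Lemma exists_residual n e : orthonormal_upto n e ->
  exists k, 0 < qn (residual n e (g k)).
Proof.
move=> oe; apply: contrapT => /forallNP none.
have g0 k : qn (residual n e (g k)) = 0.
  apply/eqP; rewrite eq_le qn_ge0 ?andbT; last first.
    by apply: ph_residual => //; case: oe.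
  by rewrite leNgt; apply/negP/none.
have [u [Pu ou]] := infinite_dim n.+1.
have u1 j : (j < n.+1)%N -> 1 <= \sum_(k < n) sqn (ip (u j) (e k)).
  move=> jn; apply/ler_addgt0Pr => eps eps0.
  have eps20 : 0 < eps / 2 by rewrite divr_gt0.
  have [N [c Hc]] := total (Pu j jn) eps20.
  have := qn_residual_approx c oe Pg (Pu j jn) (fun k (_ : (k < N)%N) => g0 k).
  rewrite qn_residual//; last exact: Pu.
  have -> : qn (u j) = 1 by rewrite /qn ou// eqxx.
  lra.
have H1 : n.+1%:R <= \sum_(j < n.+1) \sum_(k < n) sqn (ip (u j) (e k)).
  rewrite -[X in X%:R](card_ord n.+1) -sum1_card natr_sum.
  by apply: ler_sum => j _; exact: u1.
have H2 : \sum_(j < n.+1) \sum_(k < n) sqn (ip (u j) (e k)) <= n%:R.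
  rewrite exchange_big /= -[X in X%:R](card_ord n) -sum1_card natr_sum.
  apply: ler_sum => k _; case: oe => Pe oe.
  under eq_bigr => j _ do
    rewrite (ph_conj ph (Pe k (ltn_ord k)) (Pu j (ltn_ord j))) sqn_conj.
  by apply: le_trans (bessel (conj Pu ou) (Pe k _)) _ => //; rewrite /qn oe// eqxx.
by have := le_trans H1 H2; rewrite ler_nat ltnn.
Qed.

(** Taking the least index, not just any, is what makes the procedure exhaust the generators in
    order. The default 0 lets the recursion be defined before orthonormality is known, on which
    existence of an index depends. *)
Definition first_pos (r : nat -> R) : nat :=
  if pselect (exists k, 0 < r k) is left H then ex_minn H else 0.

Definition first_residual n e : nat :=
  first_pos (fun k => qn (residual n e (g k))).

Definition gs_next n e : F :=
  let r := residual n e (g (first_residual n e)) in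
  fun x => ((Num.sqrt (qn r))^-1)%:C%C * r x.

(** Each step needs all earlier vectors, so a stage carries the whole initial segment; [gs] reads
    the diagonal, and [gsE] recovers the recursive equation. *)
Fixpoint gs_stage n : nat -> F :=
  if n is m.+1 then
    fun i => if i == m then gs_next m (gs_stage m) else gs_stage m i
  else fun=> fun=> 0.

Definition gs n : F := gs_stage n.+1 n.

Lemma gs_stageE m i : (i < m)%N -> gs_stage m i = gs i.
Proof.
elim: m => // m IH; rewrite ltnS leq_eqVlt => /predU1P[->//|im].
by rewrite /= (ltn_eqF im) IH.
Qed.

Lemma eq_residual n e e' f : (forall k, (k < n)%N -> e k = e' k) ->
  residual n e f = residual n e' f.
Proof.
move=> ee'; apply/funext => x; rewrite /residual; congr (_ - _).
by apply: eq_bigr => k _; rewrite ee'.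
Qed.

Definition gs_index n := first_residual n gs.

Lemma gsE n : gs n = gs_next n gs.
Proof.
have E f : residual n (gs_stage n) f = residual n gs f.
  by apply: eq_residual => k; exact: gs_stageE.
rewrite /gs /= eqxx /gs_next.
have -> : first_residual n (gs_stage n) = first_residual n gs.
  by congr first_pos; apply/funext => k; rewrite E.
by rewrite E.
Qed.

Lemma gs_indexP n : orthonormal_upto n gs ->
  0 < qn (residual n gs (g (gs_index n))) /\
  forall k, (k < gs_index n)%N -> qn (residual n gs (g k)) = 0.
Proof.
move=> oe; rewrite /gs_index /first_residual /first_pos.
case: pselect => [H|[]]; last exact: exists_residual.
case: ex_minnP => m m0 mmin; split => // k km.
apply/eqP; rewrite eq_le qn_ge0 ?andbT; last by apply: ph_residual => //; case: oe.
by rewrite leNgt; apply/negP => /mmin; rewrite leqNgt km.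
Qed.

Lemma gs_orthonormal n : orthonormal_upto n gs.
Proof.
elim: n => [|n oe]; first by split.
have [rpos _] := gs_indexP oe.
set r := residual n gs (g (gs_index n)) in rpos *.
have gsn : gs n = (fun x => ((Num.sqrt (qn r))^-1)%:C%C * r x) by rewrite gsE.
have Pr : P r by apply: ph_residual => //; case: oe.
have Pgn : P (gs n) by rewrite gsn; exact: phZ.
case: (oe) => Pe oe'.
have PS k : (k < n.+1)%N -> P (gs k).
  by rewrite ltnS leq_eqVlt => /predU1P[->//|]; exact: Pe.
have on j : (j < n)%N -> ip (gs n) (gs j) = 0.
  move=> jn; rewrite gsn ph_ipZ//; last exact: Pe.
  rewrite /r residualE ph_ipB//; [|exact: ph_lincomb|exact: Pe].
  rewrite ip_lincombl//; last exact: Pe.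
  rewrite (bigD1 (Ordinal jn))//= oe'// eqxx mulr1 big1 ?addr0 ?subrr ?mulr0//.
  move=> i ij; rewrite oe'// (_ : _ == _ = false) ?mulr0//.
  by apply/negbTE; move: ij; rewrite -val_eqE.
have nn : ip (gs n) (gs n) = 1.
  rewrite gsn ph_ipZ// -?gsn// (ph_conj ph Pgn Pr) gsn ph_ipZ// qnE//.
  rewrite -rmorphM conjc_real -rmorphM mulrA -invfM -expr2 sqr_sqrtr ?ltW//.
  by rewrite mulVf ?gt_eqF.
split; first exact: PS.
move=> i j; rewrite ltnS leq_eqVlt ltnS [(j <= n)%N]leq_eqVlt.
move=> /predU1P[->|ilt] /predU1P[->|jlt].
- by rewrite eqxx nn.
- by rewrite on// gtn_eqF.
- by rewrite (ph_conj ph Pgn (Pe _ ilt)) on// conjc0 ltn_eqF.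
- exact: oe'.
Qed.

Lemma qn_residual_anti m n f : P f -> (m <= n)%N ->
  qn (residual n gs f) <= qn (residual m gs f).
Proof.
move=> Pf mn; have om := gs_orthonormal m; have on := gs_orthonormal n.
rewrite !qn_residual// lerD2l lerN2 -!(big_mkord xpredT (fun k => sqn (ip f (gs k)))).
by rewrite [leRHS](big_cat_nat (leq0n m) mn)/= lerDl sumr_ge0// => k _; exact: sqn_ge0.
Qed.

(** The chosen indices increase strictly: after step n every generator up to [gs_index n] has
    residual 0, and residuals never grow. *)
Lemma gs_index_ge n : (n <= gs_index n)%N.
Proof.
elim: n => // n IH; apply: leq_ltn_trans IH _.
have on := gs_orthonormal n; have oS := gs_orthonormal n.+1.
have [rpos r0] := gs_indexP on; have [rpos' _] := gs_indexP oS.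
rewrite ltnNge; apply/negP; rewrite leq_eqVlt => /predU1P[E|lt]; last first.
  have := lt_le_trans rpos' (qn_residual_anti (Pg (gs_index n.+1)) (leqnSn n)).
  by rewrite r0 ?ltxx.
move: rpos'; rewrite {}E.
pose a := g (gs_index n); pose r := residual n gs a.
rewrite -/a -/r in rpos *.
have Pr : P r := ph_residual (proj1 on) (Pg _).
have gsn x : r x = (Num.sqrt (qn r))%:C%C * gs n x.
  rewrite gsE /gs_next -/(gs_index n) -/a -/r mulrA -rmorphM /=.
  by rewrite divff ?mul1r// gt_eqF// sqrtr_gt0.
suff : qn (residual n.+1 gs a) <= 0 by move=> /le_lt_trans/[apply]; rewrite ltxx.
(* These coefficients represent the generator chosen at step n exactly, by the normalization of
   [gs n]. *)
pose c k := if k == n then (Num.sqrt (qn r))%:C%C else ip a (gs k).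
have := qn_sub_lincomb c oS (Pg (gs_index n)).
have -> : (fun x => a x - lincomb n.+1 c gs x) = (fun=> 0).
  apply/funext => x; rewrite /lincomb big_ord_recr /= {2}/c eqxx -gsn.
  under eq_bigr => k _ do rewrite /c ltn_eqF//.
  by rewrite /r /residual; ring.
rewrite qn_residual//; last exact: Pg.
rewrite {1}/qn ip0l ?ph0//=; last exact: (ph0 ph).
have : 0 <= \sum_(k < n.+1) sqn (ip a (gs k) - c k).
  by apply: sumr_ge0 => k _; exact: sqn_ge0.
rewrite -/a; lra.
Qed.

(** By [gs_index_ge] the first N generators have residual 0 from stage N on, so an approximation by
    them, to within eps / 2, controls all later residuals. *)
Lemma gs_complete f (eps : R) : P f -> 0 < eps ->
  exists N, forall n, (N <= n)%N -> qn (residual n gs f) <= eps.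
Proof.
move=> Pf eps0; have eps20 : 0 < eps / 2 by rewrite divr_gt0.
have [N [c Hc]] := total Pf eps20; exists N => n Nn.
have on := gs_orthonormal n; have [_ r0] := gs_indexP on.
have g0 k : (k < N)%N -> qn (residual n gs (g k)) = 0.
  move=> kN; apply: r0; apply: leq_trans kN _.
  exact: leq_trans Nn (gs_index_ge n).
have := qn_residual_approx c on Pg Pf g0; lra.
Qed.

End prehilbert.

(** * Complex-valued integrals *)

Section complex_measurability.
Context d (T : measurableType d) (R : realType).
Local Notation C := R[i].
Implicit Types (f g : T -> C).

Lemma measurable_Re : measurable_fun setT (@complex.Re R).
Proof. exact: measurableT_comp measurable_fst (@measurable_pair_of_complex R). Qed.

Lemma measurable_Im : measurable_fun setT (@complex.Im R).
Proof. exact: measurableT_comp measurable_snd (@measurable_pair_of_complex R). Qed.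

Lemma measurable_fun_complexP f : measurable_fun setT f <->
  measurable_fun setT (fun x => complex.Re (f x)) /\
  measurable_fun setT (fun x => complex.Im (f x)).
Proof.
split=> [mf|[mre mim]].
  by split; [apply: measurableT_comp measurable_Re mf|
             apply: measurableT_comp measurable_Im mf].
rewrite (_ : f = @complex_of_pair R \o
  (fun x => (complex.Re (f x), complex.Im (f x)))); last first.
  by apply/funext => x /=; case: (f x).
apply: measurableT_comp (@measurable_complex_of_pair R) _.
exact: measurable_fun_pair.
Qed.

Lemma measurable_fun_Re f : measurable_fun setT f ->
  measurable_fun setT (fun x => complex.Re (f x)).
Proof. by case/measurable_fun_complexP. Qed.

Lemma measurable_fun_Im f : measurable_fun setT f ->
  measurable_fun setT (fun x => complex.Im (f x)).
Proof. by case/measurable_fun_complexP. Qed.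

Lemma measurable_cfunD f g : measurable_fun setT f -> measurable_fun setT g ->
  measurable_fun setT (fun x => f x + g x).
Proof.
move=> /measurable_fun_complexP[fr fi] /measurable_fun_complexP[gr gi].
apply/measurable_fun_complexP; split.
  rewrite (_ : (fun _ => _) = (fun x => complex.Re (f x) + complex.Re (g x))).
    exact: measurable_funD.
  by apply/funext => x; case: (f x) (g x) => [a b] [a' b'].
rewrite (_ : (fun _ => _) = (fun x => complex.Im (f x) + complex.Im (g x))).
  exact: measurable_funD.
by apply/funext => x; case: (f x) (g x) => [a b] [a' b'].
Qed.

Lemma measurable_cfunM f g : measurable_fun setT f -> measurable_fun setT g ->
  measurable_fun setT (fun x => f x * g x).
Proof.
move=> /measurable_fun_complexP[fr fi] /measurable_fun_complexP[gr gi].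
apply/measurable_fun_complexP; split.
  rewrite (_ : (fun _ => _) = (fun x => complex.Re (f x) * complex.Re (g x) -
    complex.Im (f x) * complex.Im (g x))).
    by apply: measurable_funB; exact: measurable_funM.
  by apply/funext => x; case: (f x) (g x) => [a b] [a' b'].
rewrite (_ : (fun _ => _) = (fun x => complex.Re (f x) * complex.Im (g x) +
    complex.Im (f x) * complex.Re (g x))).
  by apply: measurable_funD; exact: measurable_funM.
by apply/funext => x; case: (f x) (g x) => [a b] [a' b'].
Qed.

Lemma measurable_cfun_conj f : measurable_fun setT f ->
  measurable_fun setT (fun x => conjc (f x)).
Proof.
move=> /measurable_fun_complexP[fr fi].
apply/measurable_fun_complexP; split.
  rewrite (_ : (fun _ => _) = (fun x => complex.Re (f x)))//.
  by apply/funext => x; case: (f x).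
rewrite (_ : (fun _ => _) = (fun x => - complex.Im (f x))).
  exact: measurable_funN.
by apply/funext => x; case: (f x).
Qed.

Lemma measurable_cfunN f : measurable_fun setT f ->
  measurable_fun setT (fun x => - f x).
Proof.
move=> mf; rewrite (_ : (fun _ => _) = (fun x => (-1) * f x)).
  by apply: measurable_cfunM => //; exact: measurable_cst.
by apply/funext => x; rewrite mulN1r.
Qed.

Lemma measurable_cfunB f g : measurable_fun setT f -> measurable_fun setT g ->
  measurable_fun setT (fun x => f x - g x).
Proof.
by move=> mf mg; apply: measurable_cfunD => //; exact: measurable_cfunN.
Qed.

Lemma measurable_sqn f : measurable_fun setT f ->
  measurable_fun setT (fun x => sqn (f x)).
Proof.
move=> /measurable_fun_complexP[fr fi].
by apply: measurable_funD; exact: measurable_funX.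
Qed.

Lemma measurable_normc f : measurable_fun setT f ->
  measurable_fun setT (fun x => normc (f x)).
Proof.
move=> mf; rewrite (_ : (fun _ => _) = (fun x => Num.sqrt (sqn (f x)))).
  apply: (measurableT_comp (continuous_measurable_fun (@sqrt_continuous R))).
  exact: measurable_sqn.
by apply/funext => x; rewrite sqnE sqrtr_sqr ger0_norm// normc_ge0.
Qed.

Lemma measurable_real_complex (f : T -> R) : measurable_fun setT f ->
  measurable_fun setT (fun x => (f x)%:C%C).
Proof. by move=> mf; apply/measurable_fun_complexP; split. Qed.

End complex_measurability.

Lemma sqr_Re_le (R : realType) (u : R[i]) : complex.Re u ^+ 2 <= sqn u.
Proof. by rewrite lerDl sqr_ge0. Qed.

Lemma sqr_Im_le (R : realType) (u : R[i]) : complex.Im u ^+ 2 <= sqn u.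
Proof. by rewrite lerDr sqr_ge0. Qed.

Lemma norm_Re_le (R : realType) (u : R[i]) : `|complex.Re u| <= normc u.
Proof.
by rewrite -ler_sqr ?nnegrE ?normc_ge0// -sqnE real_normK ?num_real// sqr_Re_le.
Qed.

Lemma norm_Im_le (R : realType) (u : R[i]) : `|complex.Im u| <= normc u.
Proof.
by rewrite -ler_sqr ?nnegrE ?normc_ge0// -sqnE real_normK ?num_real// sqr_Im_le.
Qed.

Section complex_integral.
Context d (T : measurableType d) (R : realType) (m : {measure set T -> \bar R}).
Local Notation C := R[i].
Implicit Types (f g h : T -> C).

Definition Cint f : C := Complex (\int[m]_x complex.Re (f x))
                                 (\int[m]_x complex.Im (f x)).

Definition cintegrable f : Prop :=
  m.-integrable setT (fun x => (complex.Re (f x))%:E) /\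
  m.-integrable setT (fun x => (complex.Im (f x))%:E).

Lemma cintegrable_measurable f : cintegrable f -> measurable_fun setT f.
Proof.
move=> [/measurable_int r /measurable_int i].
by apply/measurable_fun_complexP; split; exact/measurable_EFinP.
Qed.

Lemma dominated_cintegrable f (g : T -> R) : measurable_fun setT f ->
  m.-integrable setT (EFin \o g) -> (forall x, normc (f x) <= g x) ->
  cintegrable f.
Proof.
move=> mf ig fg; split.
  apply: (le_integrable measurableT _ _ ig).
    exact/measurable_EFinP/measurable_fun_Re.
  move=> x _ /=; rewrite lee_fin (le_trans (norm_Re_le _))//.
  exact: le_trans (fg x) (ler_norm _).
apply: (le_integrable measurableT _ _ ig).
  exact/measurable_EFinP/measurable_fun_Im.
move=> x _ /=; rewrite lee_fin (le_trans (norm_Im_le _))//.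
exact: le_trans (fg x) (ler_norm _).
Qed.

Lemma normc_le_add (u : C) : normc u <= `|complex.Re u| + `|complex.Im u|.
Proof.
rewrite -ler_sqr ?nnegrE ?normc_ge0 ?addr_ge0// -sqnE sqrrD.
rewrite !real_normK ?num_real// /sqn -addrA [X in _ <= _ + X]addrC addrA.
by rewrite lerDl mulrn_wge0// mulr_ge0.
Qed.

Lemma cintegrable_normc f : cintegrable f ->
  m.-integrable setT (fun x => (normc (f x))%:E).
Proof.
move=> icf; have mf := cintegrable_measurable icf; have [ir ii] := icf.
apply: (le_integrable measurableT _ _
  (integrableD measurableT (integrable_norm ir) (integrable_norm ii))).
  exact/measurable_EFinP/measurable_normc.
move=> x _ /=; rewrite lee_fin [leLHS]ger0_norm ?normc_ge0//.
by rewrite ger0_norm ?addr_ge0// normc_le_add.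
Qed.

Lemma cintegrable_lin a f g : cintegrable f -> cintegrable g ->
  cintegrable (fun x => a * f x + g x).
Proof.
move=> icf icg; have mf := cintegrable_measurable icf.
have mg := cintegrable_measurable icg.
have nf := cintegrable_normc icf; have ng := cintegrable_normc icg.
have := integrableD measurableT (integrableZl measurableT (normc a) nf) ng.
move=> H; apply: (dominated_cintegrable (g := fun x => normc a * normc (f x) + normc (g x)) _ H) => //.
  by apply: measurable_cfunD => //; apply: measurable_cfunM => //; exact: measurable_cst.
by move=> x; rewrite -ComplexField.Normc.normcM; exact: le_normcD.
Qed.

Lemma cintegrable0 : cintegrable (fun=> 0).
Proof. by split; exact: integrable0. Qed.

Lemma cintegrableZ a f : cintegrable f -> cintegrable (fun x => a * f x).
Proof.
move=> icf; have := cintegrable_lin a icf cintegrable0.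
by congr cintegrable; apply/funext => x; rewrite addr0.
Qed.

Lemma cintegrable_conj f : cintegrable f -> cintegrable (fun x => conjc (f x)).
Proof.
move=> icf; have mf := cintegrable_measurable icf.
apply: (dominated_cintegrable _ (cintegrable_normc icf)).
  exact: measurable_cfun_conj.
by move=> x; rewrite normc_conj.
Qed.

Lemma eq_Cint f g : f =1 g -> Cint f = Cint g.
Proof. by move=> fg; congr Cint; apply/funext. Qed.

Lemma integrable_funZ (k : R) (f : T -> R) : m.-integrable setT (EFin \o f) ->
  m.-integrable setT (EFin \o (fun x => k * f x)).
Proof. by move=> fi; have := integrableZl measurableT k fi. Qed.

Lemma integrable_funD (f g : T -> R) : m.-integrable setT (EFin \o f) ->
  m.-integrable setT (EFin \o g) ->
  m.-integrable setT (EFin \o (fun x => f x + g x)).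
Proof. by move=> fi gi; have := integrableD measurableT fi gi. Qed.

Lemma integrable_funB (f g : T -> R) : m.-integrable setT (EFin \o f) ->
  m.-integrable setT (EFin \o g) ->
  m.-integrable setT (EFin \o (fun x => f x - g x)).
Proof. by move=> fi gi; have := integrableB measurableT fi gi. Qed.

Lemma Cint_lin a f g : cintegrable f -> cintegrable g ->
  Cint (fun x => a * f x + g x) = a * Cint f + Cint g.
Proof.
move=> [fr fi] [gr gi]; case: a => a b; rewrite /Cint /=; congr Complex.
  have -> : (fun x => complex.Re (Complex a b * f x + g x)) =
    (fun x => (a * complex.Re (f x) - b * complex.Im (f x)) + complex.Re (g x)).
    by apply/funext => x; case: (f x) (g x) => [? ?] [? ?].
  rewrite RintegralD//; last by apply: integrable_funB; exact: integrable_funZ.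
  by rewrite RintegralB// ?RintegralZl//; exact: integrable_funZ.
have -> : (fun x => complex.Im (Complex a b * f x + g x)) =
  (fun x => (a * complex.Im (f x) + b * complex.Re (f x)) + complex.Im (g x)).
  by apply/funext => x; case: (f x) (g x) => [? ?] [? ?].
rewrite RintegralD//; last by apply: integrable_funD; exact: integrable_funZ.
by rewrite RintegralD// ?RintegralZl//; exact: integrable_funZ.
Qed.

Lemma Cint0 : Cint (fun=> 0) = 0.
Proof.
by rewrite /Cint /= Rintegral_cst// mul0r.
Qed.

Lemma CintZ a f : cintegrable f -> Cint (fun x => a * f x) = a * Cint f.
Proof.
move=> icf; rewrite -[RHS]addr0 -[X in _ = _ + X]Cint0 -Cint_lin//; last exact: cintegrable0.
by apply: eq_Cint => x; rewrite addr0.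
Qed.

Lemma Cint_conj f : cintegrable f -> Cint (fun x => conjc (f x)) = conjc (Cint f).
Proof.
move=> [fr fi]; rewrite /Cint /=; congr Complex.
  by apply: eq_Rintegral => x _; case: (f x).
rewrite -mulN1r -RintegralZl//; apply: eq_Rintegral => x _.
by case: (f x) => ? ? /=; rewrite mulN1r.
Qed.

(** Multiplying by the conjugate of the integral I makes the left side real: |I|^2 is the real part
    of the integral of conj(I) f, hence at most |I| times the integral of |f|. The case I = 0 is
    apart because |I| is cancelled. *)
Lemma normc_Cint f : cintegrable f -> normc (Cint f) <= \int[m]_x normc (f x).
Proof.
move=> icf; set I := Cint f.
have := cintegrable_normc icf => inf.
have [->|I0] := eqVneq (normc I) 0.
  by apply: Rintegral_ge0 => x _; exact: normc_ge0.
have Ipos : 0 < normc I by rewrite lt_neqAle eq_sym I0 normc_ge0.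
rewrite -(ler_pM2l Ipos).
have -> : normc I * normc I = complex.Re (Cint (fun x => conjc I * f x)).
  rewrite CintZ// -/I [conjc I * _]mulrC -sqn_mulJ sqnE /=.
  by rewrite expr2.
rewrite -RintegralZl//.
apply: le_trans (ler_norm _) _.
have icIf := cintegrableZ (conjc I) icf.
apply: le_trans (le_normr_Rintegral _ (proj1 icIf)) _ => //.
apply: le_Rintegral => //.
- exact: integrable_norm (proj1 icIf).
- exact: integrable_funZ.
move=> x _; apply: le_trans (norm_Re_le _) _.
by rewrite ComplexField.Normc.normcM normc_conj.
Qed.

Definition L2 f : Prop := measurable_fun setT f /\
  m.-integrable setT (fun x => (sqn (f x))%:E).

Definition L2ip f g : C := Cint (fun x => f x * conjc (g x)).

Lemma L2_le f (g : T -> R) : measurable_fun setT f ->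
  m.-integrable setT (EFin \o g) -> (forall x, sqn (f x) <= g x) -> L2 f.
Proof.
move=> mf ig fg; split => //; apply: (le_integrable measurableT _ _ ig).
  exact/measurable_EFinP/measurable_sqn.
move=> x _ /=; rewrite lee_fin ger0_norm ?sqn_ge0//.
exact: le_trans (fg x) (ler_norm _).
Qed.

Lemma L2_mul f g : L2 f -> L2 g -> cintegrable (fun x => f x * conjc (g x)).
Proof.
move=> [mf lf] [mg lg].
have := integrableD measurableT lf lg.
move=> H; apply: (dominated_cintegrable (g := fun x => sqn (f x) + sqn (g x)) _ H) => //.
  by apply: measurable_cfunM => //; exact: measurable_cfun_conj.
move=> x; rewrite ComplexField.Normc.normcM normc_conj !sqnE.
have := sqr_ge0 (normc (f x) - normc (g x)).
have := sqr_ge0 (normc (f x) + normc (g x)).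
nra.
Qed.

Lemma L2_lin a f g : L2 f -> L2 g -> L2 (fun x => a * f x + g x).
Proof.
move=> [mf lf] [mg lg].
have := integrableD measurableT (integrableZl measurableT (2 * sqn a) lf)
                    (integrableZl measurableT 2 lg).
move=> H; apply: (L2_le (g := fun x => (2 * sqn a) * sqn (f x) + 2 * sqn (g x)) _ H) => //.
  by apply: measurable_cfunD => //; apply: measurable_cfunM => //; exact: measurable_cst.
by move=> x; rewrite (le_trans (sqnD_le _ _))// sqnM mulrA.
Qed.

Lemma L2ip_sqn f : L2ip f f = (\int[m]_x sqn (f x))%:C%C.
Proof.
rewrite /L2ip /Cint; congr Complex.
  by apply: eq_Rintegral => x _; rewrite -sqn_mulJ.
rewrite -[RHS](mul0r (fine (m setT))) -Rintegral_cst//.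
by apply: eq_Rintegral => x _; rewrite -sqn_mulJ.
Qed.

Lemma L2_prehilbert : prehilbert L2 L2ip.
Proof.
split.
- by split; [exact: measurable_cst|rewrite sqn0; exact: integrable0].
- by move=> a f g; exact: L2_lin.
- move=> a f g h Lf Lg Lh; rewrite /L2ip -Cint_lin; [|exact: L2_mul..].
  by apply: eq_Cint => x; rewrite mulrDl mulrA.
- move=> f g Lf Lg; rewrite /L2ip -Cint_conj; last exact: L2_mul.
  by apply: eq_Cint => x; rewrite rmorphM /= conjcK mulrC.
- move=> f Lf; rewrite L2ip_sqn /=; apply: Rintegral_ge0 => x _; exact: sqn_ge0.
Qed.

Lemma L2_qn f : L2 f -> (qn L2ip f)%:E = (\int[m]_x (sqn (f x))%:E)%E.
Proof.
move=> [_ lf]; rewrite /qn L2ip_sqn /= /Rintegral fineK//.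
exact: integrable_fin_num.
Qed.

End complex_integral.

(** * The normalized measure of the ball *)

Section ball_measure.
Variables (R : realType) (d : nat).
Local Notation Cd := (d.-tuple R[i]).
Local Notation v := (@vball R d).
Local Notation B := (@unit_ball R d).

(* If the ball had infinite measure then [ball_volume = fine +oo = 0] and
   [vball = 0]. *)
Lemma vball_fin : fin_num_fun v.
Proof.
apply: lty_fin_num_fun; rewrite /= /mscale /= /mrestr setTI /ball_volume.
case: (lebesgue_measureCn R d _) => [r||]/=; first by rewrite -EFinM ltry.
  by rewrite invr0 mul0e.
by rewrite invr0 mul0e.
Qed.

(** A second name for the measure, to which the finite-measure structure used for product measures
    is attached. *)
Definition vfin : set Cd -> \bar R := v.

HB.instance Definition _ := Measure.copy vfin v.
HB.instance Definition _ := Measure_isFinite.Build _ _ _ vfin vball_fin.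

Definition vbf : {finite_measure set Cd -> \bar R} := vfin.

Lemma vbfE : (vbf : {measure set Cd -> \bar R}) = v.
Proof. by []. Qed.

Lemma vball_setC : v (~` B) = 0%E.
Proof. by rewrite /= /mscale /= /mrestr setICl measure0 mule0. Qed.

Lemma vball_setT : v setT = v B.
Proof. by rewrite /= /mscale /= /mrestr setTI setIid. Qed.

Implicit Types (f g : Cd -> R[i]).

(** Integrals over the ball become integrals over the whole space, and measurability on the ball
    becomes measurability everywhere. *)
Definition rB f : Cd -> R[i] := f \_ B.

Lemma rB_in f z : B z -> rB f z = f z.
Proof. by move=> Bz; rewrite /rB patchE mem_set. Qed.

Lemma rB_out f z : ~ B z -> rB f z = 0.
Proof. by move=> Bz; rewrite /rB patchE memNset. Qed.

Lemma rB_comp (h : R[i] -> R) f : h 0 = 0 ->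
  (fun z => h (rB f z)) = (fun z => h (f z)) \_ B.
Proof.
move=> h0; apply/funext => z; rewrite patchE; case: ifPn => [|] zB.
  by rewrite rB_in//; exact: set_mem.
by rewrite rB_out ?h0//; move/negP: zB => + /mem_set.
Qed.

Lemma rB_lin a f g :
  rB (fun z => a * f z + g z) = (fun z => a * rB f z + rB g z).
Proof.
apply/funext => z; have [zB|zB] := pselect (B z); first by rewrite !rB_in.
by rewrite !rB_out// mulr0 addr0.
Qed.

Lemma measurable_rB f : measurable_fun B f <-> measurable_fun setT (rB f).
Proof. exact: (measurable_restrictT f (@measurable_unit_ball R d)). Qed.

Lemma Rintegral_rB (h : R[i] -> R) f : h 0 = 0 ->
  \int[v]_(z in B) h (f z) = \int[v]_z h (rB f z).
Proof. by move=> h0; rewrite Rintegral_mkcond (rB_comp f h0). Qed.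

Lemma ball_integralE f : ball_integral f = Cint vbf (rB f).
Proof.
rewrite vbfE /ball_integral /Cint; congr Complex; exact: (Rintegral_rB (h := _)).
Qed.

Lemma innerE f g : inner f g = L2ip vbf (rB f) (rB g).
Proof.
rewrite /inner ball_integralE /L2ip; apply: eq_Cint => z.
have [zB|zB] := pselect (B z); first by rewrite !rB_in.
by rewrite !rB_out// mul0r.
Qed.

Lemma LpNorm2_sqr f : (LpNorm 2%:E f ^+ 2 = \int[vbf]_z (sqn (rB f z))%:E)%E.
Proof.
transitivity (\int[v]_z (sqn (rB f z))%:E)%E; last by [].
rewrite /LpNorm unlock /Lnorm /=.
have -> : (\int[v]_x (`| ((fun z => (normc (f z))%:E) \_ B) x | `^ 2%:R)%E =
          \int[v]_z (sqn (rB f z))%:E)%E.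
  apply: eq_integral => z _; rewrite patchE; case: ifPn => zB.
    rewrite rB_in; last exact: set_mem.
    by rewrite /= ger0_norm ?normc_ge0// sqnE powR_mulrn// normc_ge0.
  rewrite rB_out; last by move/negP: zB => + /mem_set.
  by rewrite abse0 sqn0 /= powR0// pnatr_eq0.
have : (0 <= \int[v]_z (sqn (rB f z))%:E)%E.
  by apply: integral_ge0 => z _; rewrite lee_fin sqn_ge0.
case: (\int[v]_z (sqn (rB f z))%:E)%E => [r| |]//=.
  rewrite lee_fin => r0; rewrite -EFinM -expr2 -powR_mulrn ?powR_ge0// -powRrM.
  by rewrite mulVf ?pnatr_eq0// powRr1.
by move=> _; rewrite invr_eq0 pnatr_eq0 mulyy.
Qed.

Lemma LpNorm2_lty f : ((LpNorm 2%:E f < +oo) = (\int[vbf]_z (sqn (rB f z))%:E < +oo))%E.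
Proof.
rewrite -LpNorm2_sqr; have : (0 <= LpNorm 2%:E f)%E by exact: Lnorm_ge0.
by case: (LpNorm 2%:E f) => [r _|_|]//; rewrite ?ltry // expe2 mulyy.
Qed.

Lemma in_L2P f : in_Lp 2%:E f <-> L2 vbf (rB f).
Proof.
rewrite /in_Lp LpNorm2_lty measurable_rB /L2; split=> -[mf lf]; split => //.
  apply/integrableP; split; first exact/measurable_EFinP/measurable_sqn.
  by under eq_integral => z _ do rewrite gee0_abs ?lee_fin ?sqn_ge0//.
exact: integrable_lty lf.
Qed.

Lemma inner_prehilbert : prehilbert (@in_Lp R d 2%:E) (@inner R d).
Proof.
have [h0 hlin hipl hconj hge0] := L2_prehilbert vbf.
split.
- apply/in_L2P; have := h0; congr L2; apply/funext => z.
  by have [zB|zB] := pselect (B z); [rewrite rB_in|rewrite rB_out].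
- by move=> a f g /in_L2P Lf /in_L2P Lg; apply/in_L2P; rewrite rB_lin; exact: hlin.
- move=> a f g h /in_L2P Lf /in_L2P Lg /in_L2P Lh; rewrite !innerE rB_lin.
  exact: hipl.
- by move=> f g /in_L2P Lf /in_L2P Lg; rewrite !innerE; exact: hconj.
- by move=> f /in_L2P Lf; rewrite innerE; exact: hge0.
Qed.

Lemma qn_inner f : in_Lp 2%:E f ->
  (qn (@inner R d) f)%:E = (\int[vbf]_z (sqn (rB f z))%:E)%E.
Proof. by move=> /in_L2P Lf; rewrite -L2_qn// /qn innerE. Qed.

Lemma LpNorm2E f : in_Lp 2%:E f ->
  LpNorm 2%:E f = (Num.sqrt (qn (@inner R d) f))%:E.
Proof.
move=> Lf; have := LpNorm2_sqr f; rewrite -qn_inner//.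
have := Lf.2; have : (0 <= LpNorm 2%:E f)%E by exact: Lnorm_ge0.
case: (LpNorm 2%:E f) => [r| |]//; rewrite lee_fin => r0 _.
by rewrite -EFin_expe => -[<-]; rewrite sqrtr_sqr ger0_norm.
Qed.

End ball_measure.

(** * Square-integrable kernels *)

Section prehilbert_series.
Variables (R : realType) (T : Type).
Variables (P : (T -> R[i]) -> Prop) (ip : (T -> R[i]) -> (T -> R[i]) -> R[i]).
Hypothesis ph : prehilbert P ip.
Implicit Types (f g : T -> R[i]).

Lemma ph_cauchy_schwarz f g : P f -> P g -> sqn (ip f g) <= qn ip f * qn ip g.
Proof.
move=> Pf Pg.
have H (s : R) : 0 <= qn ip f - 2 * s * sqn (ip f g) + s ^+ 2 * sqn (ip f g) * qn ip g.
  pose a := - (s%:C%C * ip f g).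
  have Pl := ph_lin ph a Pg Pf.
  suff -> : qn ip f - 2 * s * sqn (ip f g) + s ^+ 2 * sqn (ip f g) * qn ip g =
      qn ip (fun x => a * g x + f x) by exact: qn_ge0 Pl.
  rewrite [RHS]/qn (ph_ipl ph)// (ph_conj ph Pl Pf) (ph_conj ph Pl Pg).
  rewrite !(ph_ipl ph)// (qnE ph Pf) (qnE ph Pg) (ph_conj ph Pf Pg) /a.
  case: (ip f g) => x y; rewrite /sqn /=; ring.
have qg := qn_ge0 ph Pg; have qf := qn_ge0 ph Pf; have x0 := sqn_ge0 (ip f g).
have [q0|q0] := eqVneq (qn ip g) 0; last first.
  have qpos : 0 < qn ip g by rewrite lt_neqAle eq_sym q0.
  have := H (qn ip g)^-1.
  rewrite (_ : qn ip f - _ + _ = qn ip f - sqn (ip f g) / qn ip g); last by field.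
  by rewrite subr_ge0 ler_pdivrMr.
rewrite q0 mulr0; have [->//|X0] := eqVneq (sqn (ip f g)) 0.
(* When [qn ip g] is 0 the quadratic in s is affine with slope -2 |<f, g>|^2; this s gives it the
   value -1. *)
have := H ((qn ip f + 1) / (2 * sqn (ip f g))).
rewrite q0 mulr0 addr0.
rewrite (_ : qn ip f - _ = -1); last by field.
by rewrite lerNr oppr0 ler10.
Qed.

Lemma parseval_series (e : nat -> T -> R[i]) f :
  (forall n, orthonormal_upto P ip n e) -> P f ->
  (fun n => qn ip (residual ip n e f)) @ \oo --> (0 : R) ->
  (\sum_(0 <= n <oo) (sqn (ip f (e n)))%:E = (qn ip f)%:E)%E.
Proof.
move=> oe Pf cv; apply/cvg_lim => //.
rewrite (_ : (fun n => _) = EFin \o (fun n => qn ip f - qn ip (residual ip n e f))).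
  apply: cvg_EFin; first exact: nearW.
  rewrite -[X in _ --> X]subr0; apply: cvgB cv; exact: cvg_cst.
apply/funext => n; rewrite /= sumEFin big_mkord; congr EFin.
by rewrite (qn_residual ph (oe n) Pf) opprB addrC subrK.
Qed.

End prehilbert_series.

Section kernel_operator.
Context d (T : measurableType d) (R : realType).
Variable m : {finite_measure set T -> \bar R}.
Local Notation C := R[i].
Variable k : T * T -> C.
Hypothesis mk : measurable_fun setT k.
Hypothesis k2 : (\int[m]_x \int[m]_y (sqn (k (x, y)))%:E < +oo)%E.
Hypothesis ks : forall x, L2 m (fun y => k (x, y)).
Implicit Types f g : T -> C.

(** By [ks], which holds at every x and not only almost everywhere, the integral converges
    absolutely at each x for f in L^2, so linearity is a pointwise statement. *)
Definition Kop f : T -> C := fun x => Cint m (fun y => k (x, y) * f y).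

Let ph := L2_prehilbert m.

Lemma L2_conj f : L2 m f -> L2 m (fun x => conjc (f x)).
Proof.
move=> [mf lf]; split; first exact: measurable_cfun_conj.
by under eq_fun do rewrite sqn_conj.
Qed.

Lemma L2_cintegrable_mul f g : L2 m f -> L2 m g ->
  cintegrable m (fun y => f y * g y).
Proof.
move=> Lf /L2_conj /(L2_mul Lf).
by congr cintegrable; apply/funext => y; rewrite conjcK.
Qed.

Lemma Kop_ip f x : Kop f x = L2ip m (fun y => k (x, y)) (fun y => conjc (f y)).
Proof. by apply: eq_Cint => y; rewrite conjcK. Qed.

Lemma Kop_lin a f g x : L2 m f -> L2 m g ->
  Kop (fun y => a * f y + g y) x = a * Kop f x + Kop g x.
Proof.
move=> Lf Lg; rewrite /Kop -Cint_lin.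
- by apply: eq_Cint => y; ring.
- exact: L2_cintegrable_mul.
- exact: L2_cintegrable_mul.
Qed.

Let mm := (m \x m)%E.

Lemma sqn_kernel_integrable : mm.-integrable setT (fun z => (sqn (k z))%:E).
Proof.
apply/integrable12ltyP; first exact/measurable_EFinP/measurable_sqn.
under eq_integral => x _.
  under eq_integral => y _ do rewrite gee0_abs ?lee_fin ?sqn_ge0//.
  over.
exact: k2.
Qed.

Lemma sqn_tensor_integrable f g : L2 m f -> L2 m g ->
  mm.-integrable setT (fun z => (sqn (f z.1) * sqn (g z.2))%:E).
Proof.
move=> [mf lf] [mg lg]; apply/integrable12ltyP.
  apply/measurable_EFinP/measurable_funM; apply: measurable_sqn.
    exact: measurableT_comp mf measurable_fst.
  exact: measurableT_comp mg measurable_snd.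
have lgi := integrable_lty measurableT lg.
rewrite (_ : (\int[m]_x _)%E = (\int[m]_x ((sqn (f x))%:E * \int[m]_y (sqn (g y))%:E))%E).
  have g0 : (0 <= \int[m]_y (sqn (g y))%:E)%E.
    by apply: integral_ge0 => x _; rewrite lee_fin sqn_ge0.
  rewrite ge0_integralZr//.
  - apply: lte_mul_pinfty => //.
    + by apply: integral_ge0 => x _; rewrite lee_fin sqn_ge0.
    + exact: integrable_fin_num.
  - exact/measurable_EFinP/measurable_sqn.
  - by move=> x _; rewrite lee_fin sqn_ge0.
apply: eq_integral => x _; rewrite -ge0_integralZl//.
- apply: eq_integral => y _.
  by rewrite gee0_abs ?EFinM// lee_fin mulr_ge0// sqn_ge0.
- exact/measurable_EFinP/measurable_sqn.
- by move=> y _; rewrite lee_fin sqn_ge0.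
- by rewrite lee_fin sqn_ge0.
Qed.

Lemma L2_cst (a : C) : L2 m (fun=> a).
Proof.
split; first exact: measurable_cst.
apply/integrableP; split; first exact: measurable_cst.
rewrite integral_cst//= lte_mul_pinfty//.
by rewrite -ge0_fin_numE// fin_num_measure.
Qed.

(** Dominated by |k|^2 + |f|^2 |g|^2. With f = 1 this gives the measurability of [Kop g]; in general
    it justifies the exchange of integrals behind self-adjointness. *)
Lemma triple_cintegrable f g : L2 m f -> L2 m g ->
  cintegrable mm (fun z => k z * g z.2 * conjc (f z.1)).
Proof.
move=> Lf Lg.
have H := integrable_funD sqn_kernel_integrable (sqn_tensor_integrable Lf Lg).
apply: (dominated_cintegrable _ H).
  apply: measurable_cfunM; first apply: measurable_cfunM => //.
    exact: measurableT_comp Lg.1 measurable_snd.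
  apply: measurable_cfun_conj; exact: measurableT_comp Lf.1 measurable_fst.
move=> [x y] /=; rewrite !ComplexField.Normc.normcM normc_conj !sqnE -exprMn.
set a := normc (k _); set b := normc (g y); set c := normc (f x).
have := sqr_ge0 (a - c * b); have := sqr_ge0 (a + c * b); nra.
Qed.

Lemma pair_cintegrable f : L2 m f -> cintegrable mm (fun z => k z * f z.2).
Proof.
move=> Lf; have := triple_cintegrable (L2_cst 1) Lf.
by congr cintegrable; apply/funext => z; rewrite conjc1 mulr1.
Qed.

Lemma measurable_Kop f : L2 m f -> measurable_fun setT (Kop f).
Proof.
move=> /pair_cintegrable[Hr Hi].
have mfine := measurableT_comp (@fine_measurable R setT measurableT).
apply/measurable_fun_complexP; split.
  exact: mfine (measurable_fubini_F Hr).
exact: mfine (measurable_fubini_F Hi).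
Qed.

Lemma sqn_Kop_le f x : L2 m f ->
  ((sqn (Kop f x))%:E <= \int[m]_y (sqn (k (x, y)))%:E * (qn (L2ip m) f)%:E)%E.
Proof.
move=> Lf; rewrite Kop_ip -(L2_qn (ks x)) -EFinM lee_fin.
have -> : qn (L2ip m) f = qn (L2ip m) (fun y => conjc (f y)).
  apply: EFin_inj; rewrite !L2_qn//; last exact: L2_conj.
  by apply: eq_integral => y _; rewrite sqn_conj.
by apply: (ph_cauchy_schwarz ph) => //; exact: L2_conj.
Qed.

Lemma integral_sqn_Kop_le f : L2 m f -> (\int[m]_x (sqn (Kop f x))%:E <=
  (\int[m]_x \int[m]_y (sqn (k (x, y)))%:E) * (qn (L2ip m) f)%:E)%E.
Proof.
move=> Lf.
have mF : measurable_fun setT (fun x => \int[m]_y (sqn (k (x, y)))%:E)%E.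
  apply: (measurable_fun_fubini_tonelli_F (fun z => (sqn (k z))%:E)) => //.
    exact/measurable_EFinP/measurable_sqn.
  by move=> z; rewrite lee_fin sqn_ge0.
have F0 x : (0 <= \int[m]_y (sqn (k (x, y)))%:E)%E.
  by apply: integral_ge0 => y _; rewrite lee_fin sqn_ge0.
have q0 : (0 <= (qn (L2ip m) f)%:E)%E by rewrite lee_fin; exact: qn_ge0 ph _ _.
rewrite -ge0_integralZr//; apply: ge0_le_integral => //.
- by move=> x _; rewrite lee_fin sqn_ge0.
- exact/measurable_EFinP/measurable_sqn/measurable_Kop.
- by apply: emeasurable_funM => //; exact: measurable_cst.
- by move=> x _; exact: sqn_Kop_le.
Qed.

Lemma L2_Kop f : L2 m f -> L2 m (Kop f).
Proof.
move=> Lf; split; first exact: measurable_Kop.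
apply/integrableP; split; first exact/measurable_EFinP/measurable_sqn/measurable_Kop.
under eq_integral => x _ do rewrite gee0_abs ?lee_fin ?sqn_ge0//.
apply: le_lt_trans (integral_sqn_Kop_le Lf) _.
rewrite lte_mul_pinfty ?ltry//.
  by apply: integral_ge0 => x _; apply: integral_ge0 => y _; rewrite lee_fin sqn_ge0.
rewrite ge0_fin_numE//.
by apply: integral_ge0 => x _; apply: integral_ge0 => y _; rewrite lee_fin sqn_ge0.
Qed.

Lemma Cint_fubini (h : T * T -> C) : cintegrable mm h ->
  Cint m (fun x => Cint m (fun y => h (x, y))) =
  Cint m (fun y => Cint m (fun x => h (x, y))).
Proof.
have fubR (u : T * T -> R) : mm.-integrable setT (EFin \o u) ->
    \int[m]_x (\int[m]_y u (x, y)) = \int[m]_y (\int[m]_x u (x, y)).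
  move=> iu; have mu := measurable_int _ iu.
  have F1 := ae_integrable1 iu; have F2 := ae_integrable2 iu.
  rewrite /Rintegral; congr fine.
  transitivity (\int[m]_x fubini_F m (EFin \o u) x)%E.
    apply: ae_eq_integral => //.
    - apply/measurable_EFinP.
      exact: measurableT_comp (@fine_measurable R setT measurableT) (measurable_fubini_F iu).
    - exact: measurable_fubini_F iu.
    - apply: filterS F1 => x ix _; rewrite fineK//.
      exact: integrable_fin_num ix.
  rewrite integral12_prod_meas1// -integral21_prod_meas1//.
  apply: ae_eq_integral => //.
  - exact: measurable_fubini_G iu.
  - apply/measurable_EFinP.
    exact: measurableT_comp (@fine_measurable R setT measurableT) (measurable_fubini_G iu).
  - apply: filterS F2 => y iy _; rewrite fineK//.
    exact: integrable_fin_num iy.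
move=> [/(fubR (fun z => complex.Re (h z))) hr].
move=> /(fubR (fun z => complex.Im (h z))) hi.
by rewrite /Cint -hr -hi.
Qed.

Hypothesis kh : forall x y, k (y, x) = conjc (k (x, y)).

Lemma Kop_selfadjoint f g : L2 m f -> L2 m g ->
  L2ip m (Kop f) g = L2ip m f (Kop g).
Proof.
move=> Lf Lg.
transitivity (Cint m (fun x => Cint m (fun y => k (x, y) * f y * conjc (g x)))).
  apply: eq_Cint => x; rewrite mulrC -CintZ; last exact: L2_cintegrable_mul.
  by apply: eq_Cint => y; rewrite mulrC.
rewrite (Cint_fubini (triple_cintegrable Lg Lf)).
apply: eq_Cint => y; rewrite -Cint_conj; last exact: L2_cintegrable_mul.
rewrite -CintZ; last by apply: cintegrable_conj; exact: L2_cintegrable_mul.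
by apply: eq_Cint => x /=; rewrite rmorphM /= -kh; ring.
Qed.

Section hilbert_schmidt_sum.
Variable e : nat -> T -> C.
Hypothesis oe : forall n, orthonormal_upto (L2 m) (L2ip m) n e.

(** At each x, [Kop (e n) x] is the conjugate of the coefficient of conj k(x, .) along [e n]; the
    sum moves inside by monotone convergence and is then ready for Parseval. *)
Lemma hs_sumE : (\sum_(0 <= n <oo) \int[m]_x (sqn (Kop (e n) x))%:E =
  \int[m]_x \sum_(0 <= n <oo)
    (sqn (L2ip m (fun y => conjc (k (x, y))) (e n)))%:E)%E.
Proof.
have Le n : L2 m (e n) by case: (oe n.+1) => /(_ n (ltnSn n)).
pose F n x := (sqn (Kop (e n) x))%:E.
rewrite -(@integral_nneseries _ _ _ m setT measurableT F).
- apply: eq_integral => x _; apply: eq_eseriesr => n _.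
  rewrite /F -sqn_conj -Cint_conj; last exact: L2_cintegrable_mul.
  by congr (sqn _)%:E; apply: eq_Cint => y; rewrite rmorphM.
- by move=> n; exact/measurable_EFinP/measurable_sqn/measurable_Kop.
- by move=> n x _; rewrite lee_fin sqn_ge0.
Qed.

Lemma conj_kernelE x : (\int[m]_y (sqn (k (x, y)))%:E =
  (qn (L2ip m) (fun y => conjc (k (x, y))))%:E)%E.
Proof.
rewrite L2_qn; last exact: L2_conj.
by apply: eq_integral => y _; rewrite sqn_conj.
Qed.

Lemma hs_sum_eq : (forall x, (fun n => qn (L2ip m)
      (residual (L2ip m) n e (fun y => conjc (k (x, y))))) @ \oo --> (0 : R)) ->
  (\sum_(0 <= n <oo) \int[m]_x (sqn (Kop (e n) x))%:E =
   \int[m]_x \int[m]_y (sqn (k (x, y)))%:E)%E.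
Proof.
move=> comp; rewrite hs_sumE; apply: eq_integral => x _.
rewrite conj_kernelE; apply: parseval_series ph _ _ oe _ _; first exact: L2_conj.
exact: comp.
Qed.

End hilbert_schmidt_sum.

End kernel_operator.

(** * Density and orthonormal bases *)

Section pi_system.
Context (T : Type) (I : countType) (A : I -> set T).

Definition finite_meet (s : seq I) : set T := foldr (fun i X => A i `&` X) setT s.

(** Finite intersections are indexed by lists, and lists by natural numbers through [pickle]:
    Gram-Schmidt needs a sequence and Dynkin's theorem a family closed under intersection. *)
Definition pi_system (n : nat) : set T :=
  if unpickle n is Some s then finite_meet s else setT.

Lemma finite_meet_cat s t : finite_meet (s ++ t) = finite_meet s `&` finite_meet t.
Proof. by elim: s => [|i s IH] /=; rewrite ?setTI// IH setIA. Qed.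

Lemma pi_systemE s : pi_system (pickle s) = finite_meet s.
Proof. by rewrite /pi_system pickleK. Qed.

Lemma pi_systemP n : exists s, pi_system n = finite_meet s.
Proof. by rewrite /pi_system; case: unpickle => [s|]; [exists s|exists [::]]. Qed.

Lemma pi_systemI i j : exists k, pi_system i `&` pi_system j = pi_system k.
Proof.
have [s ->] := pi_systemP i; have [t ->] := pi_systemP j.
by exists (pickle (s ++ t)); rewrite pi_systemE finite_meet_cat.
Qed.

Lemma pi_systemT : exists k, pi_system k = setT.
Proof. by exists (pickle ([::] : seq I)); rewrite pi_systemE. Qed.

Lemma pi_system_gen i : exists k, pi_system k = A i.
Proof. by exists (pickle [:: i]); rewrite pi_systemE /= setIT. Qed.

End pi_system.

Section density.
Context d (T : measurableType d) (R : realType).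
Variable m : {finite_measure set T -> \bar R}.
Local Notation C := R[i].
Local Notation ph := (L2_prehilbert m).
Local Notation qm := (qn (L2ip m)).
Implicit Types f g h : T -> C.

Definition cindic (A : set T) : T -> C := fun x => (\1_A x)%:C%C.

Lemma sqn_real (r : R) : sqn (r%:C%C) = r ^+ 2.
Proof. by rewrite /sqn /= expr0n /= addr0. Qed.

Lemma L2_cindic A : measurable A -> L2 m (cindic A).
Proof.
move=> mA; apply: (L2_le (g := fun=> 1)).
- exact: measurable_real_complex.
- have [_] := L2_cst m (1 : C).
  by rewrite (_ : sqn 1 = 1)// /sqn /= expr1n expr0n addr0.
- move=> x; rewrite sqn_real indicE; by case: (x \in A); rewrite ?expr1n ?expr0n ?ler01.
Qed.

Lemma qm_cindic A : measurable A -> (qm (cindic A))%:E = m A.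
Proof.
move=> mA; rewrite L2_qn; last exact: L2_cindic.
rewrite -[in RHS](setIT A) -integral_indic//; apply: eq_integral => x _.
by rewrite sqn_real indicE; case: (x \in A); rewrite ?expr1n ?expr0n.
Qed.

Variable P : nat -> set T.
Hypothesis mP : forall n, measurable (P n).
Hypothesis PI : forall i j, exists k, P i `&` P j = P k.
Hypothesis PT : exists k, P k = setT.
Hypothesis Pgen : forall A, measurable A -> <<s range P >> A.

Let g n := cindic (P n).

Let Lg n : L2 m (g n). Proof. exact: L2_cindic. Qed.

Definition approximable f := L2 m f /\ forall eps : R, 0 < eps ->
  exists n c, qm (fun x => f x - lincomb n c g x) <= eps.

Let L2lc n c : L2 m (lincomb n c g).
Proof. exact: ph_lincomb ph _ _ _ _. Qed.

Lemma lincomb_pad (n N : nat) (c : nat -> C) (e : nat -> T -> C) : (n <= N)%N ->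
  lincomb n c e = lincomb N (fun k => if (k < n)%N then c k else 0) e.
Proof.
move=> nN; apply/funext => x; rewrite /lincomb (big_ord_widen _ (fun k => c k * e k x) nN).
by rewrite big_mkcond /=; apply: eq_bigr => k _; case: ifP; rewrite ?mul0r.
Qed.

Lemma approximable_lin a f h : approximable f -> approximable h ->
  approximable (fun x => a * f x + h x).
Proof.
move=> [Lf Hf] [Lh Hh]; split; first exact: L2_lin.
move=> eps eps0.
(* The summand 1 keeps s positive when a = 0; each of the two errors contributes at most eps / 2 to
   the bound of [qnD_le]. *)
pose s := 2 * sqn a + 1.
have s0 : 0 < s by rewrite /s; have := sqn_ge0 a; lra.
have [n [c Hc]] := Hf (eps / (2 * s)) ltac:(by rewrite divr_gt0// mulr_gt0).
have [n' [c' Hc']] := Hh (eps / 4) ltac:(by rewrite divr_gt0).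
pose N := maxn n n'.
pose c1 := fun k => if (k < n)%N then c k else 0.
pose c2 := fun k => if (k < n')%N then c' k else 0.
exists N, (fun k => a * c1 k + c2 k).
rewrite (lincomb_pad _ _ (leq_maxl n n')) -/N -/c1 in Hc.
rewrite (lincomb_pad _ _ (leq_maxr n n')) -/N -/c2 in Hc'.
have -> : (fun x => a * f x + h x - lincomb N (fun k => a * c1 k + c2 k) g x) =
  (fun x => a * (f x - lincomb N c1 g x) + (h x - lincomb N c2 g x)).
  apply/funext => x; rewrite /lincomb.
  under eq_bigr => k _ do rewrite mulrDl -mulrA.
  by rewrite big_split /= -mulr_sumr; ring.
apply: le_trans (qnD_le ph _ (phB ph Lf (L2lc _ _)) (phB ph Lh (L2lc _ _))) _.
have q0 := qn_ge0 ph (phB ph Lf (L2lc N c1)).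
have : 2 * sqn a * qm (fun x => f x - lincomb N c1 g x) <= eps / 2.
  apply: (@le_trans _ _ (s * qm (fun x => f x - lincomb N c1 g x))).
    by apply: ler_wpM2r => //; rewrite /s lerDl.
  move: Hc; rewrite -(ler_pM2l s0) => /le_trans; apply.
  by rewrite le_eqVlt; apply/orP; left; apply/eqP; field; rewrite gt_eqF.
lra.
Qed.

Lemma approximable_closed f : L2 m f ->
  (forall eps : R, 0 < eps -> exists2 h, approximable h & qm (fun x => f x - h x) <= eps) ->
  approximable f.
Proof.
move=> Lf H; split => // eps eps0.
have eps4 : 0 < eps / 4 by rewrite divr_gt0.
have [h [Lh Hh] fh] := H _ eps4; have [n [c hc]] := Hh _ eps4.
exists n, c.
have -> : (fun x => f x - lincomb n c g x) =
    (fun x => 1 * (f x - h x) + (h x - lincomb n c g x)).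
  by apply/funext => x; ring.
apply: le_trans (qnD_le ph _ (phB ph Lf Lh) (phB ph Lh (L2lc _ _))) _.
have -> : sqn (1 : C) = 1 by rewrite /sqn /= expr1n expr0n /= addr0.
lra.
Qed.

Lemma approximable0 : approximable (fun=> 0).
Proof.
split; first exact: (ph0 ph).
move=> eps eps0; exists 0, (fun=> 0).
have -> : (fun x => 0 - lincomb 0 (fun=> 0) g x) = (fun=> 0).
  by apply/funext => x; rewrite /lincomb big_ord0 subr0.
by rewrite /qn (ip0l ph (ph0 ph)) ltW.
Qed.

Lemma approximableZ a f : approximable f -> approximable (fun x => a * f x).
Proof.
move=> Hf; have := approximable_lin a Hf approximable0.
by congr approximable; apply/funext => x; rewrite addr0.
Qed.

Lemma approximable_sum (J : Type) (s : seq J) (F : J -> T -> C) :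
  (forall j, approximable (F j)) -> approximable (fun x => \sum_(j <- s) F j x).
Proof.
move=> HF; elim: s => [|j s IH].
  have := approximable0; congr approximable.
  by apply/funext => x; rewrite big_nil.
have := approximable_lin 1 (HF j) IH; congr approximable; apply/funext => x.
by rewrite big_cons mul1r.
Qed.

Lemma approximable_gen n : approximable (g n).
Proof.
split => // eps eps0; exists n.+1, (fun k => (k == n)%:R).
have -> : (fun x => g n x - lincomb n.+1 (fun k => (k == n)%:R) g x) = (fun=> 0).
  apply/funext => x; rewrite /lincomb big_ord_recr /= eqxx mul1r big1 ?add0r ?subrr//.
  by move=> i _; rewrite ltn_eqF// mul0r.
by rewrite /qn (ip0l ph (ph0 ph)) ltW.
Qed.

Lemma cindic_setD (A B : set T) : B `<=` A ->
  cindic (A `\` B) = (fun x => (-1) * cindic B x + cindic A x).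
Proof.
move=> BA; apply/funext => x; rewrite /cindic !indicE in_setD.
have [xB|xB] := boolP (x \in B).
  have -> : x \in A by apply/mem_set/BA/set_mem.
  by rewrite mulN1r addNr.
by rewrite andbT mulr0 add0r.
Qed.

(** Dynkin's pi-lambda theorem. For increasing unions, the squared distance of two nested indicators
    is the mass of the difference, which tends to 0 by continuity from below, m being finite. *)
Lemma approximable_cindic A : measurable A -> approximable (cindic A).
Proof.
move=> mA.
pose H := [set A | measurable A /\ approximable (cindic A)].
suff : <<s range P >> `<=` H by move=> /(_ _ (Pgen mA))[].
apply: lambda_system_subset => //.
- move=> X Y [i _ <-] [j _ <-]; have [k ->] := PI i j; by exists k.
- split => //.
  + by split => //; have [k <-] := PT; exact: approximable_gen.
  + move=> X Y YX [mX HX] [mY HY]; split; first exact: measurableD.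
    by rewrite cindic_setD//; exact: approximable_lin.
  + move=> F ndF HF.
    have mF n : measurable (F n) by case: (HF n).
    have mU : measurable (\bigcup_n F n) by exact: bigcup_measurable.
    split => //; apply: approximable_closed; first exact: L2_cindic.
    move=> eps eps0.
    have FU n : F n `<=` \bigcup_n F n by exact: bigcup_sup.
    have fin X : measurable X -> m X = (fine (m X))%:E.
      by move=> mX; rewrite fineK//; exact: fin_num_measure.
    have : m \o F @ \oo --> (fine (m (\bigcup_n F n)))%:E.
      by rewrite -(fin _ mU); exact: nondecreasing_cvg_mu.
    move/fine_cvgP => [_] /cvgrPdist_le /(_ _ eps0) [N _ /(_ N)] /(_ (leqnn N)) /=.
    move=> Heps; exists (cindic (F N)); first by case: (HF N).
    have -> : (fun x => cindic (\bigcup_n F n) x - cindic (F N) x) =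
        cindic (\bigcup_n F n `\` F N).
      by rewrite cindic_setD//; apply/funext => x; rewrite mulN1r addrC.
    rewrite -lee_fin qm_cindic; last exact: measurableD.
    have lty : (m (\bigcup_n F n) < +oo)%E by rewrite fin// ltry.
    have -> : m (\bigcup_n F n `\` F N) =
        (fine (m (\bigcup_n F n)) - fine (m (F N)))%:E.
      rewrite EFinB -(fin _ mU) -(fin _ (mF N)).
      apply: etrans (measureD mU (mF N) lty) _; congr (_ - m _)%E.
      by rewrite setIC; exact/setIidPl.
    rewrite lee_fin.
    exact: le_trans (ler_norm _) Heps.
- by move=> _ [n _ <-]; split => //; exact: approximable_gen.
Qed.

Import HBNNSimple.

Lemma approximable_nnsfun (h : {nnsfun T >-> R}) :
  approximable (fun x => (h x)%:C%C).
Proof.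
have -> : (fun x => (h x)%:C%C) = (fun x =>
    \sum_(y <- finmap.enum_fset (fset_set (range h))) y%:C%C * cindic (h @^-1` [set y]) x).
  apply/funext => x; rewrite {1}fimfunE fsbig_finite//= rmorph_sum.
  by apply: eq_bigr => y _; rewrite rmorphM.
apply: approximable_sum => y; apply: approximableZ; apply: approximable_cindic.
by rewrite -[X in measurable X]setTI; apply: (@measurable_funPT _ _ _ _ h).
Qed.

(** The increasing simple approximations satisfy 0 <= a_n <= f, so (f - a_n)^2 is dominated by the
    integrable f^2 and dominated convergence applies. *)
Lemma approximable_nneg (f : T -> R) : measurable_fun setT f ->
  (forall x, 0 <= f x) -> L2 m (fun x => (f x)%:C%C) ->
  approximable (fun x => (f x)%:C%C).
Proof.
move=> mf f0 Lf; apply: approximable_closed => // eps eps0.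
have mEf : measurable_fun setT (EFin \o f) by exact/measurable_EFinP.
pose a := nnsfun_approx measurableT mEf.
have af x : (a n x @[n --> \oo] --> f x).
  have := cvg_nnsfun_approx measurableT mEf (fun x _ => f0 x : (0 <= (f x)%:E)%E) (x := x) I.
  by move/fine_cvgP => [].
have ale n x : a n x <= f x.
  have cv : cvgn (fun n => a n x) by apply/cvg_ex; exists (f x).
  rewrite -(cvg_lim (@Rhausdorff R) (af x)).
  apply: nondecreasing_cvgn_le => // i j ij.
  by have /lefP := nd_nnsfun_approx measurableT mEf ij; exact.
have ma n : measurable_fun setT (a n) by [].
have La n : L2 m (fun x => (a n x)%:C%C) by case: (approximable_nnsfun (a n)).
have [_ fi] := Lf.
have [] := @dominated_convergence _ _ _ m setT measurableT
  (fun n x => ((f x - a n x) ^+ 2)%:E) (cst 0)%E (fun x => (sqn (f x)%:C%C)%:E) _ _ _ fi.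
- move=> n; apply/measurable_EFinP/measurable_funX; exact: measurable_funB.
- exact: measurable_cst.
- apply: aeW => x _; apply: cvg_EFin; first exact: nearW.
  rewrite [X in _ --> X](_ : _ = (f x - f x) ^+ 2); last by rewrite subrr expr0n.
  apply: (@cvg_comp _ _ _ (fun n => f x - a n x) (fun y => y ^+ 2)); last exact: exprn_continuous.
  apply: cvgB (af x); exact: cvg_cst.
- apply: aeW => x n _; rewrite sqn_real /= lee_fin ger0_norm ?sqr_ge0//.
  have := ale n x; have : 0 <= a n x by []; have := f0 x; nra.
move=> _ _; rewrite integral0 => /fine_cvgP[_] /cvgrPdist_le /(_ _ eps0).
move=> [N _ /(_ N (leqnn N))] /= Heps.
exists (fun x => (a N x)%:C%C); first exact: approximable_nnsfun.
have LB := phB ph Lf (La N).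
rewrite -lee_fin L2_qn//.
have fin := integrable_fin_num measurableT LB.2.
rewrite -(fineK fin) lee_fin; apply: le_trans Heps.
rewrite sub0r normrN; apply: le_trans (ler_norm _).
rewrite le_eqVlt; apply/orP; left; apply/eqP; congr fine.
by apply: eq_integral => x _; rewrite -rmorphB sqn_real.
Qed.

Lemma L2_approximable f : L2 m f -> approximable f.
Proof.
move=> Lf; have [mf fi] := Lf.
have real (u : T -> R) : measurable_fun setT u ->
    (forall x, u x ^+ 2 <= sqn (f x)) -> approximable (fun x => (u x)%:C%C).
  move=> mu uf.
  have -> : (fun x => (u x)%:C%C) =
      (fun x => (-1) * (u^\- x)%:C%C + (u^\+ x)%:C%C).
    apply/funext => x; rewrite mulN1r addrC -rmorphB; congr (_%:C%C).
    by rewrite -[in LHS](funrposBneg u).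
  apply: approximable_lin.
    apply: approximable_nneg => //.
      exact: measurable_funrneg.
    apply: (L2_le _ fi); first exact/measurable_real_complex/measurable_funrneg.
    move=> x; rewrite sqn_real; apply: le_trans (uf x); rewrite /funrneg.
    by case: (leP 0) => ?; nra.
  apply: approximable_nneg => //.
    exact: measurable_funrpos.
  apply: (L2_le _ fi); first exact/measurable_real_complex/measurable_funrpos.
  move=> x; rewrite sqn_real; apply: le_trans (uf x); rewrite /funrpos.
  by case: (leP 0) => ?; nra.
have -> : f = (fun x => (Complex 0 1) * (complex.Im (f x))%:C%C + (complex.Re (f x))%:C%C).
  by apply/funext => x; case: (f x) => a b; apply/eqP; rewrite eq_complex /=; apply/andP; split; apply/eqP; ring.
apply: approximable_lin; apply: real.
- exact: measurable_fun_Im.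
- by move=> x; exact: sqr_Im_le.
- exact: measurable_fun_Re.
- by move=> x; exact: sqr_Re_le.
Qed.

End density.

(** * Lebesgue measure on C and C^n: iterated integrals, boxes and generators *)

Section image_product_integral.
Context d1 d2 d (T1 : measurableType d1) (T2 : measurableType d2)
  (T : measurableType d) (R : realType).
Variables (m1 : {sigma_finite_measure set T1 -> \bar R}).
Variables (m2 : {sigma_finite_measure set T2 -> \bar R}).
Variables (f : T1 * T2 -> T) (g : T -> T1 * T2).
Hypotheses (mf : measurable_fun setT f) (mg : measurable_fun setT g).
Hypothesis fK : cancel f g.
Local Notation im := (image_product_measure m1 m2 mf mg fK).

Lemma ge0_integral_image_product (h : T -> \bar R) : measurable_fun setT h ->
  (forall x, (0 <= h x)%E) ->
  (\int[im]_x h x = \int[m1]_x \int[m2]_y h (f (x, y)))%E.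
Proof.
move=> mh h0.
have -> := ge0_integral_pushforward mf (m1 \x m2)%E measurableT mh (fun y _ => h0 y).
by rewrite preimage_setT (fubini_tonelli1 (h \o f) (measurableT_comp mh mf) (fun x => h0 (f x))).
Qed.

Lemma image_product_setX (X : set T1) (Y : set T2) (A : set T) :
  measurable X -> measurable Y -> f @^-1` A = X `*` Y ->
  im A = (m1 X * m2 Y)%E.
Proof.
by move=> mX mY fA; rewrite /image_product_measure /pushforward fA product_measure1E.
Qed.

End image_product_integral.

Section lebesgue_Cn.
Variable R : realType.
Local Notation C := R[i].
Local Notation lam := (@lebesgue_measure R).
Local Notation lamC := (lebesgue_measureC R).
Local Notation lamn := (lebesgue_measureCn R).

Lemma ge0_integral_lebesgueC (h : C -> \bar R) : measurable_fun setT h ->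
  (forall x, (0 <= h x)%E) ->
  (\int[lamC]_u h u = \int[lam]_x \int[lam]_y h (Complex x y))%E.
Proof. exact: ge0_integral_image_product. Qed.

Lemma ge0_integral_lebesgueCnS n (h : n.+1.-tuple C -> \bar R) :
  measurable_fun setT h -> (forall x, (0 <= h x)%E) ->
  (\int[lamn n.+1]_t h t =
   \int[lamC]_u \int[lamn n]_t h [tuple of u :: t])%E.
Proof. exact: ge0_integral_image_product. Qed.

Definition rectC (X Y : set R) : set C :=
  [set u | X (complex.Re u) /\ Y (complex.Im u)].

Lemma measurable_rectC X Y : measurable X -> measurable Y -> measurable (rectC X Y).
Proof.
move=> mX mY.
have -> : rectC X Y = (@complex.Re R @^-1` X) `&` (@complex.Im R @^-1` Y) by [].
apply: measurableI; rewrite -[X in measurable X]setTI.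
  exact: measurable_Re.
exact: measurable_Im.
Qed.

Lemma lebesgueC_rectC X Y : measurable X -> measurable Y ->
  lamC (rectC X Y) = (lam X * lam Y)%E.
Proof. by move=> mX mY; exact: image_product_setX. Qed.

Definition polydisc n (Q : nat -> set C) : set (n.-tuple C) :=
  [set t | forall i : 'I_n, Q i (tnth t i)].

Lemma measurable_polydisc n Q : (forall i, measurable (Q i)) ->
  measurable (@polydisc n Q).
Proof.
move=> mQ; have -> : @polydisc n Q = \bigcap_(i in [set: 'I_n])
    ((fun t : n.-tuple C => tnth t i) @^-1` (Q i)).
  apply/seteqP; split=> t /=; first by move=> H i _ /=; exact: H.
  by move=> H i; exact: (H i).
apply: fin_bigcap_measurable => // i _; rewrite -[X in measurable X]setTI.
exact: measurable_tnth.
Qed.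

Lemma lebesgueCn_polydisc n Q : (forall i, measurable (Q i)) ->
  lamn n (polydisc Q) = (\prod_(i < n) lamC (Q i))%E.
Proof.
elim: n Q => [|n IH] Q mQ.
  rewrite big_ord0 /= /dirac indicE mem_set//; by move=> [].
rewrite big_ord_recl -(IH (fun i => Q i.+1))//.
apply: image_product_setX => //; first exact: measurable_polydisc.
apply/seteqP; split=> -[u t] /=.
  move=> H; split; first exact: (H ord0).
  by move=> i; have := H (lift ord0 i); rewrite /tuple_of_pair /= tnthS.
move=> [Hu Ht] i; case: (unliftP ord0 i) => [j|] -> //=.
by rewrite /tuple_of_pair /= tnthS; exact: Ht.
Qed.

End lebesgue_Cn.

Section tuple_generators.
Variables (R : realType) (n : nat).
Local Notation Cn := (n.-tuple R[i]).

Definition halfspace (x : 'I_n * bool * rat) : set Cn :=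
  [set z | (if x.1.2 then complex.Re (tnth z x.1.1)
            else complex.Im (tnth z x.1.1)) < ratr x.2].

Lemma measurable_halfspace x : measurable (halfspace x).
Proof.
case: x => -[i b] q.
have mi : measurable_fun setT (fun z : Cn => if b then complex.Re (tnth z i)
    else complex.Im (tnth z i)).
  by case: b; [apply: measurable_fun_Re|apply: measurable_fun_Im];
    exact: measurable_tnth.
have := mi measurableT _ (measurable_itv `]-oo, (ratr q : R)[).
by rewrite setTI; congr measurable; apply/seteqP; split=> z /=; rewrite in_itv.
Qed.

(** Measurability of the identity out of the generated sigma-algebra reduces to the real and
    imaginary parts of the coordinates, and there to the rays below x, which are countable unions of
    rays with rational end. *)
Lemma halfspaces_generate (P : set (set Cn)) (A : set Cn) :
  (forall x, P (halfspace x)) -> measurable A -> <<s P >> A.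
Proof.
move=> HP mA; pose T' := g_sigma_algebraType P.
suff mid : measurable_fun [set: T'] (idfun : T' -> Cn).
  by have := mid measurableT A mA; rewrite setTI.
have mreal (i : 'I_n) b : measurable_fun [set: T'] (fun z : T' =>
    if b then complex.Re (tnth (z : Cn) i) else complex.Im (tnth (z : Cn) i)).
  apply: (measurability _ (RGenInftyO.measurableE R)) => _ [_ [x ->] <-].
  rewrite setTI [X in measurable X](_ : _ =
    \bigcup_(q in [set q : rat | ratr q <= x]) halfspace (i, b, q)).
    rewrite bigcup_mkcond; apply: bigcupT_measurable_rat => q.
    by case: ifP => _; [apply: sub_sigma_algebra|exact: measurable0].
  apply/seteqP; split=> z /=; rewrite in_itv/=.
    by move=> /rat_in_itvoo[q]; rewrite in_itv /= => /andP[zq qx]; exists q => //=; exact: ltW.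
  by move=> [q /= qx zq]; exact: lt_le_trans zq qx.
apply/measurable_fun_tnthP => i; apply/measurable_fun_complexP; split.
  exact: (mreal i true).
exact: (mreal i false).
Qed.

End tuple_generators.

Section ball_volume.
Variables (R : realType) (d : nat).
Local Notation Cd := (d.-tuple R[i]).
Local Notation v := (@vball R d).
Local Notation B := (@unit_ball R d).
Local Notation lamn := (lebesgue_measureCn R).

Lemma unit_ballE (z : Cd) : B z = (\sum_(j < d) sqn (tnth z j) < 1) :> Prop.
Proof. by rewrite /unit_ball /=; under eq_bigr do rewrite -sqnE. Qed.

Lemma lebesgueCn_ball_lty : (lamn d B < +oo)%E.
Proof.
pose I : set R := `[(-1 : R), 1]%classic.
have mI : measurable I by exact: measurable_itv.
apply: (@le_lt_trans _ _ (lamn d (polydisc (fun=> rectC I I)))).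
  apply: le_measure; rewrite ?inE.
  - exact: measurable_unit_ball.
  - by apply: measurable_polydisc => _; exact: measurable_rectC.
  move=> z; rewrite unit_ballE => zB i.
  have zi : sqn (tnth z i) < 1.
    apply: le_lt_trans zB; rewrite (bigD1 i)//= lerDl sumr_ge0// => j _.
    exact: sqn_ge0.
  move: zi; rewrite /sqn /rectC /I /= !in_itv /= => zi.
  have := sqr_ge0 (complex.Re (tnth z i)); have := sqr_ge0 (complex.Im (tnth z i)).
  by split; nra.
rewrite lebesgueCn_polydisc; last by move=> _; exact: measurable_rectC.
have -> : lebesgue_measureC R (rectC I I) = (2 * 2)%:E.
  rewrite lebesgueC_rectC// /I lebesgue_measure_itv /= lte_fin.
  by rewrite (_ : -1 < 1 :> R) -?EFinB -?EFinM; [congr EFin; ring|lra].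
elim: (d) => [|n IH]; first by rewrite big_ord0 ltry.
by rewrite big_ord_recl; apply: lte_mul_pinfty.
Qed.

Lemma vball_subE (A : set Cd) : A `<=` B ->
  v A = ((ball_volume R d)^-1%:E * lamn d A)%E.
Proof. by move=> AB; rewrite /= /mscale /= /mrestr (setIidl AB). Qed.

End ball_volume.

Lemma L2ip_cindic_disjoint d (T : measurableType d) (R : realType)
    (m : {measure set T -> \bar R}) (X Y : set T) (a b : R[i]) :
  X `&` Y = set0 ->
  L2ip m (fun z => a * cindic R X z) (fun z => b * cindic R Y z) = 0.
Proof.
move=> XY0; rewrite -[RHS](Cint0 m); apply: eq_Cint => z.
have out A : ~ A z -> cindic R A z = 0 by move=> Az; rewrite /cindic indicE memNset.
have [Xz|nXz] := pselect (X z); last by rewrite (out _ nXz) mulr0 mul0r.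
have [Yz|nYz] := pselect (Y z); last by rewrite (out _ nYz) mulr0 conjc0 mulr0.
by have : (X `&` Y) z; [split|rewrite XY0].
Qed.

Section orthonormal_basis_exists.
Variables (R : realType) (d' : nat).
Local Notation d := d'.+1.
Local Notation Cd := (d.-tuple R[i]).
Local Notation v := (@vball R d).
Local Notation B := (@unit_ball R d).
Local Notation lamn := (lebesgue_measureCn R).

Let r : R := d.+1%:R^-1.

Let r_gt0 : 0 < r. Proof. by rewrite invr_gt0 ltr0n. Qed.

(** A box in the ball is cut into n slabs along the real part of the first coordinate: n disjoint
    sets of positive measure give n orthonormal functions, and one slab shows that the ball has
    positive volume. With r = 1 / (d + 1), every point of the box has |z|^2 <= 2 d r^2 = 2 r (1 - r)
    <= 1/2. *)
Definition slice (n j : nat) : set Cd :=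
  polydisc (fun i => if i == 0%N
    then rectC `[r * (j%:R / n%:R), r * (j.+1%:R / n%:R)[%classic `[0, r[%classic
    else rectC `[0, r[%classic `[0, r[%classic).

Lemma measurable_slice n j : measurable (slice n j).
Proof.
by apply: measurable_polydisc => i; case: ifP => _; apply: measurable_rectC;
  exact: measurable_itv.
Qed.

Lemma slice_sub n j : (j < n)%N -> slice n j `<=` B.
Proof.
move=> jn z zS; rewrite unit_ballE.
have n0 : 0 < n%:R :> R by rewrite ltr0n (leq_ltn_trans _ jn).
have zi i : sqn (tnth z i) <= 2 * r ^+ 2.
  suff [] : 0 <= complex.Re (tnth z i) <= r /\ 0 <= complex.Im (tnth z i) <= r.
    move=> /andP[? ?] /andP[? ?]; rewrite /sqn; nra.
  have := zS i; case: ifP => _; rewrite /rectC /= !in_itv /= => -[/andP[a b] /andP[e f]].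
    have j1 : j.+1%:R / n%:R <= 1 :> R by rewrite ler_pdivrMr// mul1r ler_nat.
    have j0 : 0 <= j%:R / n%:R :> R by rewrite divr_ge0.
    have r0 := r_gt0; move: a b; set x := complex.Re _ => a b.
    by split; apply/andP; split; [nra|nra|exact: e|exact: ltW].
  by rewrite a e !ltW.
apply: le_lt_trans (ler_sum _ (fun i _ => zi i)) _.
rewrite sumr_const card_ord -[X in X < _]mulr_natl.
have Dr : d%:R * r = 1 - r.
  have : d.+1%:R * r = 1 by rewrite /r mulfV.
  by rewrite -natr1; lra.
have -> : d%:R * (2 * r ^+ 2) = 2 * ((d%:R * r) * r) by rewrite expr2; ring.
rewrite Dr; have := sqr_ge0 (2 * r - 1); lra.
Qed.

Lemma slice_disjoint n i j : (0 < n)%N -> (i < j)%N -> slice n i `&` slice n j = set0.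
Proof.
move=> n0 ij; apply/seteqP; split => // z [/(_ ord0) + /(_ ord0)].
rewrite /= /rectC /= !in_itv /= => -[/andP[_ a] _] [/andP[b _] _].
have : j%:R < i.+1%:R :> R.
  have := le_lt_trans b a; rewrite ltr_pM2l// ltr_pM2r// invr_gt0 ltr0n//.
by rewrite ltr_nat ltnS leqNgt ij.
Qed.

Lemma slice_gt0 n j : (0 < n)%N -> (0 < lamn d (slice n j))%E.
Proof.
move=> n0; have nR : 0 < n%:R :> R by rewrite ltr0n.
have mQ i : measurable (if i == 0%N
    then rectC `[r * (j%:R / n%:R), r * (j.+1%:R / n%:R)[%classic `[0, r[%classic
    else rectC `[0, r[%classic `[0, r[%classic).
  by case: ifP => _; apply: measurable_rectC; exact: measurable_itv.
rewrite /slice lebesgueCn_polydisc//; apply: (big_ind (fun x : \bar R => (0 < x)%E)) => [//|x y|i _].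
  exact: mule_gt0.
have E : lebesgue_measureC R (rectC `[0, r[%classic `[0, r[%classic) = (r * r)%:E.
  rewrite lebesgueC_rectC; [|exact: measurable_itv..].
  by rewrite lebesgue_measure_itv /= lte_fin r_gt0 sube0 -EFinM.
case: ifP => _; last by rewrite E lte_fin mulr_gt0.
rewrite lebesgueC_rectC; [|exact: measurable_itv..].
rewrite !lebesgue_measure_itv /= !lte_fin r_gt0 sube0.
rewrite ltr_pM2l// ltr_pM2r ?invr_gt0// ltr_nat ltnSn.
by rewrite -EFinB -EFinM lte_fin mulr_gt0// subr_gt0 ltr_pM2l// ltr_pM2r ?invr_gt0// ltr_nat.
Qed.

Lemma ball_volume_gt0 : 0 < ball_volume R d.
Proof.
rewrite /ball_volume fine_gt0// lebesgueCn_ball_lty andbT.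
apply: lt_le_trans (slice_gt0 0 (ltnSn 0)) _.
apply: le_measure; rewrite ?inE.
- exact: measurable_slice.
- exact: measurable_unit_ball.
- exact: slice_sub.
Qed.

Lemma vball_ball : v B = 1%E.
Proof.
rewrite vball_subE//.
have := @lebesgueCn_ball_lty R d; rewrite -ge0_fin_numE// => fin.
by rewrite -(fineK fin) -EFinM mulVf// gt_eqF// ball_volume_gt0.
Qed.

Lemma vball_slice_gt0 n j : (j < n)%N -> (0 < v (slice n j))%E.
Proof.
move=> jn; rewrite vball_subE; last exact: slice_sub.
rewrite mule_gt0 ?slice_gt0 ?(leq_ltn_trans _ jn)//.
by rewrite lte_fin invr_gt0 ball_volume_gt0.
Qed.

Local Notation vm := (@vbf R d).

Lemma rB_sub (A : set Cd) (a : R[i]) : A `<=` B ->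
  rB (fun z => a * cindic R A z) = (fun z => a * cindic R A z).
Proof.
move=> AB; apply/funext => z; have [zB|zB] := pselect (B z); first by rewrite rB_in.
by rewrite rB_out// /cindic indicE memNset ?mulr0// => /AB.
Qed.

Lemma ball_L2_infinite n : exists u, orthonormal_upto (@in_Lp R d 2%:E) (@inner R d) n u.
Proof.
pose E j := slice n j.
pose c j : R := (Num.sqrt (fine (vm (E j))))^-1.
have LE j : L2 vm (cindic R (E j)) by apply: L2_cindic; exact: measurable_slice.
exists (fun j z => (c j)%:C%C * cindic R (E j) z).
split=> [k kn|i j ilt jlt].
  by apply/in_L2P; rewrite rB_sub; [exact: (phZ (L2_prehilbert vm))|exact: slice_sub].
have n0 : (0 < n)%N by exact: leq_ltn_trans ilt.
rewrite innerE !rB_sub; [|exact: slice_sub..].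
have ph := L2_prehilbert vm.
have [<-|ij] := eqVneq i j; last first.
  apply: L2ip_cindic_disjoint.
  by case: (ltngtP i j) ij => // ? _; [|rewrite setIC]; exact: slice_disjoint.
rewrite -/(L2ip vm _ _) (ph_ipZ ph)//; last exact: (phZ ph).
rewrite (ph_conj ph (phZ ph _ (LE i)) (LE i)) (ph_ipZ ph)// (qnE ph (LE i)).
rewrite real_mul_conj -[RHS]/((1 : R)%:C%C); congr (_%:C%C).
have -> : qn (L2ip vm) (cindic R (E i)) = fine (vm (E i)).
  by rewrite -(qm_cindic vm)//; exact: measurable_slice.
have fpos : 0 < fine (vm (E i)).
  rewrite fine_gt0// vball_slice_gt0//=.
  by rewrite -ge0_fin_numE// fin_num_measure//; exact: measurable_slice.
by rewrite /c -invfM -expr2 sqr_sqrtr ?ltW// mulVf// gt_eqF.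
Qed.

Let P := pi_system (@halfspace R d).

Lemma measurable_pi_halfspace n : measurable (P n).
Proof.
rewrite /P; have [s ->] := pi_systemP (@halfspace R d) n.
elim: s => [|i s IH] /=; first exact: measurableT.
by apply: measurableI => //; exact: measurable_halfspace.
Qed.

Lemma ball_L2_total f (eps : R) : in_Lp 2%:E f -> 0 < eps ->
  exists n c, qn (@inner R d) (fun z : Cd => f z - lincomb n c (fun k => cindic R (P k)) z) <= eps.
Proof.
move=> Lf eps0; have Lf' : L2 vm (rB f) by exact/in_L2P.
have [|_ /(_ _ eps0)[n [c H]]] :=
    L2_approximable measurable_pi_halfspace (@pi_systemI _ _ _) (@pi_systemT _ _ _) _ Lf'.
  move=> A; apply: halfspaces_generate => x.
  by have [k <-] := pi_system_gen (@halfspace R d) x; exists k.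
exists n, c; apply: le_trans H; rewrite -lee_fin.
set l := lincomb _ _ _.
have Ll : L2 vm l.
  apply: (ph_lincomb (L2_prehilbert vm)) => k _.
  by apply: L2_cindic; exact: measurable_pi_halfspace.
have Lr : L2 vm (fun x => rB f x - l x) := phB (L2_prehilbert vm) Lf' Ll.
have sub z : sqn (rB (fun z => f z - l z) z) <= sqn (rB f z - l z).
  have [zB|zB] := pselect (B z); first by rewrite !rB_in.
  by rewrite rB_out// sqn0 sqn_ge0.
have mr : measurable_fun setT (rB (fun z => f z - l z)).
  have -> : rB (fun z => f z - l z) = (fun z => rB f z - rB l z).
    apply/funext => z; have [zB|zB] := pselect (B z); first by rewrite !rB_in.
    by rewrite !rB_out// subr0.
  apply: measurable_cfunB; first exact: Lf'.1.
  by apply/measurable_rB; exact: measurable_funTS Ll.1.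
rewrite qn_inner; last by apply/in_L2P; exact: L2_le mr Lr.2 sub.
rewrite L2_qn//; apply: ge0_le_integral => //.
- by move=> z _; rewrite lee_fin sqn_ge0.
- exact/measurable_EFinP/measurable_sqn.
- by apply/measurable_EFinP; apply: measurable_sqn; exact: Lr.1.
- by move=> z _; rewrite lee_fin.
Qed.

Lemma LpNorm2_cvg0 (F : nat -> Cd -> R[i]) : (forall n, in_Lp 2%:E (F n)) ->
  LpNorm 2%:E (F n) @[n --> \oo] --> 0%E <-> qn (@inner R d) (F n) @[n --> \oo] --> (0 : R).
Proof.
move=> LF; have -> : (fun n => LpNorm 2%:E (F n)) = EFin \o (fun n => Num.sqrt (qn (@inner R d) (F n))).
  by apply/funext => n; rewrite LpNorm2E.
have q0 n : 0 <= qn (@inner R d) (F n) by exact: (qn_ge0 (inner_prehilbert R d) (LF n)).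
split=> [/fine_cvgP[_ /= cv]|cv].
  rewrite (_ : (fun n => _) = (fun n => Num.sqrt (qn (@inner R d) (F n)) * Num.sqrt (qn (@inner R d) (F n)))).
    by rewrite -[X in _ --> X](mulr0 0); exact: cvgM.
  by apply/funext => n; rewrite -expr2 sqr_sqrtr.
apply: cvg_EFin; first exact: nearW.
rewrite -(@sqrtr0 R); apply: (cvg_comp _ _ cv); exact: sqrt_continuous.
Qed.

Lemma orthonormal_basis_exists : exists e, @orthonormal_basis R d e.
Proof.
have ph := inner_prehilbert R d.
pose g k := cindic R (P k).
have Pg k : in_Lp 2%:E (g k).
  apply/in_L2P; have Lg : L2 vm (g k) by apply: L2_cindic; exact: measurable_pi_halfspace.
  apply: (L2_le _ Lg.2); first by apply/measurable_rB; exact: measurable_funTS Lg.1.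
  move=> z; have [zB|zB] := pselect (B z); first by rewrite rB_in.
  by rewrite rB_out// sqn0 sqn_ge0.
pose e := gs (@inner R d) g; exists e.
have oe n := gs_orthonormal ph ball_L2_infinite Pg ball_L2_total n.
split.
- by move=> n; have [+ _] := oe n.+1; apply.
- move=> i j; have [_] := oe (maxn i j).+1; apply; rewrite ltnS; [exact: leq_maxl|exact: leq_maxr].
- move=> f Lf; apply/LpNorm2_cvg0.
    by move=> n; apply: (ph_residual ph) => //; case: (oe n).
  apply/cvgrPdist_le => eps eps0.
  have [N HN] := gs_complete ph ball_L2_infinite Pg ball_L2_total Lf eps0.
  exists N => // n /= Nn; rewrite sub0r normrN ger0_norm; first exact: HN.
  by apply: (qn_ge0 ph); apply: (ph_residual ph) => //; case: (oe n).
Qed.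

End orthonormal_basis_exists.

(** * Integral operators on the ball *)

Section ae_L2.
Variables (R : realType) (d : nat).
Local Notation Cd := (d.-tuple R[i]).
Local Notation v := (@vball R d).
Local Notation B := (@unit_ball R d).
Local Notation in_L2 := (@in_Lp R d 2%:E).
Implicit Types (f g : Cd -> R[i]) (S T : (Cd -> R[i]) -> Cd -> R[i]).

Lemma in_L2B f g : in_L2 f -> in_L2 g -> in_L2 (fun z => f z - g z).
Proof. exact: (phB (inner_prehilbert R d)). Qed.

Lemma ae_ball (P : Cd -> Prop) : (forall z, B z -> P z) -> {ae v, forall z, P z}.
Proof.
move=> BP; exists (~` B); split.
- by apply: measurableC; exact: measurable_unit_ball.
- exact: vball_setC.
- by move=> z /= nP zB; exact: nP (BP z zB).
Qed.

Lemma LpNorm2_eq0 f : in_L2 f -> LpNorm 2%:E f = 0%E <-> {ae v, forall z, f z = 0}.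
Proof.
move=> /in_L2P Lf; have mf := Lf.1.
have ms : measurable_fun setT (fun z => (sqn (rB f z))%:E).
  exact/measurable_EFinP/measurable_sqn.
have sqn_eq0 (u : R[i]) : sqn u = 0 -> u = 0.
  case: u => a b; rewrite /sqn /= => h.
  have := sqr_ge0 a; have := sqr_ge0 b => b0 a0.
  have a2 : a ^+ 2 = 0 by lra.
  have b2 : b ^+ 2 = 0 by lra.
  by move/eqP: a2; rewrite sqrf_eq0 => /eqP->; move/eqP: b2; rewrite sqrf_eq0 => /eqP->.
split=> [f0|f0].
  have : (\int[v]_z `|(sqn (rB f z))%:E| = 0)%E.
    under eq_integral do rewrite gee0_abs ?lee_fin ?sqn_ge0//.
    by rewrite -[X in X = _]/(\int[@vbf R d]_z (sqn (rB f z))%:E)%E -LpNorm2_sqr f0 expe2 mule0.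
  move/(ae_eq_integral_abs v measurableT ms) => h.
  have Bae := @ae_ball (fun z => B z) (fun z => id).
  apply: filterS2 h Bae => z /(_ I) [] /sqn_eq0; rewrite /= => + zB.
  by rewrite rB_in.
have h : (LpNorm 2%:E f ^+ 2 = 0)%E.
  rewrite LpNorm2_sqr -(@integral0 _ _ _ v setT).
  rewrite -[LHS]/(\int[v]_z (sqn (rB f z))%:E)%E.
  apply: ae_eq_integral => //; apply: filterS f0 => z fz _.
  have [zB|zB] := pselect (B z); first by rewrite rB_in// fz sqn0.
  by rewrite rB_out// sqn0.
have : (0 <= LpNorm 2%:E f)%E by exact: Lnorm_ge0.
move: h; case: (LpNorm 2%:E f) => [r| |]//; rewrite -EFin_expe => -[/eqP].
by rewrite sqrf_eq0 => /eqP->.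
Qed.

(** Operators act on functions and are linear only almost everywhere, so compatibility with a.e.
    equality has to be proved: boundedness sends the null function f - g to a null function, and
    linearity is applied to the sum of f - g and g. *)
Lemma bounded_linear_ae S f g : bounded_linear_L2 S -> in_L2 f -> in_L2 g ->
  {ae v, forall z, f z = g z} -> {ae v, forall z, S f z = S g z}.
Proof.
move=> [SL Slin [M SM]] Lf Lg fg.
have Ld := in_L2B Lf Lg.
have Sd0 : {ae v, forall z, S (fun z => f z - g z) z = 0}.
  apply/LpNorm2_eq0; first exact: SL.
  have d0 : LpNorm 2%:E (fun z => f z - g z) = 0%E.
    by apply/LpNorm2_eq0 => //; apply: filterS fg => z ->; rewrite subrr.
  apply/eqP; rewrite eq_le Lnorm_ge0 andbT; apply: le_trans (SM _ Ld) _.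
  by rewrite d0 mule0.
apply: filterS2 Sd0 (Slin 1 _ _ Ld Lg) => z.
rewrite (_ : (fun w => 1 * (f w - g w) + g w) = f); last first.
  by apply/funext => w; ring.
by move=> -> ->; rewrite mulr0 add0r.
Qed.

Lemma bounded_linear_comp S T : bounded_linear_L2 S -> bounded_linear_L2 T ->
  bounded_linear_L2 (S \o T).
Proof.
move=> bS bT; have [SL Slin [M SM]] := bS; have [TL Tlin [N TN]] := bT.
split.
- by move=> f Lf; exact: SL (TL _ Lf).
- move=> a f g Lf Lg.
  have Lh : in_L2 (fun w => a * f w + g w) := ph_lin (inner_prehilbert R d) a Lf Lg.
  have Lh' : in_L2 (fun w => a * T f w + T g w).
    exact: (ph_lin (inner_prehilbert R d) a (TL _ Lf) (TL _ Lg)).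
  have := bounded_linear_ae bS (TL _ Lh) Lh' (Tlin a f g Lf Lg).
  apply: filterS2 (Slin a _ _ (TL _ Lf) (TL _ Lg)) => z /= h1 h2.
  by rewrite h2 h1.
- exists (`|M| * `|N|) => f Lf.
  apply: le_trans (SM _ (TL _ Lf)) _.
  apply: (@le_trans _ _ (`|M|%:E * LpNorm 2%:E (T f))%E).
    by apply: lee_wpmul2r; rewrite ?Lnorm_ge0// lee_fin ler_norm.
  rewrite EFinM -muleA; apply: lee_wpmul2l; first by rewrite lee_fin.
  apply: le_trans (TN _ Lf) _.
  by apply: lee_wpmul2r; rewrite ?Lnorm_ge0// lee_fin ler_norm.
Qed.

End ae_L2.

Section ball_kernel.
Variables (R : realType) (d' : nat).
Local Notation d := d'.+1.
Local Notation Cd := (d.-tuple R[i]).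
Local Notation v := (@vball R d).
Local Notation B := (@unit_ball R d).
Local Notation in_L2 := (@in_Lp R d 2%:E).
Local Notation ipB := (@inner R d).
Implicit Types (f g : Cd -> R[i]).

Variable kap : Cd -> Cd -> R[i].

(** The factors are ordered as in [Kalpha] and [Kalpha_plus], which are thus instances up to
    conversion. *)
Definition Kker f (z : Cd) : R[i] := ball_integral (fun w => f w * kap z w).

(** Cut off in both variables, so that [Kop] on the whole space corresponds to [Kker] under
    restriction to the ball. *)
Definition kerB (p : Cd * Cd) : R[i] := rB (fun z => rB (kap z) p.2) p.1.

Local Notation vm := (@vbf R d).

Hypothesis mk : measurable_fun setT kerB.
Hypothesis k2 : (\int[vm]_x \int[vm]_y (sqn (kerB (x, y)))%:E < +oo)%E.
Hypothesis ks : forall x, L2 vm (fun y => kerB (x, y)).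

Lemma kerB_in z w : B z -> B w -> kerB (z, w) = kap z w.
Proof. by move=> zB wB; rewrite /kerB !rB_in. Qed.

Lemma rB_Kker f : rB (Kker f) = Kop vm kerB (rB f).
Proof.
apply/funext => z; have [zB|zB] := pselect (B z).
  rewrite rB_in// /Kker ball_integralE; apply: eq_Cint => w.
  have [wB|wB] := pselect (B w); first by rewrite !rB_in// kerB_in// mulrC.
  by rewrite !(rB_out _ wB) mulr0.
rewrite rB_out//; rewrite -[LHS](Cint0 vm); apply: eq_Cint => w.
by rewrite /kerB rB_out// mul0r.
Qed.

Lemma Kker_L2 f : in_L2 f -> in_L2 (Kker f).
Proof.
by move=> /in_L2P Lf; apply/in_L2P; rewrite rB_Kker; exact: (L2_Kop mk k2 ks).
Qed.

Lemma Kker_bounded_linear : bounded_linear_L2 Kker.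
Proof.
have ph := inner_prehilbert R d.
split; first exact: Kker_L2.
- move=> a f g /in_L2P Lf /in_L2P Lg; apply: ae_ball => z zB.
  rewrite -(rB_in (Kker (fun w => a * f w + g w)) zB) rB_Kker rB_lin (Kop_lin ks)//.
  by rewrite -!rB_Kker !rB_in.
- have k0 : (0 <= \int[vm]_x \int[vm]_y (sqn (kerB (x, y)))%:E)%E.
    by apply: integral_ge0 => x _; apply: integral_ge0 => y _; rewrite lee_fin sqn_ge0.
  have kf : (\int[vm]_x \int[vm]_y (sqn (kerB (x, y)))%:E)%E \is a fin_num.
    by rewrite ge0_fin_numE.
  exists (Num.sqrt (fine (\int[vm]_x \int[vm]_y (sqn (kerB (x, y)))%:E)%E)) => f Lf.
  rewrite !LpNorm2E//; last exact: Kker_L2.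
  rewrite -EFinM lee_fin -sqrtrM ?fine_ge0// ler_wsqrtr//.
  have LK := Kker_L2 Lf.
  rewrite -lee_fin qn_inner// EFinM fineK// rB_Kker.
  have /in_L2P Lf' := Lf.
  apply: le_trans (integral_sqn_Kop_le mk k2 ks Lf') _.
  by rewrite /qn innerE.
Qed.

Section basis.
Variable e : nat -> Cd -> R[i].
Hypothesis oe : orthonormal_basis e.

Lemma rB_orthonormal n : orthonormal_upto (L2 vm) (L2ip vm) n (fun k => rB (e k)).
Proof.
have [Le oe' _] := oe; split=> [k _|i j _ _]; first exact/in_L2P.
by rewrite -innerE oe'.
Qed.

Lemma Kker_hs_sum : (\sum_(0 <= n <oo) LpNorm 2%:E (Kker (e n)) ^+ 2 =
  \int[vm]_x \int[vm]_y (sqn (kerB (x, y)))%:E)%E.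
Proof.
rewrite -(hs_sum_eq mk k2 ks rB_orthonormal).
  by apply: eq_eseriesr => n _; rewrite LpNorm2_sqr rB_Kker.
(* Completeness is given for [inner] and the basis e, but wanted for [L2ip] and the restricted
   basis; the two residuals agree because this section of the kernel already vanishes off the
   ball. *)
move=> x; pose f := fun y : Cd => conjc (kerB (x, y)).
rewrite -[fun y => _^*%C]/f.
have [Le oe' ce] := oe.
have fE : rB f = f.
  apply/funext => y; have [yB|yB] := pselect (B y); first by rewrite rB_in.
  rewrite rB_out// /f /kerB /=.
  have [xB|xB] := pselect (B x); last by rewrite rB_out// conjc0.
  by rewrite rB_in// rB_out// conjc0.
have Lf : in_L2 f by apply/in_L2P; rewrite fE; exact/L2_conj/ks.
have LR n : in_L2 (residual ipB n e f).
  by apply: (ph_residual (inner_prehilbert R d)) => // k _; exact: Le.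
have rres n : rB (residual ipB n e f) = residual (L2ip vm) n (fun k => rB (e k)) f.
  apply/funext => z; rewrite /residual; have [zB|zB] := pselect (B z).
    rewrite rB_in//; congr (_ - _); apply: eq_bigr => k _.
    by rewrite innerE fE rB_in.
  rewrite rB_out// -[in f z]fE rB_out// big1 ?subrr// => k _.
  by rewrite rB_out// mulr0.
have -> : (fun n => qn (L2ip vm) (residual (L2ip vm) n (fun k => rB (e k)) f)) =
    (fun n => qn ipB (residual ipB n e f)).
  by apply/funext => n; rewrite /qn innerE rres.
exact: (LpNorm2_cvg0 LR).1 (ce f Lf).
Qed.

End basis.

Lemma Kker_hilbert_schmidt : hilbert_schmidt Kker.
Proof.
split; first exact: Kker_bounded_linear.
have [e oe] := orthonormal_basis_exists R d'.
by exists e => //; rewrite Kker_hs_sum.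
Qed.

Hypothesis kh : forall z w, B z -> B w -> kap w z = conjc (kap z w).

Lemma kerB_herm z w : kerB (w, z) = conjc (kerB (z, w)).
Proof.
rewrite /kerB /=.
have [zB|zB] := pselect (B z); have [wB|wB] := pselect (B w).
- by rewrite !rB_in// kh.
- by rewrite (rB_out _ wB) (rB_in _ zB) (rB_out _ wB) conjc0.
- by rewrite (rB_out _ zB) (rB_in _ wB) (rB_out _ zB) conjc0.
- by rewrite !rB_out// conjc0.
Qed.

Lemma Kker_is_adjoint : is_adjoint Kker Kker.
Proof.
split; first exact: Kker_bounded_linear.
move=> f g /in_L2P Lf /in_L2P Lg; rewrite !innerE !rB_Kker.
exact: (Kop_selfadjoint mk k2 ks kerB_herm).
Qed.

(** [adjoint] is obtained by choice, so an adjoint must first be exhibited: the kernel is Hermitian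
    and [Kker] is adjoint to itself. From then on only the defining property is used, which turns
    each diagonal entry into the squared norm of [Kker (e k)]. *)
Lemma Kker_has_trace : has_trace (adjoint Kker \o Kker)
  (fine (\int[vm]_x \int[vm]_y (sqn (kerB (x, y)))%:E)%E)%:C%C.
Proof.
have ph := inner_prehilbert R d.
have [bS adjS] : is_adjoint Kker (adjoint Kker).
  by apply: xgetPex; exists Kker; exact: Kker_is_adjoint.
split.
- by apply: bounded_linear_comp bS _; exact: Kker_bounded_linear.
- exact: orthonormal_basis_exists.
move=> e oe; have [Le oe' _] := oe.
have k0 : (0 <= \int[vm]_x \int[vm]_y (sqn (kerB (x, y)))%:E)%E.
  by apply: integral_ge0 => x _; apply: integral_ge0 => y _; rewrite lee_fin sqn_ge0.
have kf : (\int[vm]_x \int[vm]_y (sqn (kerB (x, y)))%:E)%E \is a fin_num.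
  by rewrite ge0_fin_numE.
set t := fine _.
have -> : (fun n => normc (\sum_(k < n) inner ((adjoint Kker \o Kker) (e k)) (e k) -
    t%:C%C)) = (fun n => `|(\sum_(k < n) qn ipB (Kker (e k))) - t|).
  apply/funext => n.
  have -> : \sum_(k < n) inner ((adjoint Kker \o Kker) (e k)) (e k) =
      (\sum_(k < n) qn ipB (Kker (e k)))%:C%C.
    rewrite rmorph_sum; apply: eq_bigr => k _ /=.
    have LK := Kker_L2 (Le k).
    have LS : in_L2 (adjoint Kker (Kker (e k))) by case: bS => + _ _; apply.
    by rewrite (ph_conj ph (Le k) LS) -adjS// (qnE ph LK) conjc_real.
  by rewrite -rmorphB /= expr0n /= addr0 sqrtr_sqr.
have cv : (fun n => \sum_(k < n) qn ipB (Kker (e k))) @ \oo --> t.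
  have := Kker_hs_sum oe; rewrite -(fineK kf) -/t => sumE.
  have cvE : cvgn (fun n => (\sum_(0 <= k < n) LpNorm 2%:E (Kker (e k)) ^+ 2)%E).
    by apply: is_cvg_nneseries => k _ _; rewrite expe_ge0// Lnorm_ge0.
  have E : (fun n => (\sum_(0 <= k < n) LpNorm 2%:E (Kker (e k)) ^+ 2)%E) =
      EFin \o (fun n => \sum_(k < n) qn ipB (Kker (e k))).
    apply/funext => n; rewrite big_mkord /comp -sumEFin; apply: eq_bigr => k _.
    by rewrite LpNorm2_sqr qn_inner//; exact: Kker_L2.
  have : EFin \o (fun n => \sum_(k < n) qn ipB (Kker (e k))) @ \oo --> t%:E.
    by rewrite -E -sumE; exact: cvE.
  by move/fine_cvgP => [].
apply/cvgrPdist_le => eps eps0; move/cvgrPdist_le: cv => /(_ _ eps0).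
by apply: filterS => n /=; rewrite sub0r normrN normr_id distrC.
Qed.

End ball_kernel.

(** * Square integrability of the kernels *)

Section lebesgue_affine.
Variable R : realType.
Local Notation lam := (@lebesgue_measure R).

Definition affine (k c : R) (x : measurableTypeR R) : measurableTypeR R := k * x + c.

Lemma measurable_affine k c : measurable_fun setT (affine k c).
Proof.
apply: measurable_funD; last exact: measurable_cst.
by apply: measurable_funM; [exact: measurable_cst|exact: measurable_id].
Qed.

Definition affine_measure k c : {measure set (measurableTypeR R) -> \bar R} :=
  mscale (NngNum (normr_ge0 k))
    (measure_function_pushforward__canonical__measure_function_Measure lam
      (measurable_affine k c)).

(** By uniqueness of Lebesgue measure it suffices to compare on the intervals open on the left and
    closed on the right. For k < 0 the preimage is half-open on the other side, with the same
    length. *)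
Lemma lebesgue_affine (k c : R) (A : set R) : k != 0 -> measurable A ->
  lam A = (`|k|%:E * lam (affine k c @^-1` A))%E.
Proof.
move=> k0 mA.
suff : lam A = affine_measure k c A by [].
apply: lebesgue_measure_unique => // X [[x y] _ <-] /=.
rewrite /affine_measure /= /mscale /= /pushforward.
have [kn|kp] : k < 0 \/ 0 < k by move: k0; rewrite neq_lt => /orP.
  have -> : affine k c @^-1` `]x, y]%classic = `[(y - c) / k, (x - c) / k[%classic.
    apply/seteqP; split=> z; rewrite /affine /= !in_itv /=.
      by rewrite ler_ndivrMr// ltr_ndivlMr// => /andP[? ?]; apply/andP; split; lra.
    by rewrite ler_ndivrMr// ltr_ndivlMr// => /andP[? ?]; apply/andP; split; lra.
  rewrite !lebesgue_measure_itv /= !lte_fin ltr_ndivrMr// divfK// ltrD2r.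
  case: ifPn => xy; last by rewrite mule0.
  rewrite -!EFinB -EFinM ltr0_norm//; congr EFin; field; exact: ltr0_neq0.
have -> : affine k c @^-1` `]x, y]%classic = `](x - c) / k, (y - c) / k]%classic.
  apply/seteqP; split=> z; rewrite /affine /= !in_itv /=.
    by rewrite ler_pdivlMr// ltr_pdivrMr// => /andP[? ?]; apply/andP; split; lra.
  by rewrite ler_pdivlMr// ltr_pdivrMr// => /andP[? ?]; apply/andP; split; lra.
rewrite !lebesgue_measure_itv /= !lte_fin ltr_pdivrMr// divfK// ltrD2r.
case: ifPn => xy; last by rewrite mule0.
by rewrite -!EFinB -EFinM gtr0_norm//; congr EFin; field.
Qed.

Lemma ge0_integral_affine (k c : R) (f : R -> \bar R) : k != 0 ->
  measurable_fun setT f -> (forall x, (0 <= f x)%E) ->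
  (\int[lam]_x f x = `|k|%:E * \int[lam]_x f (k * x + c)%R)%E.
Proof.
move=> k0 mf f0.
rewrite (eq_measure_integral (affine_measure k c)); last by move=> A mA _; exact: lebesgue_affine.
rewrite ge0_integral_mscale//; congr (_ * _)%E.
have -> := ge0_integral_pushforward (measurable_affine k c) lam measurableT mf
  (fun y _ => f0 y).
by rewrite preimage_setT.
Qed.

(** The interval is exhausted by compact ones away from 0, where the fundamental theorem of calculus
    applies; dropping the nonnegative contribution of the lower endpoint gives a bound uniform in
    n. *)
Lemma integral_powR01 (p : R) : -1 < p ->
  (\int[lam]_(x in `]0%R, 1%R]) (x `^ p)%:E <= (1 / (p + 1))%:E)%E.
Proof.
move=> p1; have p10 : 0 < p + 1 by lra.
pose F n : set R := `[(n.+1%:R^-1 : R), 1]%classic.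
have UF : \bigcup_n F n = `]0, 1]%classic.
  apply/seteqP; split=> x /=.
    move=> [n _]; rewrite /F /= !in_itv /= => /andP[nx ->]; rewrite andbT.
    by apply: lt_le_trans nx; rewrite invr_gt0.
  rewrite in_itv /= => /andP[x0 x1].
  have [n xn] : exists n, n.+1%:R^-1 <= x.
    exists (Num.truncn x^-1); rewrite -[leRHS]invrK lef_pV2 ?posrE ?invr_gt0//.
    exact/ltW/truncnS_gt.
  by exists n => //; rewrite /F /= in_itv /= xn.
have ndF : nondecreasing_seq F.
  move=> m n mn; apply/subsetPset => x; rewrite /F /= !in_itv /= => /andP[mx ->].
  by rewrite andbT (le_trans _ mx)// lef_pV2 ?posrE// ler_nat.
have mpow : measurable_fun setT (fun x : R => (x `^ p)%:E).
  apply/measurable_EFinP; exact: measurable_powR.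
have cv : (\int[lam]_(x in F n) (x `^ p)%:E)%E @[n --> \oo] -->
    (\int[lam]_(x in \bigcup_n F n) (x `^ p)%:E)%E.
  apply: ge0_nondecreasing_set_cvg_integral => //.
  - by move=> n; exact: measurable_itv.
  - by move=> n; exact: measurable_funTS mpow.
  - by move=> n x _; rewrite lee_fin powR_ge0.
rewrite -UF -(cvg_lim _ cv)//; apply: lime_le.
  by apply/cvg_ex; exists (\int[lam]_(x in \bigcup_n F n) (x `^ p)%:E)%E.
apply: nearW => n.
(* For n = 0 the interval is the single point 1, which the fundamental theorem of calculus does not
   cover. *)
have [n0|n1] := eqVneq n 0%N.
  rewrite n0 /F invr1 set_itv1 integral_set1 lee_fin divr_ge0// ltW//.
have sn1 : n.+1%:R^-1 < 1 :> R by rewrite invf_lt1// ltr1n ltnS lt0n.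
have sn0 : 0 < n.+1%:R^-1 :> R by rewrite invr_gt0.
rewrite (@continuous_FTC2 _ _ (fun x => (p + 1)^-1 * x `^ (p + 1)))//.
- rewrite -EFinB lee_fin powR1 mulr1 div1r lerBlDr lerDl.
  by rewrite mulr_ge0 ?powR_ge0// invr_ge0 ltW.
- apply: continuous_in_subspaceT => x; rewrite inE /= in_itv /= => /andP[x0 _].
  apply: differentiable_continuous; apply/derivable1_diffP.
  by apply: derivable_powR; rewrite in_itv /= andbT (lt_le_trans sn0).
- have der x : 0 < x -> derivable (fun x => (p + 1)^-1 * x `^ (p + 1)) x 1.
    by move=> x0; apply: derivableM => //; apply: derivable_powR; rewrite in_itv /= andbT.
  have cF x : 0 < x -> {for x, continuous (fun x => (p + 1)^-1 * x `^ (p + 1))}.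
    by move=> x0; apply: differentiable_continuous; exact/derivable1_diffP/der.
  split.
  + by move=> x; rewrite in_itv /= => /andP[x0 _]; apply: der; exact: lt_trans x0.
  + by apply: cvg_at_right_filter; exact: cF.
  + by apply: cvg_at_left_filter; exact: cF.
- move=> x; rewrite in_itv /= => /andP[x0 _].
  have {}x0 : 0 < x by exact: lt_trans x0.
  rewrite derive1Ml; last by apply: derivable_powR; rewrite in_itv /= andbT.
  rewrite powR_derive1 ?in_itv /= ?andbT// addrK mulrA mulVf ?mul1r// gt_eqF//.
Qed.

End lebesgue_affine.

(** * Iterated integration over the coordinates of a tuple *)

Section tuple_integral_bound.
Variable R : realType.
Local Notation C := R[i].
Local Notation lamC := (lebesgue_measureC R).
Local Notation lamn := (lebesgue_measureCn R).
Local Open Scope ereal_scope.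

Definition upd n (t : n.-tuple C) (j : 'I_n) (u : C) : n.-tuple C :=
  [tuple if i == j then u else tnth t i | i < n].

Lemma upd_cons0 n (t : n.-tuple C) a u :
  upd [tuple of a :: t] ord0 u = [tuple of u :: t].
Proof.
apply: eq_from_tnth => i; rewrite tnth_mktuple.
by case: (unliftP ord0 i) => [k|] ->; rewrite ?eqxx ?(negbTE (neq_lift _ _)) ?[_ == ord0]eq_sym ?(negbTE (neq_lift _ _)) ?tnthS ?tnth0.
Qed.

Lemma upd_consS n (t : n.-tuple C) (j : 'I_n) a u :
  upd [tuple of a :: t] (lift ord0 j) u = [tuple of a :: upd t j u].
Proof.
apply: eq_from_tnth => i; rewrite tnth_mktuple.
case: (unliftP ord0 i) => [k|] ->; last by rewrite (negbTE (neq_lift _ _)) !tnth0.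
by rewrite !tnthS tnth_mktuple (inj_eq lift_inj).
Qed.

Lemma measurable_cons_pair n :
  measurable_fun setT (fun p : C * n.-tuple C => [tuple of p.1 :: p.2]).
Proof. exact: measurable_cons. Qed.

Lemma emeasurable_prod d (T : measurableType d) n (F : 'I_n -> T -> \bar R) :
  (forall i, measurable_fun setT (F i)) ->
  measurable_fun setT (fun x => \prod_(i < n) F i x).
Proof.
elim: n F => [|n IH] F mF.
  rewrite (_ : (fun _ => _) = cst 1); first exact: measurable_cst.
  by apply/funext => x; rewrite big_ord0.
rewrite (_ : (fun _ => _) = (fun x => F ord0 x * \prod_(i < n) F (lift ord0 i) x)).
  by apply: emeasurable_funM => //; exact: IH.
by apply/funext => x; rewrite big_ord_recl.
Qed.

Lemma measurable_coord n (G : C -> \bar R) (i : 'I_n) : measurable_fun setT G ->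
  measurable_fun setT (fun t : n.-tuple C => G (tnth t i)).
Proof. by move=> mG; apply: (measurableT_comp mG); exact: measurable_tnth. Qed.

Variables (M : R) (M0 : (0 <= M)%R).

Lemma integral_prod_le n (G : nat -> C -> \bar R) :
  (forall k, measurable_fun setT (G k)) -> (forall k u, 0 <= G k u) ->
  (forall k, \int[lamC]_u G k u <= M%:E) ->
  \int[lamn n]_t (\prod_(k < n) G k (tnth t k)) <= (M ^+ n)%:E.
Proof.
elim: n G => [|n IH] G mG G0 GM.
  under eq_integral do rewrite big_ord0.
  by rewrite integral_cst// mul1e /= /dirac indicE mem_set// expr0.
rewrite ge0_integral_lebesgueCnS; last 2 first.
- by apply: emeasurable_prod => i; exact: measurable_coord.
- by move=> t; apply: prode_ge0 => i _; exact: G0.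
pose Q (t : n.-tuple C) := \prod_(k < n) G k.+1 (tnth t k).
have mQ : measurable_fun setT Q by apply: emeasurable_prod => i; exact: measurable_coord.
have Q0 t : 0 <= Q t by apply: prode_ge0 => i _; exact: G0.
have IQ0 : 0 <= \int[lamn n]_t Q t by apply: integral_ge0 => t _.
apply: (@le_trans _ _ (\int[lamC]_u (G 0%N u * \int[lamn n]_t Q t))).
  rewrite le_eqVlt; apply/orP; left; apply/eqP; apply: eq_integral => u _.
  rewrite -ge0_integralZl//; apply: eq_integral => t _.
  rewrite big_ord_recl tnth0; congr (_ * _); apply: eq_bigr => k _.
  by rewrite tnthS.
rewrite ge0_integralZr// exprS EFinM; apply: lee_pmul => //.
  by apply: integral_ge0 => u _.
exact: (IH (fun k => G k.+1)).

Qed.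

(** [H] depends on all coordinates while its bound holds only along coordinate j, so j must be
    integrated innermost: the coordinates before j are peeled off from the outside by induction, and
    when j comes first Tonelli moves it inside. *)
Lemma integral_section_le n (j : 'I_n) (G : nat -> C -> \bar R)
    (H : n.-tuple C -> \bar R) :
  (forall k, measurable_fun setT (G k)) -> (forall k u, 0 <= G k u) ->
  (forall k, \int[lamC]_u G k u <= M%:E) ->
  measurable_fun setT H -> (forall t, 0 <= H t) ->
  (forall t, \int[lamC]_u H (upd t j u) <= M%:E) ->
  \int[lamn n]_t ((\prod_(k < n) if k == j then 1 else G k (tnth t k)) * H t)
    <= (M ^+ n)%:E.
Proof.
elim: n j G H => [[]//|n IH] j G H mG G0 GM mH H0 HM.
have mP (i : 'I_n.+1) : measurable_fun setT
    (fun t : n.+1.-tuple C => if i == j then 1 else G i (tnth t i)).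
  by case: (i == j); [exact: measurable_cst|exact: measurable_coord].
have P0 (i : 'I_n.+1) (t : n.+1.-tuple C) :
  0 <= (if i == j then 1 else G i (tnth t i)) by case: (i == j).
rewrite ge0_integral_lebesgueCnS; last 2 first.
- by apply: emeasurable_funM => //; exact: emeasurable_prod.
- by move=> t; apply: mule_ge0 => //; apply: prode_ge0 => i _.
have mHc : measurable_fun setT (fun p : C * n.-tuple C => H [tuple of p.1 :: p.2]).
  by apply: (measurableT_comp mH); exact: measurable_cons_pair.
have mHu u : measurable_fun setT (fun t : n.-tuple C => H [tuple of u :: t]).
  apply: (measurableT_comp mH); apply: (measurable_cons (f := fun=> u)) => //.
have mHt (t : n.-tuple C) : measurable_fun setT (fun u : C => H [tuple of u :: t]).
  apply: (measurableT_comp mH); apply: (measurable_cons (g := fun=> t)) => //.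
have [[j' jE]|jE] : (exists j', j = lift ord0 j') \/ j = ord0.
  by case: (unliftP ord0 j) => [j'|] ->; [left; exists j'|right].
- pose Q (t : n.-tuple C) := \prod_(k < n) if k == j' then 1 else G k.+1 (tnth t k).
  have mQ : measurable_fun setT Q.
    by apply: emeasurable_prod => i; case: (i == j'); [exact: measurable_cst|exact: measurable_coord].
  have Q0 t : 0 <= Q t by apply: prode_ge0 => i _; case: (i == j').
  have mQH u : measurable_fun setT (fun t => Q t * H [tuple of u :: t]).
    exact: emeasurable_funM mQ (mHu u).
  apply: (@le_trans _ _ (\int[lamC]_u (G 0%N u * (M ^+ n)%:E))).
    apply: ge0_le_integral => //.
    + by move=> u _; apply: integral_ge0 => t _; apply: mule_ge0 => //;
        apply: prode_ge0 => i _.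
    + apply: (measurable_fun_fubini_tonelli_F (fun p : C * n.-tuple C =>
        (\prod_(k < n.+1) if k == j then 1 else G k (tnth [tuple of p.1 :: p.2] k))
          * H [tuple of p.1 :: p.2])).
        apply: emeasurable_funM => //.
        apply: (measurableT_comp (f := fun t : n.+1.-tuple C =>
          \prod_(k < n.+1) if k == j then 1 else G k (tnth t k))).
          exact: emeasurable_prod.
        exact: measurable_cons_pair.
      by move=> p; apply: mule_ge0 => //; apply: prode_ge0 => i _.
    + by apply: emeasurable_funM => //; exact: measurable_cst.
    + move=> u _.
      have -> : \int[lamn n]_t ((\prod_(k < n.+1) (if k == j then 1
          else G k (tnth [tuple of u :: t] k))) * H [tuple of u :: t]) =
          G 0%N u * \int[lamn n]_t (Q t * H [tuple of u :: t]).
        rewrite -ge0_integralZl//; last by move=> t _; exact: mule_ge0.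
        apply: eq_integral => t _; rewrite big_ord_recl tnth0 muleA jE.
        rewrite (negbTE (neq_lift _ _)); congr (_ * _ * _); apply: eq_bigr => k _.
        by rewrite (inj_eq lift_inj) tnthS.
      apply: lee_wpmul2l => //.
      apply: (IH j' (fun k => G k.+1) (fun t => H [tuple of u :: t])) => //.
      move=> t; under eq_integral do rewrite -upd_consS -jE.
      exact: HM.
  rewrite ge0_integralZr//; last by rewrite lee_fin exprn_ge0.
  rewrite exprS EFinM; apply: lee_wpmul2r => //.
  by rewrite lee_fin exprn_ge0.
- pose Q (t : n.-tuple C) := \prod_(k < n) G k.+1 (tnth t k).
  have mQ : measurable_fun setT Q.
    by apply: emeasurable_prod => i; exact: measurable_coord.
  have Q0 t : 0 <= Q t by apply: prode_ge0 => i _; exact: G0.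
  have mf : measurable_fun setT (fun p : C * n.-tuple C => Q p.2 * H [tuple of p.1 :: p.2]).
    apply: emeasurable_funM => //.
    exact: measurableT_comp mQ measurable_snd.
  have f0 p : 0 <= Q p.2 * H [tuple of p.1 :: p.2] by exact: mule_ge0.
  have -> : \int[lamC]_u \int[lamn n]_t
      ((\prod_(k < n.+1) (if k == j then 1 else G k (tnth [tuple of u :: t] k))) *
       H [tuple of u :: t]) =
      \int[lamn n]_t \int[lamC]_u (Q t * H [tuple of u :: t]).
    rewrite -(fubini_tonelli (m1 := lamC) (m2 := lamn n)
      (fun p : C * n.-tuple C => Q p.2 * H [tuple of p.1 :: p.2]) mf f0).
    apply: eq_integral => u _; apply: eq_integral => t _.
    rewrite big_ord_recl jE eqxx mul1e; congr (_ * _); apply: eq_bigr => k _.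
    by rewrite tnthS.
  apply: (@le_trans _ _ (\int[lamn n]_t (Q t * M%:E))).
    apply: ge0_le_integral => //.
    + by move=> t _; apply: integral_ge0 => u _; exact: mule_ge0.
    + exact: (measurable_fun_fubini_tonelli_G
        (fun p : C * n.-tuple C => Q p.2 * H [tuple of p.1 :: p.2])).
    + by apply: emeasurable_funM => //; exact: measurable_cst.
    + move=> t _; rewrite ge0_integralZl//.
      apply: lee_wpmul2l => //.
      (* The entry 0 is a placeholder that [upd] overwrites. *)
      apply: le_trans (HM [tuple of (0 : C)%R :: t]).
      rewrite le_eqVlt; apply/orP; left; apply/eqP; apply: eq_integral => u _.
      by rewrite jE upd_cons0.
  rewrite ge0_integralZr// exprSr EFinM; apply: lee_wpmul2r ; first by rewrite lee_fin.
  exact: (@integral_prod_le n (fun k => G k.+1)).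
Qed.

End tuple_integral_bound.

(** * The singularity |x|^(-a) in one real variable *)

Section singular_power.
Variable R : realType.
Local Notation C := R[i].
Local Notation lam := (@lebesgue_measure R).
Local Notation lamC := (lebesgue_measureC R).
Variable a : R.
Hypotheses (a0 : 0 < a) (a1 : a < 1).

Lemma ler_powRN (x y : R) : 0 < x -> x <= y -> y `^ (- a) <= x `^ (- a).
Proof.
move=> x0 xy; have y0 : 0 < y by exact: lt_le_trans xy.
rewrite !powRN lef_pV2 ?posrE ?powR_gt0//.
by apply: ge0_ler_powR => //; rewrite ?nnegrE; exact: ltW.
Qed.

(* The value at [0] is [+oo], as [0 `^ (- a) = 0]. *)
Definition phi (x : R) : \bar R :=
  if x == 0 then +oo%E else (`|x| `^ (- a))%:E.

Lemma phi_gt0 x : (0 < phi x)%E.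
Proof.
rewrite /phi; case: eqVneq => [//|x0].
by rewrite lte_fin powR_gt0// normr_gt0.
Qed.

Lemma phi_ge0 x : (0 <= phi x)%E. Proof. exact/ltW/phi_gt0. Qed.

Lemma measurable_phi : measurable_fun setT phi.
Proof.
apply: measurable_fun_ifT.
- by apply: measurable_fun_eqr => //; exact: measurable_cst.
- exact: measurable_cst.
- apply/measurable_EFinP; apply: (measurableT_comp (measurable_powR (- a))).
  exact: normr_measurable.
Qed.

Lemma powRN_le_phi s x : 0 < s -> `|x| <= s -> ((s `^ (- a))%:E <= phi x)%E.
Proof.
move=> s0 xs; rewrite /phi; case: eqVneq => [_|x0]; first exact: leey.
by rewrite lee_fin ler_powRN// normr_gt0.
Qed.

Lemma powRN_le_phiM s x y : 0 < s -> `|x| * `|y| <= s ->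
  ((s `^ (- a))%:E <= phi x * phi y)%E.
Proof.
move=> s0 xys; have px := phi_gt0 x; have py := phi_gt0 y.
have [x0|x0] := eqVneq x 0.
  have -> : phi x = +oo%E by rewrite /phi x0 eqxx.
  by rewrite gt0_mulye// leey.
have [y0|y0] := eqVneq y 0.
  have -> : phi y = +oo%E by rewrite /phi y0 eqxx.
  by rewrite gt0_muley// leey.
rewrite /phi (negbTE x0) (negbTE y0) -EFinM lee_fin -powRM//.
by apply: ler_powRN => //; rewrite mulr_gt0 ?normr_gt0.
Qed.

(** Since x^2 + y^2 >= |x| |y|, a planar singularity of exponent -2a is bounded by a product of two
    one-variable singularities of exponent -a, integrable for the same range a < 1. *)
Lemma sqn_powRN_le (u : C) : 0 < sqn u ->
  (((sqn u) `^ (- a))%:E <= phi (complex.Re u) * phi (complex.Im u))%E.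
Proof.
move=> u0; apply: powRN_le_phiM => //; rewrite /sqn.
set x := complex.Re u; set y := complex.Im u.
rewrite -[x ^+ 2]real_normK ?num_real// -[y ^+ 2]real_normK ?num_real//.
have := normr_ge0 x; have := normr_ge0 y.
have := sqr_ge0 (`|x| - `|y|); nra.
Qed.

Let I : set R := `[-1, 1]%classic.

Definition psi (x0 x : R) : \bar R := ((\1_I x)%:E * phi (x - x0))%E.

Lemma psi_ge0 x0 x : (0 <= psi x0 x)%E.
Proof. by apply: mule_ge0; [rewrite lee_fin|exact: phi_ge0]. Qed.

Lemma measurable_psi2 d (T : measurableType d) (f g : T -> R) :
  measurable_fun setT f -> measurable_fun setT g ->
  measurable_fun setT (fun t => psi (f t) (g t)).
Proof.
move=> mf mg; apply: emeasurable_funM.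
  apply/measurable_EFinP; apply: (measurableT_comp _ mg).
  by apply: measurable_indic; exact: measurable_itv.
by apply: (measurableT_comp measurable_phi); exact: measurable_funB.
Qed.

(** Each side of the singularity contributes 1 / (1 - a); farther than 1 from it the power is at
    most 1, and [-1, 1] has length 2. The bound is uniform in the centre x0. *)
Definition Mpsi : R := 2 / (1 - a) + 2.

Lemma Mpsi_gt0 : 0 < Mpsi.
Proof. by rewrite addr_gt0// divr_gt0// subr_gt0. Qed.

Lemma lebesgue_I : lam I = 2%:E.
Proof.
rewrite /I lebesgue_measure_itv /= lte_fin (_ : -1 < 1 :> R); last by lra.
by rewrite -EFinB; congr EFin; ring.
Qed.

Lemma integral_indic_I : (\int[lam]_x (\1_I x)%:E = 2%:E)%E.
Proof.
rewrite integral_indic//; last exact: measurable_itv.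
by rewrite setIT; exact: lebesgue_I.
Qed.

Let g : R -> \bar R := (fun x => (x `^ (- a))%:E) \_ `]0%R, 1%R].

Let g_ge0 x : (0 <= g x)%E.
Proof. by rewrite /g patchE; case: ifP => // _; rewrite lee_fin powR_ge0. Qed.

Let mg : measurable_fun setT g.
Proof.
apply/(measurable_restrictT _ (measurable_itv `]0, 1])).
by apply: measurable_funTS; apply/measurable_EFinP; exact: measurable_powR.
Qed.

Let int_g : (\int[lam]_x g x <= (1 / (1 - a))%:E)%E.
Proof.
have := @integral_powR01 R (- a); rewrite ltrN2 addrC => /(_ a1).
by rewrite integral_mkcond.
Qed.

Lemma integral_psi_le x0 : (\int[lam]_x psi x0 x <= Mpsi%:E)%E.
Proof.
(* [phi] on [-1, 1] is dominated by [g] on the right, its reflection on the left and [dl] for the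
   value +oo at 0, which costs nothing in the integral. *)
pose dl : R -> \bar R := (cst +oo%E) \_ [set 0].
have dl0 x : (0 <= dl x)%E.
  by rewrite /dl patchE; case: ifP => // _; exact: leey.
have mdl : measurable_fun setT dl.
  apply/(measurable_restrictT _ (measurable_set1 0)); exact: measurable_cst.
have int_dl : (\int[lam]_x dl x = 0)%E by rewrite -integral_mkcond integral_set1.
pose h x := (g x + g ((-1) * x + 0)%R + dl x)%E.
have h0 x : (0 <= h x)%E by rewrite !adde_ge0.
have mgN : measurable_fun setT (fun x : R => g ((-1) * x + 0)%R).
  exact: measurableT_comp mg (measurable_affine (-1) 0).
have mh : measurable_fun setT h.
  by do 2 apply: emeasurable_funD => //.
have int_h : (\int[lam]_x h x <= (2 / (1 - a))%:E)%E.
  rewrite ge0_integralD//; last 2 first.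
  - by move=> x _; exact: adde_ge0.
  - exact: emeasurable_funD.
  rewrite int_dl adde0 ge0_integralD//.
  have e1 : (-1 : R) != 0 by rewrite oppr_eq0 oner_eq0.
  have := ge0_integral_affine 0 e1 mg g_ge0; rewrite normrN1 mul1e => <-.
  apply: le_trans (leeD int_g int_g) _.
  by rewrite -EFinD lee_fin -mulrDl.
have psih x : (psi x0 x <= h (1 * x + - x0)%R + (\1_I x)%:E)%E.
  rewrite /psi mul1r; have [xI|xI] := boolP (x \in I); last first.
    by rewrite indicE (negbTE xI) mul0e adde0.
  rewrite indicE xI mul1e; set y := x - x0.
  have [y1|y1] := leP `|y| 1; last first.
    apply: (@le_trans _ _ 1%E); last by rewrite leeDr.
    have y0 : y != 0 by rewrite -normr_gt0 (lt_trans _ y1).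
    rewrite /phi (negbTE y0) lee_fin.
    by apply: le_trans (ler_powRN ltr01 (ltW y1)) _; rewrite powR1.
  apply: (@le_trans _ _ (h y)); last by rewrite leeDl// lee_fin.
  rewrite /phi; case: eqVneq => [y0|y0].
    by rewrite /h /dl patchE y0 mem_set// addey// gt_eqF// (lt_le_trans _ (adde_ge0 _ _)).
  have [yp|yn] := ltP 0 y.
    have -> : (`|y| `^ (- a))%:E = g y.
      rewrite /g patchE mem_set /= ?gtr0_norm//.
      by rewrite in_itv /= yp -(gtr0_norm yp).
    exact: le_trans (leeDl _ (g_ge0 ((-1) * y + 0)%R)) (leeDl _ (dl0 y)).
  have {}yn : 0 < - y by rewrite oppr_gt0 lt_neqAle y0.
  have -> : (`|y| `^ (- a))%:E = g ((-1) * y + 0)%R.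
    rewrite mulN1r addr0 -normrN (gtr0_norm yn) /g patchE mem_set//=.
    by rewrite in_itv /= yn -(gtr0_norm yn) normrN.
  exact: le_trans (leeDr _ (g_ge0 y)) (leeDl _ (dl0 y)).
have mhs : measurable_fun setT (fun x : R => h (1 * x + - x0)%R).
  exact: measurableT_comp mh (measurable_affine 1 (- x0)).
have mI : measurable_fun setT (fun x => (\1_I x)%:E : \bar R).
  by apply/measurable_EFinP; apply: measurable_indic; exact: measurable_itv.
apply: (@le_trans _ _ (\int[lam]_x (h (1 * x + - x0)%R + (\1_I x)%:E))%E).
  apply: ge0_le_integral => //.
  - by move=> x _; exact: psi_ge0.
  - by apply: measurable_psi2 => //; exact: measurable_cst.
  - exact: emeasurable_funD.
rewrite ge0_integralD//.
have := ge0_integral_affine (- x0) (oner_neq0 R) mh h0; rewrite normr1 mul1e => <-.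
rewrite integral_indic_I.
have -> : Mpsi%:E = ((2 / (1 - a))%:E + 2%:E)%E by [].
exact: leeD2r.
Qed.

Definition psiC (z u : C) : \bar R :=
  (psi (complex.Re z) (complex.Re u) * psi (complex.Im z) (complex.Im u))%E.

Lemma psiC_ge0 z u : (0 <= psiC z u)%E.
Proof. by apply: mule_ge0; exact: psi_ge0. Qed.

Lemma measurable_psiC2 d (T : measurableType d) (f1 f2 : T -> C) :
  measurable_fun setT f1 -> measurable_fun setT f2 ->
  measurable_fun setT (fun t => psiC (f1 t) (f2 t)).
Proof.
move=> mf mg'; apply: emeasurable_funM; apply: measurable_psi2.
- exact: measurable_fun_Re.
- exact: measurable_fun_Re.
- exact: measurable_fun_Im.
- exact: measurable_fun_Im.
Qed.

Lemma integral_psiC_le z : (\int[lamC]_u psiC z u <= (Mpsi * Mpsi)%:E)%E.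
Proof.
rewrite ge0_integral_lebesgueC; last 2 first.
- by apply: measurable_psiC2 => //; exact: measurable_cst.
- by move=> u; exact: psiC_ge0.
have mpsi x0 : measurable_fun setT (psi x0).
  by apply: measurable_psi2 => //; exact: measurable_cst.
have J0 : (0 <= \int[lam]_y psi (complex.Im z) y)%E.
  by apply: integral_ge0 => y _; exact: psi_ge0.
have -> : (\int[lam]_x \int[lam]_y psiC z (Complex x y) =
    \int[lam]_x (psi (complex.Re z) x * \int[lam]_y psi (complex.Im z) y))%E.
  apply: eq_integral => x _; rewrite -ge0_integralZl//; last exact: psi_ge0.
  exact: mpsi.
  by move=> y _; exact: psi_ge0.
rewrite ge0_integralZr//; [|exact: mpsi|by move=> x _; exact: psi_ge0].
rewrite EFinM; apply: lee_pmul; try exact: integral_psi_le.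
- by apply: integral_ge0 => y _; exact: psi_ge0.
- by apply: integral_ge0 => y _; exact: psi_ge0.
Qed.

End singular_power.

(** * Bounds for |1 - <z, w>| on the ball *)

Section ball_geometry.
Variables (R : realType) (d : nat).
Local Notation C := R[i].
Local Notation Cd := (d.-tuple C).
Local Notation B := (@unit_ball R d).
Implicit Types (z w : Cd).

Definition sqd z w : R := sqn (1 - hdot z w).
Definition defect z : R := 1 - \sum_(k < d) sqn (tnth z k).

Lemma defect_gt0 z : B z = (0 < defect z) :> Prop.
Proof. by rewrite unit_ballE /defect subr_gt0. Qed.

(** Polarization: 2 Re <z, w> = |z|^2 + |w|^2 - |z - w|^2. On the ball all three terms are
    nonnegative, so each of them alone bounds |1 - <z, w>| from below. *)
Lemma Re_one_sub_hdot z w : complex.Re (1 - hdot z w) =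
  (\sum_(k < d) sqn (tnth z k - tnth w k) + defect z + defect w) / 2.
Proof.
have -> : complex.Re (1 - hdot z w) =
    1 - \sum_(k < d) complex.Re (tnth z k * conjc (tnth w k)).
  by rewrite -Re_sum -/(hdot z w); case: (hdot z w).
have -> : \sum_(k < d) sqn (tnth z k - tnth w k) =
    \sum_(k < d) sqn (tnth z k) + \sum_(k < d) sqn (tnth w k)
    - 2 * \sum_(k < d) complex.Re (tnth z k * conjc (tnth w k)).
  rewrite mulr_sumr -big_split -sumrB; apply: eq_bigr => k _.
  by case: (tnth z k) (tnth w k) => [a b] [a' b']; rewrite /sqn /=; ring.
by rewrite /defect; field.
Qed.

Lemma one_sub_hdot_ge z w : B z -> B w ->
  defect z / 2 <= normc (1 - hdot z w) /\
  forall k, sqn (tnth z k - tnth w k) / 2 <= normc (1 - hdot z w).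
Proof.
rewrite !defect_gt0 => zB wB.
have S0 : 0 <= \sum_(k < d) sqn (tnth z k - tnth w k).
  by apply: sumr_ge0 => k _; exact: sqn_ge0.
have N : complex.Re (1 - hdot z w) <= normc (1 - hdot z w).
  by apply: le_trans (norm_Re_le _); exact: ler_norm.
split=> [|k]; apply: le_trans N; rewrite Re_one_sub_hdot ler_pM2r ?invr_gt0//.
  lra.
rewrite (bigD1 k)//=; set S' := \sum_(i < d | _) _.
have : 0 <= S' by apply: sumr_ge0 => i _; exact: sqn_ge0.
lra.
Qed.

Lemma one_sub_hdot_gt0 z w : B z -> B w -> 0 < normc (1 - hdot z w).
Proof.
move=> zB wB; have [+ _] := one_sub_hdot_ge zB wB; apply: lt_le_trans.
by rewrite divr_gt0// -defect_gt0.
Qed.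

Lemma one_sub_hdot_le z w : B z -> B w -> normc (1 - hdot z w) <= 2.
Proof.
move=> zB wB; apply: le_trans (le_normcD _ _) _.
rewrite normcN (_ : 2 = 1 + 1 :> R)// lerD//.
  by rewrite ComplexField.Normc.normc1.
have : normc (hdot z w) <= \sum_(k < d) normc (tnth z k * conjc (tnth w k)).
  rewrite /hdot; elim/big_rec2 : _ => [|k x y _ H].
    by rewrite ComplexField.Normc.normc0.
  by apply: le_trans (le_normcD _ _) _; rewrite lerD2l.
move/le_trans; apply.
apply: (@le_trans _ _ (\sum_(k < d) ((sqn (tnth z k) + sqn (tnth w k)) / 2))).
  apply: ler_sum => k _; rewrite ComplexField.Normc.normcM normc_conj !sqnE.
  by have := sqr_ge0 (normc (tnth z k) - normc (tnth w k)); lra.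
rewrite -mulr_suml big_split /=; move: zB wB; rewrite !unit_ballE; lra.
Qed.

Lemma sqdE z w : sqd z w = normc (1 - hdot z w) ^+ 2.
Proof. exact: sqnE. Qed.

Lemma sqd_gt0 z w : B z -> B w -> 0 < sqd z w.
Proof. by move=> zB wB; rewrite sqdE exprn_gt0// one_sub_hdot_gt0. Qed.

Lemma measurable_csum dT (T : measurableType dT) (n : nat) (F : 'I_n -> T -> C) :
  (forall i, measurable_fun setT (F i)) ->
  measurable_fun setT (fun x => \sum_(i < n) F i x).
Proof.
elim: n F => [|n IH] F mF.
  rewrite (_ : (fun _ => _) = cst 0); first exact: measurable_cst.
  by apply/funext => x; rewrite big_ord0.
rewrite (_ : (fun _ => _) = (fun x => F ord0 x + \sum_(i < n) F (lift ord0 i) x)).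
  by apply: measurable_cfunD => //; exact: IH.
by apply/funext => x; rewrite big_ord_recl.
Qed.

Lemma measurable_one_sub_hdot dT (T : measurableType dT) (f g : T -> Cd) :
  measurable_fun setT f -> measurable_fun setT g ->
  measurable_fun setT (fun x => 1 - hdot (f x) (g x)).
Proof.
move=> mf mg; apply: measurable_cfunB; first exact: measurable_cst.
apply: measurable_csum => i; apply: measurable_cfunM.
  exact: (measurableT_comp (measurable_tnth i) mf).
apply: measurable_cfun_conj.
exact: (measurableT_comp (measurable_tnth i) mg).
Qed.

Lemma measurable_sqd dT (T : measurableType dT) (f g : T -> Cd) :
  measurable_fun setT f -> measurable_fun setT g ->
  measurable_fun setT (fun x => sqd (f x) (g x)).
Proof. by move=> mf mg; apply: measurable_sqn; exact: measurable_one_sub_hdot. Qed.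

Lemma measurable_defect : measurable_fun setT defect.
Proof.
apply: measurable_funB; first exact: measurable_cst.
by apply: measurable_sum => i; apply: measurable_sqn; exact: measurable_tnth.
Qed.

End ball_geometry.

Lemma ge0_integral_mrestr dT (T : measurableType dT) (R : realType)
    (m : {measure set T -> \bar R}) (D : set T) (mD : measurable D)
    (f : T -> \bar R) : measurable_fun setT f -> (forall x, (0 <= f x)%E) ->
  (\int[mrestr m mD]_x f x = \int[m]_(x in D) f x)%E.
Proof.
move=> mf f0; rewrite -(setUv D) ge0_integral_setU//=.
- rewrite [X in (_ + X)%E]null_set_integral ?adde0//.
  + apply: eq_measure_integral => A mA AD.
    by rewrite /= /mrestr (setIidl AD).
  + exact: measurableC.
  + exact: measurable_funTS.
  + by rewrite /= /mrestr setICl measure0.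
- exact: measurableC.
- by rewrite setUv.
- by apply/disj_setPCl.
Qed.

Section vball_integral.
Variables (R : realType) (d : nat).
Local Notation Cd := (d.-tuple R[i]).
Local Notation B := (@unit_ball R d).

Lemma ge0_integral_vbf (f : Cd -> \bar R) : measurable_fun setT f ->
  (forall z, (0 <= f z)%E) -> (\int[@vbf R d]_z f z =
    (ball_volume R d)^-1%:E * \int[lebesgue_measureCn R d]_(z in B) f z)%E.
Proof.
move=> mf f0.
transitivity (\int[@vball R d]_z f z)%E; first by [].
rewrite /vball ge0_integral_mscale//; congr (_ * _)%E.
exact: ge0_integral_mrestr.
Qed.

Lemma integral_vbf_le (f : Cd -> \bar R) : measurable_fun setT f ->
  (forall z, (0 <= f z)%E) -> (\int[@vbf R d]_z f z <=
    (ball_volume R d)^-1%:E * \int[lebesgue_measureCn R d]_z f z)%E.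
Proof.
move=> mf f0; rewrite ge0_integral_vbf//; apply: lee_wpmul2l.
  by rewrite lee_fin invr_ball_volume_ge0.
by apply: ge0_subset_integral => //; exact: measurable_unit_ball.
Qed.

End vball_integral.

Lemma ge0_integralZl2 dT (T : measurableType dT) (R : realType)
    (m : {measure set T -> \bar R}) (k1 k2 : \bar R) (h : T -> \bar R) :
  measurable_fun setT h -> (forall x, (0 <= h x)%E) -> (0 <= k1)%E ->
  (0 <= k2)%E ->
  (\int[m]_x (k1 * (k2 * h x)) = k1 * (k2 * \int[m]_x h x))%E.
Proof.
move=> mh h0 k10 k20; rewrite -(ge0_integralZl m measurableT mh)//.
rewrite -ge0_integralZl//; last by move=> x _; exact: mule_ge0.
by apply: emeasurable_funM => //; exact: measurable_cst.
Qed.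

(** * Integrating the singular factors in the coordinate j *)

Section kernel_bound.
Variables (R : realType) (d' : nat).
Local Notation d := d'.+1.
Local Notation C := R[i].
Local Notation Cd := (d.-tuple C).
Local Notation B := (@unit_ball R d).
Local Notation lamn := (lebesgue_measureCn R d).
Local Notation lamC := (lebesgue_measureC R).
Local Notation lam := (@lebesgue_measure R).
Implicit Types (z w : Cd).

Local Notation I := (`[(-1 : R), 1]%classic).
Local Notation II := (rectC I I).

Lemma measurable_II : measurable II.
Proof. by apply: measurable_rectC; exact: measurable_itv. Qed.

Lemma ball_coordI z (k : 'I_d) : B z -> II (tnth z k).
Proof.
rewrite unit_ballE => zB.
have zk : sqn (tnth z k) < 1.
  apply: le_lt_trans zB; rewrite (bigD1 k)//= lerDl sumr_ge0// => j _.
  exact: sqn_ge0.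
move: zk; rewrite /sqn /rectC /= !in_itv /= => zk.
have := sqr_ge0 (complex.Re (tnth z k)); have := sqr_ge0 (complex.Im (tnth z k)).
by split; nra.
Qed.

Variables (a c : R).
Hypotheses (a0 : 0 < a) (a1 : a < 1) (c0 : 0 < c).
Local Notation Ma := (Mpsi a).
Local Notation psia := (psi a).
Local Notation psiCa := (psiC a).
Local Notation phia := (phi a).

Definition Hw (j : 'I_d) z w : \bar R :=
  ((\1_II (tnth w j))%:E * ((sqd z w) `^ (- a))%:E)%E.

Lemma Hw_ge0 j z w : (0 <= Hw j z w)%E.
Proof. by apply: mule_ge0; rewrite lee_fin// powR_ge0. Qed.

Lemma measurable_Hw j z : measurable_fun setT (Hw j z).
Proof.
apply: emeasurable_funM; apply/measurable_EFinP.
  apply: (measurableT_comp _ (measurable_tnth j)).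
  by apply: measurable_indic; exact: measurable_II.
apply: (measurableT_comp (measurable_powR (- a))).
by apply: measurable_sqd => //; exact: measurable_cst.
Qed.

Lemma hdot_upd z w j u :
  hdot z (upd w j u) = \sum_(k < d | k != j) tnth z k * conjc (tnth w k)
    + tnth z j * conjc u.
Proof.
rewrite /hdot (bigD1 j)//= addrC tnth_mktuple eqxx; congr (_ + _).
by apply: eq_bigr => k kj; rewrite tnth_mktuple (negbTE kj).
Qed.

Lemma sqn_gt0 (u : C) : u != 0 -> 0 < sqn u.
Proof.
move=> u0; rewrite lt_neqAle sqn_ge0 andbT eq_sym; apply: contra u0.
rewrite sqnE sqrf_eq0 => /eqP; move/ComplexField.Normc.eq0_normc => ->//.
Qed.

(* As a function of w_j, 1 - <z, w> is affine with slope of modulus |z_j|. *)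
Lemma integral_Hw_le j z w : c ^+ 2 <= sqn (tnth z j) ->
  (\int[lamC]_u Hw j z (upd w j u) <=
    ((c ^+ 2) `^ (- a) * (Ma * Ma))%:E)%E.
Proof.
move=> cz; have c2 : 0 < c ^+ 2 by rewrite exprn_gt0.
have zj0 : 0 < sqn (tnth z j) by exact: lt_le_trans cz.
have zn0 : tnth z j != 0.
  by apply/eqP => z0; move: zj0; rewrite z0 sqn0 ltxx.
(* The zero of the affine function, conjugated because u enters [hdot] through its conjugate. *)
pose q := conjc ((1 - \sum_(k < d | k != j) tnth z k * conjc (tnth w k)) / tnth z j).
apply: (@le_trans _ _ (\int[lamC]_u (((c ^+ 2) `^ (- a))%:E * psiCa q u))%E).
  apply: ge0_le_integral => //.
  - by move=> u _; exact: Hw_ge0.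
  - apply: (measurableT_comp (measurable_Hw j z)).
    apply/measurable_fun_tnthP => i.
    rewrite (_ : _ \o _ = fun u : C => if i == j then u else tnth w i).
      by case: (i == j); [exact: measurable_id|exact: measurable_cst].
    by apply/funext => u /=; rewrite tnth_mktuple.
  - apply: emeasurable_funM; first exact: measurable_cst.
    by apply: measurable_psiC2 => //; exact: measurable_cst.
  - move=> u _; rewrite /Hw tnth_mktuple eqxx.
    have cp : (0 <= ((c ^+ 2) `^ (- a))%:E)%E by rewrite lee_fin powR_ge0.
    have [uI|uI] := pselect (II u); last first.
      by rewrite indicE memNset// mul0e mule_ge0// psiC_ge0.
    rewrite indicE mem_set// mul1e.
    have -> : sqd z (upd w j u) = sqn (tnth z j) * sqn (u - q).
      rewrite /sqd hdot_upd -(sqn_conj (u - q)) -sqnM rmorphB /= conjcK.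
      rewrite -[LHS]sqnN; congr sqn; rewrite mulrBr [_ * (_ / _)]mulrC divfK//.
      ring.
    have -> : psiCa q u = (phia (complex.Re (u - q)%R) * phia (complex.Im (u - q)%R))%E.
      have [uRe uIm] := uI; rewrite /psiC /psi !indicE !mem_set// !mul1e.
      by case: (u) (q) => [? ?] [? ?].
    (* At the zero itself the left side is 0, by the value of [powR] at 0. *)
    have [->|uq] := eqVneq u q.
      rewrite subrr sqn0 mulr0 powR0 ?oppr_eq0 ?gt_eqF// mule_ge0//.
      by rewrite mule_ge0// phi_ge0.
    have uq0 : 0 < sqn (u - q) by rewrite sqn_gt0// subr_eq0.
    rewrite powRM ?sqn_ge0// EFinM; apply: lee_pmul.
    + by rewrite lee_fin powR_ge0.
    + by rewrite lee_fin powR_ge0.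
    + by rewrite lee_fin; apply: ler_powRN.
    + exact: sqn_powRN_le.
rewrite ge0_integralZl//; [|by apply: measurable_psiC2 => //; exact: measurable_cst|
  by move=> u _; exact: psiC_ge0|by rewrite lee_fin powR_ge0].
rewrite EFinM; apply: lee_wpmul2l; first by rewrite lee_fin powR_ge0.
exact: integral_psiC_le.
Qed.

(** The threshold 2 c^2 forces the real or the imaginary part of z_j to be at least c in absolute
    value, as the factorization in [annulus_bound] requires. *)
Definition Az (j : 'I_d) z : \bar R :=
  if (0 < defect z) && (2 * c ^+ 2 <= sqn (tnth z j))
  then ((defect z) `^ (- a))%:E else 0%E.

Lemma Az_ge0 j z : (0 <= Az j z)%E.
Proof. by rewrite /Az; case: ifP => // _; rewrite lee_fin powR_ge0. Qed.

Lemma measurable_Az j : measurable_fun setT (Az j).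
Proof.
apply: measurable_fun_ifT.
- apply: measurable_and.
    apply: measurable_fun_ltr; first exact: measurable_cst.
    exact: measurable_defect.
  apply: measurable_fun_ler; first exact: measurable_cst.
  by apply: measurable_sqn; exact: measurable_tnth.
- apply/measurable_EFinP/(measurableT_comp (measurable_powR (- a))).
  exact: measurable_defect.
- exact: measurable_cst.
Qed.

(* With r = sqrt (s - y^2) one has s - x^2 - y^2 = (r - x) (r + x), and one of
   the two factors is at least c in absolute value when c <= |x|. *)
Definition annulus_bound (s x y : R) : \bar R :=
  ((\1_I y)%:E * ((c `^ (- a))%:E *
    (psia (Num.sqrt (s - y ^+ 2)) x + psia (- Num.sqrt (s - y ^+ 2)) x)))%E.

Lemma annulus_bound_ge0 s x y : (0 <= annulus_bound s x y)%E.
Proof.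
apply: mule_ge0; first by rewrite lee_fin.
apply: mule_ge0; first by rewrite lee_fin powR_ge0.
by apply: adde_ge0; exact: psi_ge0.
Qed.

Lemma annulus_boundP s x y : I x -> I y -> c <= `|x| -> 0 < s - x ^+ 2 - y ^+ 2 ->
  (((s - x ^+ 2 - y ^+ 2) `^ (- a))%:E <= annulus_bound s x y)%E.
Proof.
move=> Ix Iy cx pos; set t := s - y ^+ 2.
rewrite /annulus_bound indicE mem_set// mul1e -/t.
have -> : s - x ^+ 2 - y ^+ 2 = t - x ^+ 2 by rewrite /t; ring.
have {}pos : 0 < t - x ^+ 2 by rewrite /t; lra.
have t0 : 0 <= t by have := sqr_ge0 x; lra.
pose r := Num.sqrt t; rewrite -/r.
have r2 : r ^+ 2 = t by rewrite sqr_sqrtr.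
have r0 : 0 <= r by exact: sqrtr_ge0.
have xr : `|x| < r.
  rewrite -ltr_sqr ?nnegrE// r2 real_normK ?num_real//; lra.
have rx0 : 0 < r - `|x| by lra.
apply: (@le_trans _ _ ((c * (r - `|x|)) `^ (- a))%:E).
  rewrite lee_fin; apply: ler_powRN => //; first by rewrite mulr_gt0.
  rewrite -r2 -(real_normK (num_real x)).
  have -> : r ^+ 2 - `|x| ^+ 2 = (r + `|x|) * (r - `|x|) by ring.
  by apply: ler_wpM2r; [exact: ltW|lra].
rewrite (powRM _ (ltW c0) (ltW rx0)) EFinM.
apply: lee_wpmul2l; first by rewrite lee_fin powR_ge0.
have [x0|x0] := leP 0 x.
  apply: le_trans (leeDl _ (psi_ge0 _ _ _)).
  rewrite /psi indicE mem_set// mul1e; apply: powRN_le_phi => //.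
  by move: rx0; rewrite ger0_norm// => rx0; rewrite ltr0_norm; lra.
apply: le_trans (leeDr _ (psi_ge0 _ _ _)).
rewrite /psi indicE mem_set// mul1e; apply: powRN_le_phi => //.
by move: rx0; rewrite ltr0_norm// => rx0; rewrite opprK gtr0_norm; lra.
Qed.

Lemma measurable_annulus_bound dT (T : measurableType dT) s (f g : T -> R) :
  measurable_fun setT f -> measurable_fun setT g ->
  measurable_fun setT (fun t => annulus_bound s (f t) (g t)).
Proof.
move=> mf mg; apply: emeasurable_funM.
  apply/measurable_EFinP/(measurableT_comp _ mg).
  by apply: measurable_indic; exact: measurable_itv.
apply: emeasurable_funM; first exact: measurable_cst.
have ms : measurable_fun setT (fun t => Num.sqrt (s - g t ^+ 2)).
  apply: (measurableT_comp (continuous_measurable_fun (@sqrt_continuous R))).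
  by apply: measurable_funB; [exact: measurable_cst|exact: measurable_funX].
apply: emeasurable_funD; apply: measurable_psi2 => //.
exact: measurable_funN.
Qed.

Definition Mann : R := 2 * (c `^ (- a) * (2 * Ma)).

(** The singular points move with y, but [integral_psi_le] is uniform in the centre, so x is
    integrated first. *)
Lemma integral_annulus_bound_le s :
  (\int[lam]_y \int[lam]_x annulus_bound s x y <= Mann%:E)%E.
Proof.
have mpsi x0 : measurable_fun setT (psia x0).
  by apply: measurable_psi2 => //; exact: measurable_cst.
apply: (@le_trans _ _ (\int[lam]_y ((\1_I y)%:E * (c `^ (- a) * (2 * Ma))%:E))%E).
  apply: ge0_le_integral => //.
  - by move=> y _; apply: integral_ge0 => x _; exact: annulus_bound_ge0.
  - apply: (measurable_fun_fubini_tonelli_F (m2 := lam)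
      (fun p : measurableTypeR R * measurableTypeR R => annulus_bound s p.2 p.1)).
      by apply: measurable_annulus_bound.
    by move=> p; exact: annulus_bound_ge0.
  - apply: emeasurable_funM; last exact: measurable_cst.
    by apply/measurable_EFinP; apply: measurable_indic; exact: measurable_itv.
  move=> y _; pose r := Num.sqrt (s - y ^+ 2).
  pose h x : \bar R := (psia r x + psia (- r) x)%E.
  have mh : measurable_fun setT h by exact: emeasurable_funD.
  have h0 x : setT x -> (0 <= h x)%E by move=> _; apply: adde_ge0; exact: psi_ge0.
  have cp : (0 <= (c `^ (- a))%:E)%E by rewrite lee_fin powR_ge0.
  have Ip : (0 <= (\1_I y)%:E :> \bar R)%E by rewrite lee_fin.
  have -> : (\int[lam]_x annulus_bound s x y =
      (\1_I y)%:E * ((c `^ (- a))%:E * \int[lam]_x h x))%E.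
    by apply: (@ge0_integralZl2 _ _ R lam _ _ h) => // x; exact: h0.
  apply: lee_wpmul2l => //; rewrite [X in (_ <= X)%E]EFinM.
  apply: lee_wpmul2l => //.
  rewrite ge0_integralD//; [|by move=> x _; exact: psi_ge0|exact: mpsi
    |by move=> x _; exact: psi_ge0|exact: mpsi].
  apply: le_trans (leeD (integral_psi_le a0 a1 _) (integral_psi_le a0 a1 _)) _.
  by rewrite -EFinD lee_fin mulr_natl mulr2n.
have K0 : 0 <= c `^ (- a) * (2 * Ma).
  by rewrite mulr_ge0 ?powR_ge0// mulr_ge0// ltW// Mpsi_gt0.
rewrite ge0_integralZr//.
- by rewrite integral_indic_I /Mann -EFinM.
- by apply/measurable_EFinP; apply: measurable_indic; exact: measurable_itv.
Qed.

Lemma defect_upd z j u : defect (upd z j u) =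
  1 - \sum_(k < d | k != j) sqn (tnth z k) - sqn u.
Proof.
rewrite /defect (bigD1 j)//= tnth_mktuple eqxx.
rewrite (eq_bigr (fun k => sqn (tnth z k))); last first.
  by move=> k kj; rewrite tnth_mktuple (negbTE kj).
by ring.
Qed.

(** Whether the real or the imaginary part of u is at least c decides in which variable the
    difference of squares is factored; the majorant is the sum of both versions. *)
Lemma integral_Az_le j z : (\int[lamC]_u Az j (upd z j u) <= (Mann + Mann)%:E)%E.
Proof.
pose s := 1 - \sum_(k < d | k != j) sqn (tnth z k).
have s1 : s <= 1.
  by rewrite /s lerBlDr lerDl sumr_ge0// => k _; exact: sqn_ge0.
have mupd : measurable_fun setT (fun u => upd z j u).
  apply/measurable_fun_tnthP => i.
  rewrite (_ : _ \o _ = fun u : C => if i == j then u else tnth z i).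
    by case: (i == j); [exact: measurable_id|exact: measurable_cst].
  by apply/funext => u /=; rewrite tnth_mktuple.
pose F (u : C) := (annulus_bound s (complex.Re u) (complex.Im u) +
  annulus_bound s (complex.Im u) (complex.Re u))%E.
have F0 u : (0 <= F u)%E by apply: adde_ge0; exact: annulus_bound_ge0.
have mF : measurable_fun setT F.
  apply: emeasurable_funD; apply: measurable_annulus_bound;
    by [exact: measurable_Re|exact: measurable_Im].
apply: (@le_trans _ _ (\int[lamC]_u F u)%E).
  apply: ge0_le_integral => //.
  - by move=> u _; exact: Az_ge0.
  - exact: (measurableT_comp (measurable_Az j) mupd).
  move=> u _; rewrite /Az defect_upd -/s tnth_mktuple eqxx.
  case: ifPn => [/andP[pos cu]|_]; last exact: F0.
  move: pos cu; rewrite {1 2 3}/sqn; case: u => x y /= pos cu.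
  have Ix : I x by rewrite /= in_itv /=; have := sqr_ge0 y; nra.
  have Iy : I y by rewrite /= in_itv /=; have := sqr_ge0 x; nra.
  rewrite /sqn /F /=.
  have [cx|cx] := leP c `|x|.
    apply: le_trans (leeDl _ (annulus_bound_ge0 _ _ _)).
    rewrite opprD addrA; apply: annulus_boundP => //; lra.
  apply: le_trans (leeDr _ (annulus_bound_ge0 _ _ _)).
  rewrite opprD addrA addrAC; apply: annulus_boundP => //; last lra.
  rewrite leNgt; apply/negP => cy.
  have sq (t : R) : `|t| < c -> t ^+ 2 < c ^+ 2.
    move=> tc; rewrite -[t ^+ 2]real_normK ?num_real//.
    by rewrite ltr_sqr ?nnegrE// ltW.
  by have := sq _ cx; have := sq _ cy; lra.
rewrite ge0_integral_lebesgueC// EFinD.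
have mT (f g : measurableTypeR R * measurableTypeR R -> R) :
    measurable_fun setT f -> measurable_fun setT g ->
    measurable_fun setT (fun p => annulus_bound s (f p) (g p)).
  exact: measurable_annulus_bound.
have -> : (\int[lam]_x \int[lam]_y F (Complex x y) =
  \int[lam]_x \int[lam]_y annulus_bound s x y +
  \int[lam]_x \int[lam]_y annulus_bound s y x)%E.
  rewrite -ge0_integralD//.
  - apply: eq_integral => x _; rewrite -ge0_integralD//.
    + by move=> y _; exact: annulus_bound_ge0.
    + by apply: measurable_annulus_bound => //; exact: measurable_cst.
    + by move=> y _; exact: annulus_bound_ge0.
    + by apply: measurable_annulus_bound => //; exact: measurable_cst.
  - by move=> x _; apply: integral_ge0 => y _; exact: annulus_bound_ge0.
  - apply: (measurable_fun_fubini_tonelli_F (m2 := lam)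
      (fun p : measurableTypeR R * measurableTypeR R => annulus_bound s p.1 p.2)).
      exact: mT.
    by move=> p; exact: annulus_bound_ge0.
  - by move=> x _; apply: integral_ge0 => y _; exact: annulus_bound_ge0.
  - apply: (measurable_fun_fubini_tonelli_F (m2 := lam)
      (fun p : measurableTypeR R * measurableTypeR R => annulus_bound s p.2 p.1)).
      exact: mT.
    by move=> p; exact: annulus_bound_ge0.
apply: leeD; last exact: integral_annulus_bound_le.
have -> : (\int[lam]_x \int[lam]_y annulus_bound s x y =
           \int[lam]_y \int[lam]_x annulus_bound s x y)%E.
  apply: (fubini_tonelli (m1 := lam) (m2 := lam)
    (fun p : measurableTypeR R * measurableTypeR R => annulus_bound s p.1 p.2)).
    exact: mT.
  by move=> p; exact: annulus_bound_ge0.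
exact: integral_annulus_bound_le.
Qed.

End kernel_bound.

(** * Finiteness of E(alpha) *)

Section kernel_square_integrable.
Variables (R : realType) (d' : nat).
Local Notation d := d'.+1.
Local Notation C := R[i].
Local Notation Cd := (d.-tuple C).
Local Notation B := (@unit_ball R d).
Local Notation lamn := (lebesgue_measureCn R d).
Local Notation lamC := (lebesgue_measureC R).
Local Notation vm := (@vbf R d).
Implicit Types (z w : Cd).

Local Notation I := (`[(-1 : R), 1]%classic).
Local Notation II := (rectC I I).

Lemma lee_prod_ord n (F G : 'I_n -> \bar R) :
  (forall k, 0 <= F k)%E -> (forall k, F k <= G k)%E ->
  (\prod_(k < n) F k <= \prod_(k < n) G k)%E.
Proof.
move=> F0 FG.
have [] : (0 <= \prod_(k < n) F k)%E /\ (\prod_(k < n) F k <= \prod_(k < n) G k)%E.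
  elim/big_ind2 : _ => // x1 x2 y1 y2 [x0 x12] [y0 y12].
  by split; [exact: mule_ge0|exact: lee_pmul].
by [].
Qed.

Lemma prod_neq_cst (j : 'I_d) (p : R) :
  (\prod_(k < d) (if k == j then 1 else p%:E) = (p ^+ d')%:E)%E.
Proof.
rewrite (bigD1 j)//= eqxx mul1e (eq_bigr (fun=> p%:E)); last first.
  by move=> k /negbTE ->.
by rewrite prodEFin prodr_const cardC1 card_ord.
Qed.

Lemma integral_II : (\int[lamC]_u (\1_II u)%:E = 4%:E :> \bar R)%E.
Proof.
rewrite integral_indic//; last exact: measurable_II.
have := @lebesgueC_rectC R I I (measurable_itv _) (measurable_itv _).
rewrite setIT => H; apply: (etrans H).
by rewrite lebesgue_I -EFinM; congr EFin; ring.
Qed.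

Variables (alpha : R).
Hypothesis alpha_lt : alpha < (d%:R + 2) / 2.

Section positive_exponent.
Hypothesis alpha0 : 0 < alpha.
Let a := 2 * alpha / (d%:R + 2).
(** Then 2 c^2 = 1 / (2 d): if |z|^2 > 1/2, some coordinate has |z_j|^2 >= 2 c^2. *)
Let c : R := Num.sqrt (4 * d%:R)^-1.

Let d2 : (0 : R) < d%:R + 2.
Proof. by rewrite ltr_pwDr. Qed.

Let a0 : 0 < a.
Proof. by rewrite /a divr_gt0// mulr_gt0. Qed.

Let a1 : a < 1.
Proof. by rewrite /a ltr_pdivrMr// mul1r; move: alpha_lt; lra. Qed.

Let alphaE : alpha * 2 = a * (d'.+1 + 2)%:R.
Proof. by rewrite /a natrD mulrC divfK// gt_eqF. Qed.

Let c2 : c ^+ 2 = (4 * d%:R)^-1.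
Proof. by rewrite sqr_sqrtr// invr_ge0 mulr_ge0. Qed.

Let c0 : 0 < c.
Proof. by rewrite sqrtr_gt0 invr_gt0 mulr_gt0. Qed.

Let M1 : R := Mpsi a * Mpsi a + (c ^+ 2) `^ (- a) * (Mpsi a * Mpsi a).

Let Mpp : 0 <= Mpsi a * Mpsi a.
Proof. by rewrite ltW// mulr_gt0 ?Mpsi_gt0. Qed.

Let M10 : 0 <= M1.
Proof. by rewrite /M1 addr_ge0// mulr_ge0// powR_ge0. Qed.

Let Gz z (k : nat) (u : C) : \bar R := psiC a (nth 0 z k) u.

Let Uw j z w : \bar R :=
  ((\prod_(k < d) if k == j then 1 else Gz z k (tnth w k)) * Hw a j z w)%E.

Let Uw_ge0 j z w : (0 <= Uw j z w)%E.
Proof.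
apply: mule_ge0; last exact: Hw_ge0.
by apply: prode_ge0 => k _; case: (k == j) => //; exact: psiC_ge0.
Qed.

Let mGz z k : measurable_fun setT (Gz z k).
Proof. by apply: measurable_psiC2 => //; exact: measurable_cst. Qed.

Let mUw j z : measurable_fun setT (Uw j z).
Proof.
apply: emeasurable_funM; last exact: measurable_Hw.
apply: emeasurable_prod => k; case: (k == j); first exact: measurable_cst.
exact: measurable_coord.
Qed.

Let sqd_powR z w : B z -> B w -> (sqd z w) `^ (- alpha) =
  (normc (1 - hdot z w)) `^ (- a) *
  ((normc (1 - hdot z w)) `^ (- a)) ^+ d' * (sqd z w) `^ (- a).
Proof.
move=> zB wB; rewrite sqdE; set N := normc _.
have N0 : 0 <= N by exact: normc_ge0.
have E (t : R) : (N ^+ 2) `^ (- t) = N `^ (- (t * 2)).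
  by rewrite -powR_mulrn// -powRrM; congr (_ `^ _); ring.
rewrite !E alphaE -exprS (mulrC a 2) -powR_mulrn ?powR_ge0// -powRrM.
rewrite -powRD; last first.
  by rewrite (gt_eqF (one_sub_hdot_gt0 zB wB)) implybT.
by congr (_ `^ _); rewrite natrD; ring.
Qed.

(* Of the d + 2 factors |1 - <z, w>|^(-a), one goes to the defect of z, one to
   each coordinate k <> j and two to the coordinate j. *)
Let sqd_powR_le j z w : B z -> B w ->
  (((sqd z w) `^ (- alpha))%:E <=
    (((defect z / 2) `^ (- a))%:E * Uw j z w))%E.
Proof.
move=> zB wB; rewrite sqd_powR//; set N := normc _.
have [N1 N2] := one_sub_hdot_ge zB wB.
have N0 : 0 < N by exact: one_sub_hdot_gt0.
have dz : 0 < defect z / 2 by rewrite divr_gt0// -defect_gt0.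
rewrite !EFinM -muleA; apply: lee_pmul.
- by rewrite lee_fin powR_ge0.
- by rewrite -EFinM lee_fin mulr_ge0 ?exprn_ge0 ?powR_ge0.
- by rewrite lee_fin ler_powRN.
apply: lee_pmul.
- by rewrite lee_fin exprn_ge0// powR_ge0.
- by rewrite lee_fin powR_ge0.
- rewrite -(prod_neq_cst j); apply: lee_prod_ord => k.
    by case: (k == j) => //; rewrite lee_fin powR_ge0.
  case: (k == j) => //; rewrite /Gz -tnth_nth.
  have [] := ball_coordI k wB; rewrite /psiC /psi => wRe wIm.
  rewrite !indicE !mem_set// !mul1e; apply: powRN_le_phiM => //.
  apply: le_trans (N2 k); rewrite /sqn.
  case: (tnth z k) (tnth w k) => [x y] [x' y'] /=.
  rewrite -[(x - x') ^+ 2]real_normK ?num_real// -[(y - y') ^+ 2]real_normK ?num_real//.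
  rewrite (distrC x') (distrC y').
  have := sqr_ge0 (`|x - x'| - `|y - y'|); nra.
- by rewrite /Hw indicE mem_set ?mul1e//; exact: ball_coordI.
Qed.

Let integral_Uw_le j z : c ^+ 2 <= sqn (tnth z j) ->
  (\int[lamn]_w Uw j z w <= (M1 ^+ d)%:E)%E.
Proof.
move=> cz; apply: integral_section_le => //.
- by move=> k u; exact: psiC_ge0.
- move=> k; apply: le_trans (integral_psiC_le a0 a1 _) _.
  by rewrite lee_fin /M1 lerDl mulr_ge0// powR_ge0.
- exact: measurable_Hw.
- by move=> w; exact: Hw_ge0.
- move=> w; apply: le_trans (integral_Hw_le a0 a1 c0 _ cz) _.
  by rewrite lee_fin /M1 lerDr.
Qed.

Variable kap : Cd -> Cd -> C.
Hypothesis mk : measurable_fun setT (kerB kap).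
Hypothesis kE : forall z w, B z -> B w -> sqn (kap z w) = (sqd z w) `^ (- alpha).

Let F z : \bar R := (\int[vm]_w (sqn (kerB kap (z, w)))%:E)%E.

Let mkz z : measurable_fun setT (fun w => (sqn (kerB kap (z, w)))%:E).
Proof.
apply/measurable_EFinP/measurable_sqn.
by apply: (measurableT_comp mk); exact: pair1_measurable.
Qed.

Let V0 : 0 <= (ball_volume R d)^-1.
Proof. exact: invr_ball_volume_ge0. Qed.

Let A1 : R := ((1 / 16) `^ (- alpha)) * fine (vm setT).
Let A2 : R := (ball_volume R d)^-1 * (M1 ^+ d * (1 / 2) `^ (- a)).

Let A10 : 0 <= A1.
Proof. by rewrite mulr_ge0 ?powR_ge0// fine_ge0. Qed.

Let A20 : 0 <= A2.
Proof. by rewrite !mulr_ge0 ?exprn_ge0// powR_ge0. Qed.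

Let kerB_out2 z w : ~ B w -> kerB kap (z, w) = 0.
Proof.
move=> wB; rewrite /kerB /=; have [zB|zB] := pselect (B z); last by rewrite rB_out.
by rewrite rB_in// rB_out.
Qed.

Let F_bulk z : B z -> 1 / 2 <= defect z -> (F z <= A1%:E)%E.
Proof.
move=> zB dz.
(* Here |1 - <z, w>| >= defect z / 2 >= 1/4, and [sqd] is the square of this modulus. *)
apply: (@le_trans _ _ (\int[vm]_w ((1 / 16) `^ (- alpha))%:E)%E).
  apply: ge0_le_integral => //.
  - by move=> w _; rewrite lee_fin sqn_ge0.
  move=> w _; rewrite lee_fin; have [wB|wB] := pselect (B w); last first.
    by rewrite kerB_out2// sqn0 powR_ge0.
  rewrite kerB_in// kE//; apply: ler_powRN => //.
  have [N1 _] := one_sub_hdot_ge zB wB.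
  by rewrite sqdE; nra.
rewrite integral_cst//= /A1 EFinM fineK//; exact: fin_num_measure.
Qed.

Let F_edge z j : B z -> 2 * c ^+ 2 <= sqn (tnth z j) ->
  (F z <= A2%:E * Az a c j z)%E.
Proof.
move=> zB cz.
have dz : 0 < defect z by rewrite -defect_gt0.
have dz2 : 0 <= (defect z / 2) `^ (- a) by rewrite powR_ge0.
apply: (@le_trans _ _ (\int[vm]_w (((defect z / 2) `^ (- a))%:E * Uw j z w))%E).
  apply: ge0_le_integral => //.
  - by move=> w _; rewrite lee_fin sqn_ge0.
  - by apply: emeasurable_funM => //; exact: measurable_cst.
  move=> w _; have [wB|wB] := pselect (B w); last first.
    by rewrite kerB_out2// sqn0 mule_ge0.
  by rewrite kerB_in// kE//; exact: sqd_powR_le.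
rewrite ge0_integralZl//.
have cz' : c ^+ 2 <= sqn (tnth z j).
  by apply: le_trans cz; have := sqr_ge0 c; lra.
apply: (@le_trans _ _ (((defect z / 2) `^ (- a))%:E *
    ((ball_volume R d)^-1 * M1 ^+ d)%:E)%E).
  apply: lee_wpmul2l => //; apply: le_trans (integral_vbf_le (mUw j z) _) _ => //.
  rewrite EFinM; apply: lee_wpmul2l; first by rewrite lee_fin.
  exact: integral_Uw_le.
rewrite /Az dz cz /= -!EFinM lee_fin /A2.
rewrite powRM ?(ltW dz)// div1r.
by rewrite le_eqVlt; apply/orP; left; apply/eqP; ring.
Qed.

(** The indicators equal 1 on the ball; they confine the other coordinates, so that the integral
    over all of C^d is finite and has the shape that [integral_section_le] handles. *)
Let AI j z : \bar R :=
  ((\prod_(k < d) if k == j then 1 else (\1_II (tnth z k))%:E) * Az a c j z)%E.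

Let AI_ge0 j z : (0 <= AI j z)%E.
Proof.
apply: mule_ge0; last exact: Az_ge0.
by apply: prode_ge0 => k _; case: (k == j) => //; rewrite lee_fin.
Qed.

Let mAI j : measurable_fun setT (AI j).
Proof.
apply: emeasurable_funM; last exact: measurable_Az.
apply: emeasurable_prod => k; case: (k == j); first exact: measurable_cst.
apply: (@measurable_coord _ _ (fun u => (\1_II u)%:E)).
by apply/measurable_EFinP; apply: measurable_indic; exact: measurable_II.
Qed.

Let AzE j z : B z -> AI j z = Az a c j z.
Proof.
move=> zB; rewrite /AI big1 ?mul1e// => k _.
case: (k == j) => //; rewrite indicE mem_set//; exact: ball_coordI.
Qed.

(** The good coordinate j varies with z; summing over all j avoids selecting it measurably. *)
Let F_le z : (F z <= A1%:E + \sum_(j < d) (A2%:E * AI j z))%E.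
Proof.
have S0 : (0 <= \sum_(j < d) (A2%:E * AI j z))%E.
  by apply: sume_ge0 => j _; exact: mule_ge0.
have [zB|zB] := pselect (B z); last first.
  have -> : F z = 0%E.
    rewrite /F (eq_integral (fun=> 0%E)) ?integral0// => w _.
    by rewrite /kerB /= rB_out// sqn0.
  exact: adde_ge0.
have [dz|dz] := leP (1 / 2) (defect z).
  by apply: le_trans (F_bulk zB dz) _; exact: leeDl.
have [j cz] : exists j, 2 * c ^+ 2 <= sqn (tnth z j).
  apply: contrapT => /forallNP H; move: dz; rewrite ltNge => /negP; apply.
  have : \sum_(k < d) sqn (tnth z k) <= \sum_(k < d) (2 * c ^+ 2).
    by apply: ler_sum => k _; have /negP := H k; rewrite -ltNge => /ltW.
  rewrite sumr_const card_ord c2 -[X in _ <= X]mulr_natr.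
  have -> : 2 * (4 * d%:R)^-1 * d%:R = 1 / 2 :> R.
    have : (d%:R : R) != 0 by rewrite pnatr_eq0.
    by move=> ?; field.
  rewrite /defect; lra.
apply: le_trans (F_edge zB cz) _; rewrite -AzE//.
rewrite (bigD1 j)//= addeCA leeDl// adde_ge0//.
by apply: sume_ge0 => k _; exact: mule_ge0.
Qed.

Let M2 : R := 4 + (Mann a c + Mann a c).

Let Mann0 : 0 <= Mann a c.
Proof.
have := @Mpsi_gt0 _ a a1 => /ltW ?.
by rewrite /Mann !mulr_ge0// powR_ge0.
Qed.

Let integral_AI_le j : (\int[lamn]_z AI j z <= (M2 ^+ d)%:E)%E.
Proof.
apply: (@integral_section_le _ M2 _ d j (fun _ u => (\1_II u)%:E) (Az a c j)).
- by rewrite /M2 !addr_ge0.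
- by move=> k; apply/measurable_EFinP; apply: measurable_indic; exact: measurable_II.
- by move=> k u; rewrite lee_fin.
- by move=> k; rewrite integral_II lee_fin /M2 lerDl addr_ge0.
- exact: measurable_Az.
- exact: Az_ge0.
- move=> t; apply: le_trans (integral_Az_le a0 a1 c0 _ _) _.
  by rewrite lee_fin /M2 lerDr.
Qed.

Lemma kerB_sqn_integral_lty_pos : (\int[vm]_z F z < +oo)%E.
Proof.
have mF : measurable_fun setT F.
  apply: (measurable_fun_fubini_tonelli_F (fun p : Cd * Cd => (sqn (kerB kap p))%:E)).
    exact/measurable_EFinP/measurable_sqn.
  by move=> p; rewrite lee_fin sqn_ge0.
apply: (@le_lt_trans _ _
  (\int[vm]_z (A1%:E + \sum_(j < d) (A2%:E * AI j z)))%E).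
  apply: ge0_le_integral => //.
  - by move=> z _; apply: integral_ge0 => w _; rewrite lee_fin sqn_ge0.
  - apply: emeasurable_funD; first exact: measurable_cst.
    apply: emeasurable_sum => j.
    by apply: emeasurable_funM => //; exact: measurable_cst.
rewrite (@ge0_integralD _ _ _ vm setT measurableT (fun=> A1%:E)
  (fun z => \sum_(j < d) (A2%:E * AI j z))%E)//; last 2 first.
- by move=> z _; apply: sume_ge0 => j _; exact: mule_ge0.
- apply: emeasurable_sum => j.
  by apply: emeasurable_funM => //; exact: measurable_cst.
apply: lte_add_pinfty.
  rewrite integral_cst//= -(fineK (fin_num_measure vm _ measurableT)).
  by rewrite -EFinM ltry.
rewrite ge0_integral_sum//; last 2 first.
- by move=> j; apply: emeasurable_funM => //; exact: measurable_cst.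
- by move=> j z _; exact: mule_ge0.
apply: lte_sum_pinfty => j _; rewrite ge0_integralZl//.
apply: lte_mul_pinfty => //.
apply: le_lt_trans (integral_vbf_le (mAI j) _) _ => //.
apply: (@le_lt_trans _ _ (((ball_volume R d)^-1)%:E * (M2 ^+ d)%:E)%E).
  by apply: lee_wpmul2l; [rewrite lee_fin|exact: integral_AI_le].
by rewrite -EFinM ltry.
Qed.

End positive_exponent.

Variable kap : Cd -> Cd -> C.
Hypothesis mk : measurable_fun setT (kerB kap).
Hypothesis kE : forall z w, B z -> B w -> sqn (kap z w) = (sqd z w) `^ (- alpha).

Lemma kerB_section_L2 z : L2 vm (fun w => kerB kap (z, w)).
Proof.
have mz : measurable_fun setT (fun w => kerB kap (z, w)).
  by apply: (measurableT_comp mk); exact: pair1_measurable.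
(* The two terms serve the two signs of alpha: [sqd] is at most 4, which bounds the power for alpha
   <= 0, and at least (defect z / 2)^2, which bounds it for alpha > 0. *)
pose K : R := 4 `^ (- alpha) + ((defect z / 2) ^+ 2) `^ (- alpha).
apply: (@L2_le _ _ _ vm _ (fun=> K) mz).
  apply/integrableP; split; first exact: measurable_cst.
  rewrite integral_cst//= -(fineK (fin_num_measure vm _ measurableT)).
  by rewrite -EFinM ltry.
move=> w; have K0 : 0 <= K by rewrite addr_ge0 ?powR_ge0.
have [zB|zB] := pselect (B z); last by rewrite /kerB /= rB_out// sqn0.
have [wB|wB] := pselect (B w); last by rewrite /kerB /= rB_in// rB_out// sqn0.
rewrite kerB_in// kE//; have sp := sqd_gt0 zB wB.
have [N1 _] := one_sub_hdot_ge zB wB.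
have dz : 0 < defect z by rewrite -defect_gt0.
have [al|al] := leP alpha 0.
  apply: ler_wpDr; first exact: powR_ge0.
  apply: ge0_ler_powR; rewrite ?oppr_ge0 ?nnegrE// ?(ltW sp)//.
  have := one_sub_hdot_le zB wB; have := normc_ge0 (1 - hdot z w).
  by rewrite sqdE; nra.
apply: ler_wpDl; first exact: powR_ge0.
apply: ler_powRN => //; first by rewrite exprn_gt0// divr_gt0.
by rewrite sqdE ler_sqr ?nnegrE ?divr_ge0 ?normc_ge0 ?(ltW dz).
Qed.

Lemma kerB_sqn_integral_lty :
  (\int[vm]_z \int[vm]_w (sqn (kerB kap (z, w)))%:E < +oo)%E.
Proof.
have [al|al] := leP alpha 0; last exact: kerB_sqn_integral_lty_pos.
have fv : (vm setT < +oo)%E.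
  by rewrite -ge0_fin_numE// fin_num_measure.
apply: (@le_lt_trans _ _ (\int[vm]_z \int[vm]_w (4 `^ (- alpha))%:E)%E).
  apply: ge0_le_integral => //.
  - by move=> z _; apply: integral_ge0 => w _; rewrite lee_fin sqn_ge0.
  - apply: (measurable_fun_fubini_tonelli_F (fun p : Cd * Cd => (sqn (kerB kap p))%:E)).
      exact/measurable_EFinP/measurable_sqn.
    by move=> p; rewrite lee_fin sqn_ge0.
  move=> z _; apply: ge0_le_integral => //.
  - by move=> w _; rewrite lee_fin sqn_ge0.
  - apply/measurable_EFinP/measurable_sqn.
    by apply: (measurableT_comp mk); exact: pair1_measurable.
  move=> w _; rewrite lee_fin.
  have [zB|zB] := pselect (B z); last by rewrite /kerB /= rB_out// sqn0 powR_ge0.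
  have [wB|wB] := pselect (B w); last by rewrite /kerB /= rB_in// rB_out// sqn0 powR_ge0.
  rewrite kerB_in// kE//; have sp := sqd_gt0 zB wB.
  apply: ge0_ler_powR; rewrite ?oppr_ge0 ?nnegrE// ?(ltW sp)//.
  have := one_sub_hdot_le zB wB; have := normc_ge0 (1 - hdot z w).
  by rewrite sqdE; nra.
under eq_integral do rewrite integral_cst//=.
rewrite integral_cst//= lte_mul_pinfty//.
- by rewrite mule_ge0// lee_fin powR_ge0.
- by rewrite fin_numM// fin_num_measure.
Qed.

End kernel_square_integrable.

(** * The two kernels *)

Section kernels.
Variables (R : realType).
Local Notation C := R[i].

Lemma normcE (u : C) : normc u = Num.sqrt (sqn u).
Proof. by case: u. Qed.

Lemma sqn_Cexp (u : C) : sqn (Cexp u) = expR (complex.Re u) ^+ 2.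
Proof.
rewrite /sqn /Cexp /= !exprMn -mulrDr cos2Dsin2 mulr1//.
Qed.

Lemma CexpD (u w : C) : Cexp (u + w) = Cexp u * Cexp w.
Proof.
case: u w => [x y] [x' y']; rewrite /Cexp /= expRD cosD sinD.
by apply/eqP; rewrite eq_complex /=; apply/andP; split; apply/eqP; ring.
Qed.

Lemma CexpN (u : C) : Cexp (- u) = (Cexp u)^-1.
Proof.
have H : Cexp u * Cexp (- u) = 1.
  by rewrite -CexpD subrr /Cexp /= expR0 cos0 sin0 mulr1 mulr0.
have u0 : Cexp u != 0.
  by apply/eqP => e; move: H; rewrite e mul0r => /eqP; rewrite eq_sym oner_eq0.
by apply: (mulfI u0); rewrite H divff.
Qed.

Lemma Arg_atan (u : C) : 0 < complex.Re u ->
  Arg u = atan (complex.Im u / complex.Re u).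
Proof.
case: u => x y /= x0; rewrite /Arg /=.
have xn0 : x != 0 by rewrite gt_eqF.
have E : x / Num.sqrt (x ^+ 2 + y ^+ 2) = cos (atan (y / x)).
  rewrite cos_atan; have -> : 1 + (y / x) ^+ 2 = (x ^+ 2 + y ^+ 2) / x ^+ 2.
    by field.
  rewrite sqrtrM ?addr_ge0 ?sqr_ge0// sqrtrV ?sqr_ge0// sqrtr_sqr gtr0_norm//.
  by rewrite invfM invrK mulrC.
rewrite E//; have piP := pi_gt0 R.
have p2 : pi / 2 <= pi :> R by lra.
have [y0|y0] := leP 0 y.
  apply: cosK; rewrite in_itv /= (le_trans (ltW (atan_ltpi2 _)))// andbT.
  by rewrite -[leLHS]atan0 le_atan// divr_ge0// ltW.
rewrite cosKN ?opprK// (le_trans _ (ltW (atan_gtNpi2 _))) ?lerN2//=.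
by rewrite -[leRHS]atan0 le_atan// ler_pdivrMr// mul0r ltW.
Qed.

(** The inverse principal power on the right half-plane, where 1 - <z, w> lies. With [atan] for the
    argument and a [powR] for the division it is visibly measurable on all of C and compatible with
    conjugation. *)
Definition cpowV (a : R) (u : C) : C :=
  Cexp (Complex (- a * ln (normc u)) (- a * atan (complex.Im u * complex.Re u `^ (-1)))).

Lemma CpowV (a : R) (u : C) : 0 < complex.Re u -> (Cpow u a)^-1 = cpowV a u.
Proof.
move=> u0; rewrite /Cpow -CexpN; congr Cexp; rewrite /CLog Arg_atan//.
rewrite powR_inv1 ?ltW//.
by apply/eqP; rewrite eq_complex /=; apply/andP; split; apply/eqP; ring.
Qed.

Lemma measurable_cpowV a : measurable_fun setT (cpowV a).
Proof.
have mn : measurable_fun setT (fun u : C => - a * ln (normc u)).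
  apply: measurable_funM; first exact: measurable_cst.
  apply: (measurableT_comp (@measurable_ln R)); exact: measurable_normc.
have ma : measurable_fun setT (fun u : C =>
    - a * atan (complex.Im u * complex.Re u `^ (-1))).
  apply: measurable_funM; first exact: measurable_cst.
  apply: (@measurableT_comp _ _ _ _ _ _ (@atan R)).
    by apply: continuous_measurable_fun => x; exact: continuous_atan.
  apply: measurable_funM; first exact: measurable_Im.
  exact: (measurableT_comp (measurable_powR (-1)) (@measurable_Re R)).
apply/measurable_fun_complexP; split => /=; apply: measurable_funM.
- exact: (measurableT_comp (@measurable_expR R)).
- apply: (@measurableT_comp _ _ _ _ _ _ (@cos R)) => //.
  by apply: continuous_measurable_fun => x; exact: continuous_cos.
- exact: (measurableT_comp (@measurable_expR R)).
- apply: (@measurableT_comp _ _ _ _ _ _ (@sin R)) => //.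
  by apply: continuous_measurable_fun => x; exact: continuous_sin.
Qed.

Lemma sqn_CpowV a (u : C) : u != 0 -> sqn ((Cpow u a)^-1) = (sqn u) `^ (- a).
Proof.
move=> u0; rewrite /Cpow -CexpN sqn_Cexp /CLog /=.
have s0 := sqn_gt0 u0.
rewrite /powR (gt_eqF s0) mul0r subr0 -expRM_natl; congr expR.
by rewrite normcE -powR12_sqrt ?ltW// ln_powR; field.
Qed.

Lemma cpowV_conj a (u : C) : cpowV a (conjc u) = conjc (cpowV a u).
Proof.
rewrite /cpowV normc_conj; case: u => x y /=.
rewrite [- y * _]mulNr atanN mulrN /Cexp /= cosN sinN mulrN//.
Qed.

Section kernels_ball.
Variable d : nat.
Local Notation Cd := (d.-tuple C).
Local Notation B := (@unit_ball R d).
Implicit Types (z w : Cd).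

Definition kapC (a : R) z w : C := (Cpow (1 - hdot z w) a)^-1.
Definition kapN (a : R) z w : C := ((normc (1 - hdot z w) `^ a)%:C%C)^-1.

Lemma Re_one_sub_hdot_gt0 z w : B z -> B w -> 0 < complex.Re (1 - hdot z w).
Proof.
rewrite !defect_gt0 => zB wB; rewrite Re_one_sub_hdot divr_gt0// addr_gt0//.
by rewrite ltr_wpDl// sumr_ge0// => k _; exact: sqn_ge0.
Qed.

Lemma one_sub_hdot_neq0 z w : B z -> B w -> 1 - hdot z w != 0.
Proof.
move=> zB wB; apply/eqP => e; have := Re_one_sub_hdot_gt0 zB wB.
by rewrite e /= ltxx.
Qed.

Lemma sqn_kapC a z w : B z -> B w -> sqn (kapC a z w) = (sqd z w) `^ (- a).
Proof. by move=> zB wB; rewrite /kapC sqn_CpowV// one_sub_hdot_neq0. Qed.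

Lemma kapN_real a z w : kapN a z w = (normc (1 - hdot z w) `^ (- a))%:C%C.
Proof. by rewrite /kapN -fmorphV powRN. Qed.

Lemma sqn_kapN a z w : B z -> B w -> sqn (kapN a z w) = (sqd z w) `^ (- a).
Proof.
move=> zB wB; rewrite kapN_real /sqn /= expr0n addr0 sqdE.
by rewrite !expr2 powRM ?normc_ge0.
Qed.

Lemma hdot_conj z w : hdot w z = conjc (hdot z w).
Proof.
rewrite /hdot rmorph_sum; apply: eq_bigr => k _.
by rewrite rmorphM /= conjcK mulrC.
Qed.

(** On the right half-plane the principal power commutes with conjugation, and exchanging z and w
    conjugates [hdot]. *)
Lemma kapC_herm a z w : B z -> B w -> kapC a w z = conjc (kapC a z w).
Proof.
move=> zB wB; rewrite /kapC !CpowV ?Re_one_sub_hdot_gt0//.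
by rewrite -cpowV_conj rmorphB rmorph1 /= hdot_conj.
Qed.

End kernels_ball.

Section kernels_measurable.
Variable d' : nat.
Local Notation d := d'.+1.
Local Notation Cd := (d.-tuple C).
Local Notation B := (@unit_ball R d).
Local Notation vm := (@vbf R d).
Implicit Types (z w : Cd).

Lemma measurable_kerB (kap : Cd -> Cd -> C) (G : C -> C) :
  measurable_fun setT G ->
  (forall z w, B z -> B w -> kap z w = G (1 - hdot z w)) ->
  measurable_fun setT (kerB kap).
Proof.
move=> mG kG; rewrite (_ : kerB kap = fun p =>
    ((\1_B p.1 : R) * \1_B p.2)%:C%C * G (1 - hdot p.1 p.2)).
  apply: measurable_cfunM.
    apply: measurable_real_complex; apply: measurable_funM.
      apply: (measurableT_comp _ (@measurable_fst _ _ Cd Cd)).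
      by apply: measurable_indic; exact: measurable_unit_ball.
    apply: (measurableT_comp _ (@measurable_snd _ _ Cd Cd)).
    by apply: measurable_indic; exact: measurable_unit_ball.
  by apply: (measurableT_comp mG); exact: measurable_one_sub_hdot.
apply/funext => -[z w] /=; rewrite !indicE.
have [zB|zB] := pselect (B z); last by rewrite /kerB /= rB_out// memNset// !mul0r.
have [wB|wB] := pselect (B w); last first.
  by rewrite /kerB /= rB_in// rB_out// (memNset wB) mulr0 mul0r.
by rewrite kerB_in// !mem_set// mulr1 mul1r kG.
Qed.

Lemma measurable_kapC a : measurable_fun setT (kerB (@kapC d a)).
Proof.
apply: (measurable_kerB (measurable_cpowV a)) => z w zB wB.
by rewrite /kapC CpowV// Re_one_sub_hdot_gt0.
Qed.

Lemma measurable_kapN a : measurable_fun setT (kerB (@kapN d a)).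
Proof.
apply: (@measurable_kerB _ (fun u => (normc u `^ (- a))%:C%C)).
  apply: measurable_real_complex.
  apply: (measurableT_comp (measurable_powR (- a))); exact: measurable_normc.
by move=> z w zB wB; rewrite kapN_real.
Qed.

Variable alpha : R.
Hypothesis alpha_lt : alpha < (d%:R + 2) / 2.

(** This is E(alpha) in dimension [d'.+1]; the unit disc is therefore [kernel_energy 0]. *)
Definition kernel_energy : \bar R :=
  (\int[vm]_z \int[vm]_w (sqn (kerB (@kapC d alpha) (z, w)))%:E)%E.

Lemma Kalpha_hilbert_schmidt : hilbert_schmidt (Kalpha (d := d) alpha).
Proof.
have mk := measurable_kapC alpha; have kE := @sqn_kapC d alpha.
exact: (Kker_hilbert_schmidt mk (kerB_sqn_integral_lty alpha_lt mk kE)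
  (kerB_section_L2 mk kE)).
Qed.

Lemma Kalpha_plus_hilbert_schmidt : hilbert_schmidt (Kalpha_plus (d := d) alpha).
Proof.
have mk := measurable_kapN alpha; have kE := @sqn_kapN d alpha.
exact: (Kker_hilbert_schmidt mk (kerB_sqn_integral_lty alpha_lt mk kE)
  (kerB_section_L2 mk kE)).
Qed.

Lemma Kalpha_has_trace :
  has_trace (adjoint (Kalpha (d := d) alpha) \o Kalpha (d := d) alpha)
    (fine kernel_energy)%:C%C.
Proof.
have mk := measurable_kapC alpha; have kE := @sqn_kapC d alpha.
exact: (Kker_has_trace mk (kerB_sqn_integral_lty alpha_lt mk kE)
  (kerB_section_L2 mk kE) (@kapC_herm d alpha)).
Qed.

Lemma kernel_energy_lty : (kernel_energy < +oo)%E.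
Proof. exact: (kerB_sqn_integral_lty alpha_lt (measurable_kapC alpha) (@sqn_kapC d alpha)). Qed.

End kernels_measurable.

End kernels.

(** * The unit disc *)

Section plane_integral.
Variables (R : realType).
Local Notation C := R[i].
Local Notation lamC := (lebesgue_measureC R).
Local Notation lam := (@lebesgue_measure R).
Implicit Types f : C -> \bar R.

Lemma measurable_Complex dT (T : measurableType dT) (f g : T -> R) :
  measurable_fun setT f -> measurable_fun setT g ->
  measurable_fun setT (fun t => Complex (f t) (g t)).
Proof. by move=> mf mg; apply/measurable_fun_complexP; split. Qed.

Let measurable_pair2 dT (T : measurableType dT) f (g h : T -> R) :
  measurable_fun setT f -> measurable_fun setT g -> measurable_fun setT h ->
  measurable_fun setT (fun t => f (Complex (g t) (h t))).
Proof.
by move=> mf mg mh; apply: (measurableT_comp mf); exact: measurable_Complex.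
Qed.

Let lebesgueC_swap f : measurable_fun setT f -> (forall u, (0 <= f u)%E) ->
  (\int[lam]_x \int[lam]_y f (Complex x y) = \int[lam]_y \int[lam]_x f (Complex x y))%E.
Proof.
move=> mf f0; apply: (fubini_tonelli (m1 := lam) (m2 := lam)
  (fun p : measurableTypeR R * measurableTypeR R => f (Complex p.1 p.2))) => //.
Qed.

Lemma lebesgueC_shear_im (k : R) f : measurable_fun setT f ->
  (forall u, (0 <= f u)%E) -> (\int[lamC]_u f u =
  \int[lamC]_u f (Complex (complex.Re u) (complex.Im u + k * complex.Re u)%R))%E.
Proof.
move=> mf f0.
have mg : measurable_fun setT (fun u : C =>
    f (Complex (complex.Re u) (complex.Im u + k * complex.Re u))).
  apply: measurable_pair2 => //; first exact: measurable_Re.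
  apply: measurable_funD; first exact: measurable_Im.
  by apply: measurable_funM; [exact: measurable_cst|exact: measurable_Re].
rewrite (ge0_integral_lebesgueC mf f0) (ge0_integral_lebesgueC mg (fun u => f0 _)).
apply: eq_integral => x _ /=.
rewrite (@ge0_integral_affine _ 1 (k * x)) ?oner_eq0//.
  by rewrite normr1 mul1e; apply: eq_integral => y _; rewrite mul1r.
by apply: measurable_pair2 => //; exact: measurable_cst.
Qed.

Lemma lebesgueC_shear_re (k : R) f : measurable_fun setT f ->
  (forall u, (0 <= f u)%E) -> (\int[lamC]_u f u =
  \int[lamC]_u f (Complex (complex.Re u + k * complex.Im u)%R (complex.Im u)))%E.
Proof.
move=> mf f0.
have mg : measurable_fun setT (fun u : C =>
    f (Complex (complex.Re u + k * complex.Im u) (complex.Im u))).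
  apply: measurable_pair2 => //; last exact: measurable_Im.
  apply: measurable_funD; first exact: measurable_Re.
  by apply: measurable_funM; [exact: measurable_cst|exact: measurable_Im].
rewrite (ge0_integral_lebesgueC mf f0) (ge0_integral_lebesgueC mg (fun u => f0 _)).
rewrite (lebesgueC_swap mf f0) [RHS](lebesgueC_swap mg (fun u => f0 _)).
apply: eq_integral => y _ /=.
rewrite (@ge0_integral_affine _ 1 (k * y)) ?oner_eq0//.
  by rewrite normr1 mul1e; apply: eq_integral => x _; rewrite mul1r.
by apply: measurable_pair2 => //; exact: measurable_cst.
Qed.

Lemma lebesgueC_scale (k : R) f : 0 < k -> measurable_fun setT f ->
  (forall u, (0 <= f u)%E) ->
  (\int[lamC]_u f u = (k ^+ 2)%:E * \int[lamC]_u f (k%:C%C * u)%R)%E.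
Proof.
move=> k0 mf f0.
have mg : measurable_fun setT (fun u : C => f (k%:C%C * u)).
  apply: (measurableT_comp mf); apply: measurable_cfunM; first exact: measurable_cst.
  exact: measurable_id.
rewrite (ge0_integral_lebesgueC mf f0) (ge0_integral_lebesgueC mg (fun u => f0 _)).
have mF : measurable_fun setT (fun x => \int[lam]_y f (Complex x y))%E.
  apply: (measurable_fun_fubini_tonelli_F (m2 := lam)
    (fun p : measurableTypeR R * measurableTypeR R => f (Complex p.1 p.2))) => //.

have mG : measurable_fun setT (fun x => \int[lam]_y f (k%:C%C * Complex x y)%R)%E.
  by apply: (measurable_fun_fubini_tonelli_F (m2 := lam)
    (fun p : measurableTypeR R * measurableTypeR R => f (k%:C%C * Complex p.1 p.2))) => //;
  apply: (measurable_pair2 mg).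
have F0 x : (0 <= \int[lam]_y f (Complex x y))%E by exact: integral_ge0.
have G0 x : setT x -> (0 <= \int[lam]_y f (k%:C%C * Complex x y)%R)%E.
  by move=> _; exact: integral_ge0.
have k0' : (0 <= k%:E)%E by rewrite lee_fin ltW.
apply: (etrans (@ge0_integral_affine _ k 0 _ (lt0r_neq0 k0) mF F0)).
rewrite (gtr0_norm k0) expr2 EFinM -muleA.
congr (_ * _)%E; rewrite -(ge0_integralZl lam measurableT mG G0 k0').
apply: eq_integral => x _.
have mfx : measurable_fun setT (fun y => f (Complex (k * x + 0) y)).
  by apply: measurable_pair2 => //; exact: measurable_cst.
apply: (etrans (@ge0_integral_affine _ k 0 _ (lt0r_neq0 k0) mfx (fun=> f0 _))).
rewrite (gtr0_norm k0); congr (_ * _)%E; apply: eq_integral => y _; congr f.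
by apply/eqP; rewrite eq_complex /=; apply/andP; split; apply/eqP; ring.
Qed.

(* A rotation of infinite order with rational coefficients, which makes it a
   product of three explicit shears and avoids trigonometry. *)
Definition rot345 : C := Complex (3 / 5) (4 / 5).

Lemma sqn_rot345 : sqn rot345 = 1.
Proof. by rewrite /sqn /=; field. Qed.

(* (3 + 4i)^2 = 3 + 4i modulo 5, so no positive power of 3 + 4i is real. *)
Lemma rot345X_neq1 n : rot345 ^+ n.+1 != 1.
Proof.
have g5 : (5%:R : C) * rot345 = Complex 3 4.
  have -> : (5%:R : C) = (5%:R)%:C%C by rewrite rmorph_nat.
  by apply/eqP; rewrite eq_complex /=; apply/andP; split; apply/eqP; field.
have [x [y E]] : exists x y : int, ((5%:R : C) * rot345) ^+ n.+1 =
    Complex (5 * x + 3)%:~R (5 * y + 4)%:~R.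
  rewrite g5; elim: n => [|n [x [y IH]]].
    by exists 0, 0; rewrite expr1 !mulr0 !add0r.
  exists (3 * x - 4 * y - 2), (3 * y + 4 * x + 4).
  rewrite exprS IH; apply/eqP; rewrite eq_complex /=.
  by rewrite !(rmorphD, rmorphB, rmorphM) /=; apply/andP; split; apply/eqP; ring.
apply/eqP => r1; move: E; rewrite exprMn r1 mulr1 => /(congr1 (@complex.Im R)).
have -> : (5%:R : C) ^+ n.+1 = (5%:R ^+ n.+1)%:C%C by rewrite rmorphXn /= rmorph_nat.
by move=> /= /eqP; rewrite eq_sym intr_eq0 => /eqP; lia.
Qed.

(** A rotation by theta is the product of shears with parameters -tan(theta/2), sin(theta),
    -tan(theta/2); here cos(theta) = 3/5, sin(theta) = 4/5 and tan(theta/2) = 1/2. Shears preserve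
    the measure by translation invariance in one variable. *)
Lemma lebesgueC_rot345 f : measurable_fun setT f -> (forall u, (0 <= f u)%E) ->
  (\int[lamC]_u f u = \int[lamC]_u f (rot345 * u)%R)%E.
Proof.
move=> mf f0.
pose A1 (u : C) := Complex (complex.Re u + (- (1 / 2)) * complex.Im u) (complex.Im u).
pose A2 (u : C) := Complex (complex.Re u) (complex.Im u + (4 / 5) * complex.Re u).
have mA1 : measurable_fun setT A1.
  apply: measurable_Complex; last exact: measurable_Im.
  apply: measurable_funD; first exact: measurable_Re.
  by apply: measurable_funM; [exact: measurable_cst|exact: measurable_Im].
have mA2 : measurable_fun setT A2.
  apply: measurable_Complex; first exact: measurable_Re.
  apply: measurable_funD; first exact: measurable_Im.
  by apply: measurable_funM; [exact: measurable_cst|exact: measurable_Re].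
have m1 := measurableT_comp mf mA1; have m2 := measurableT_comp m1 mA2.
rewrite (lebesgueC_shear_re (- (1 / 2)) mf)//.
rewrite (lebesgueC_shear_im (4 / 5) m1)//; last by move=> u; exact: f0.
rewrite (lebesgueC_shear_re (- (1 / 2)) m2)//; last by move=> u; exact: f0.
apply: eq_integral => u _; congr f; case: u => x y.
by apply/eqP; rewrite eq_complex /=; apply/andP; split; apply/eqP; field.
Qed.

End plane_integral.

(** * Orthogonality and moments of the monomials on the disc *)

Section disc_average.
Variables (R : realType).
Local Notation C := R[i].
Local Notation lamC := (lebesgue_measureC R).
Local Notation vm := (@vbf R 1).
Local Notation V := (ball_volume R 1).
Local Notation c0 w := (tnth w ord0).
Implicit Types f : C -> \bar R.

Definition disc (s : R) : set C := [set u | sqn u < s].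

Lemma measurable_disc s : measurable (disc s).
Proof.
rewrite (_ : disc s = setT `&` (@sqn R) @^-1` [set` `]-oo, s[]).
  by apply: measurable_sqn => //; exact: measurable_itv.
by rewrite setTI; apply/seteqP; split => z /=; rewrite in_itv.
Qed.

Lemma unit_ball1E (w : 1.-tuple C) : unit_ball w = disc 1 (c0 w).
Proof. by rewrite unit_ballE big_ord1. Qed.

Lemma integral_vbf1 f : measurable_fun setT f -> (forall u, (0 <= f u)%E) ->
  (\int[vm]_w f (c0 w) = V^-1%:E * \int[lamC]_u ((\1_(disc 1) u)%:E * f u))%E.
Proof.
move=> mf f0; have mD := measurable_disc 1.
have mI : measurable_fun setT (fun u : C => (\1_(disc 1) u)%:E * f u : \bar R)%E.
  apply: emeasurable_funM => //; apply/measurable_EFinP.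
  exact: measurable_indic.
rewrite ge0_integral_vbf//; last exact: (@measurable_coord R 1 f ord0 mf).
congr (_ * _)%E; rewrite integral_mkcond.
transitivity (\int[lebesgue_measureCn R 1]_w
    ((\1_(disc 1) (c0 w))%:E * f (c0 w)))%E.
  apply: eq_integral => w _; rewrite patchE indicE.
  have [wD|wD] := pselect (unit_ball w).
    by rewrite mem_set// mem_set ?mul1e// -unit_ball1E.
  by rewrite memNset// memNset ?mul0e// -unit_ball1E.
rewrite (@ge0_integral_lebesgueCnS R 0 (fun w =>
    ((\1_(disc 1) (c0 w))%:E * f (c0 w)))%E); last 2 first.
- exact: (@measurable_coord R 1 (fun u => (\1_(disc 1) u)%:E * f u)%E ord0).
- by move=> w; rewrite mule_ge0// lee_fin.
apply: eq_integral => u _.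
rewrite integral_dirac//; last first.
  apply: (measurableT_comp (@measurable_coord R 1 (fun u => (\1_(disc 1) u)%:E * f u)%E ord0 mI)).
  by apply: (measurable_cons (f := fun=> u)) => //.
by rewrite diracE mem_set// mul1e.
Qed.

Lemma disc_volume : (\int[lamC]_u (\1_(disc 1) u)%:E = V%:E)%E.
Proof.
have V0 := ball_volume_gt0 R 0.
have := @integral_vbf1 (cst 1%E) (measurable_cst _) (fun=> lee01).
rewrite integral_cst//= mul1e vball_setT vball_ball => H.
move: H; set X := (X in (_ * X)%E) => H.
have -> : (\int[lamC]_u (\1_(disc 1) u)%:E = X)%E.
  by apply: eq_integral => u _; rewrite mule1.
have X0 : (0 <= X)%E by apply: integral_ge0 => u _; rewrite mule_ge0// lee_fin.
have VN : V != 0 by rewrite gt_eqF.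
by rewrite -[LHS]mul1e -(divff VN) EFinM -muleA -H mule1.
Qed.

Lemma vbf1_rot345 f : measurable_fun setT f -> (forall u, (0 <= f u)%E) ->
  (\int[vm]_w f (c0 w) = \int[vm]_w f (rot345 R * c0 w)%R)%E.
Proof.
move=> mf f0.
have mr : measurable_fun setT (fun u : C => rot345 R * u).
  by apply: measurable_cfunM; [exact: measurable_cst|exact: measurable_id].
rewrite (integral_vbf1 mf f0).
rewrite (@integral_vbf1 (fun u => f (rot345 R * u)) (measurableT_comp mf mr))//.
congr (_ * _)%E; rewrite lebesgueC_rot345; last 2 first.
- apply: emeasurable_funM => //; apply/measurable_EFinP.
  by apply: measurable_indic; exact: measurable_disc.
- by move=> u; rewrite mule_ge0// lee_fin.
have rD u : disc 1 (rot345 R * u) = disc 1 u by rewrite /disc /= sqnM sqn_rot345 mul1r.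
apply: eq_integral => u _; congr (_%:E * _)%E; rewrite !indicE.
by have [uD|uD] := pselect (disc 1 u);
  [rewrite !mem_set// rD|rewrite !memNset// rD].
Qed.

Lemma integral_rot345 f : measurable_fun setT f ->
  (\int[vm]_w f (c0 w) = \int[vm]_w f (rot345 R * c0 w)%R)%E.
Proof.
move=> mf; rewrite integralE [RHS]integralE; congr (_ - _)%E.
  transitivity (\int[vm]_w (f^\+)%E (c0 w))%E.
    by apply: eq_integral => w _; rewrite !funeposE.
  rewrite vbf1_rot345; [|exact: measurable_funepos|by move=> u; exact: funepos_ge0].
  by apply: eq_integral => w _; rewrite !funeposE.
transitivity (\int[vm]_w (f^\-)%E (c0 w))%E.
  by apply: eq_integral => w _; rewrite !funenegE.
rewrite vbf1_rot345; [|exact: measurable_funeneg|by move=> u; exact: funeneg_ge0].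
by apply: eq_integral => w _; rewrite !funenegE.
Qed.

Lemma Cint_rot345 (h : C -> C) : measurable_fun setT h ->
  Cint vm (fun w => h (c0 w)) = Cint vm (fun w => h (rot345 R * c0 w)).
Proof.
move=> mh; rewrite /Cint /Rintegral; congr Complex; congr fine.
  apply: (@integral_rot345 (fun u => (complex.Re (h u))%:E)).
  by apply/measurable_EFinP; exact: measurable_fun_Re.
apply: (@integral_rot345 (fun u => (complex.Im (h u))%:E)).
by apply/measurable_EFinP; exact: measurable_fun_Im.
Qed.

Lemma L2_pow n : L2 vm (rB (fun w : 1.-tuple C => c0 w ^+ n)).
Proof.
have mp : measurable_fun setT (fun w : 1.-tuple C => c0 w ^+ n).
  elim: n => [|n IH]; first exact: measurable_cst.
  under eq_fun do rewrite exprS.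
  by apply: measurable_cfunM => //; exact: measurable_tnth.
apply: (@L2_le _ _ _ vm _ (fun=> 1)).
- exact/measurable_rB/measurable_funTS.
- by apply: finite_measure_integrable_cst.
- move=> w; have [wB|wB] := pselect (@unit_ball R 1 w); last by rewrite rB_out// sqn0.
  rewrite rB_in//; move: wB; rewrite unit_ball1E /disc /= => wD.
  elim: (n) => [|k IH]; first by rewrite /sqn /= expr1n expr0n addr0.
  by rewrite exprS sqnM mulr_ile1 ?sqn_ge0// ltW.
Qed.

Lemma rB1E (h : C -> C) : rB (fun w : 1.-tuple C => h (c0 w)) =
  fun w => (\1_(disc 1) (c0 w))%:C%C * h (c0 w).
Proof.
apply/funext => w; rewrite indicE.
have [wB|wB] := pselect (@unit_ball R 1 w).
  by rewrite rB_in// mem_set ?mul1r// -unit_ball1E.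
by rewrite rB_out// memNset ?mul0r// -unit_ball1E.
Qed.

(** Rotation invariance multiplies the inner product by the conjugate of [rot345] to the power n -
    m, which is not 1. One rotation of infinite order serves all pairs m < n. *)
Lemma L2ip_pow m n : (m < n)%N ->
  L2ip vm (rB (fun w : 1.-tuple C => c0 w ^+ m)) (rB (fun w => c0 w ^+ n)) = 0.
Proof.
move=> mn; pose h (u : C) := ((\1_(disc 1) u)%:C%C * u ^+ m) *
   conjc ((\1_(disc 1) u)%:C%C * u ^+ n).
have mpow k : measurable_fun setT (fun u : C => (\1_(disc 1) u)%:C%C * u ^+ k).
  apply: measurable_cfunM.
    by apply/measurable_real_complex/measurable_indic; exact: measurable_disc.
  elim: k => [|k IH]; first exact: measurable_cst.
  under eq_fun do rewrite exprS.
  by apply: measurable_cfunM => //; exact: measurable_id.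
have mh : measurable_fun setT h.
  by apply: measurable_cfunM => //; exact: measurable_cfun_conj.
set X := L2ip _ _ _.
have XE : X = Cint vm (fun w => h (c0 w)).
  by rewrite /X /L2ip (rB1E (fun u => u ^+ m)) (rB1E (fun u => u ^+ n)).
have rD u : disc 1 (rot345 R * u) = disc 1 u by rewrite /disc /= sqnM sqn_rot345 mul1r.
have ih : cintegrable vm (fun w => h (c0 w)).
  have := L2_mul (L2_pow m) (L2_pow n).
  by rewrite (rB1E (fun u => u ^+ m)) (rB1E (fun u => u ^+ n)).
have ee : rot345 R * conjc (rot345 R) = 1 by rewrite -sqn_mulJ sqn_rot345.
have : X = conjc (rot345 R ^+ (n - m)) * X.
  rewrite XE -(CintZ _ ih); apply: (etrans (Cint_rot345 mh)); apply: eq_Cint => w.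
  rewrite /h (_ : \1_(disc 1) (rot345 R * c0 w) = \1_(disc 1) (c0 w)); last first.
    rewrite !indicE; have [uD|uD] := pselect (disc 1 (c0 w)).
      by rewrite !mem_set// rD.
    by rewrite !memNset// rD.
  rewrite !exprMn !rmorphM /= -{1}(subnK (ltnW mn)) exprD rmorphM /=.
  transitivity ((rot345 R * conjc (rot345 R)) ^+ m * (conjc (rot345 R ^+ (n - m)) *
    ((\1_(disc 1) (c0 w))%:C%C * c0 w ^+ m * (conjc (\1_(disc 1) (c0 w))%:C%C * conjc (c0 w ^+ n))))).
    by rewrite exprMn -rmorphXn /=; ring.
  by rewrite ee expr1n mul1r.
move/eqP; rewrite eq_sym -subr_eq0 -{2}[X]mul1r -mulrBl mulf_eq0 => /orP[|/eqP//].
rewrite subr_eq0 => /eqP/(congr1 (@conjc R)); rewrite conjcK rmorph1 => /eqP.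
have -> : (n - m = (n - m).-1.+1)%N by rewrite prednK// subn_gt0.
by rewrite (negbTE (rot345X_neq1 _ _)).
Qed.

Lemma bernoulli_le (t : R) n : 0 <= t -> t <= 1 -> 1 - n%:R * t <= (1 - t) ^+ n.
Proof.
move=> t0 t1; elim: n => [|n IH]; first by rewrite mul0r subr0 expr0.
rewrite exprS; apply: (@le_trans _ _ ((1 - t) * (1 - n%:R * t))).
  rewrite -natr1; have : 0 <= n%:R * t * t by rewrite !mulr_ge0.
  by lra.
by apply: ler_wpM2l => //; lra.
Qed.

(** The limit s -> 1 made quantitative: with s = 1 - t, Bernoulli's inequality contradicts one of
    the two bounds as soon as n t, respectively x n t, is below half of |1 - x|. *)
Lemma eq1_of_pinch n (x : R) : 0 <= x ->
  (forall s, 0 < s -> s < 1 -> s ^+ n <= x /\ x * s ^+ n <= 1) -> x = 1.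
Proof.
move=> x0 H; have n0 : 0 <= n%:R :> R by [].
have [x1|x1|//] := ltgtP x 1.
  pose t := (1 - x) / (2 * (n%:R + 1)).
  have p : 0 < 2 * (n%:R + 1) :> R by lra.
  have t0 : 0 < t by rewrite divr_gt0// subr_gt0.
  have t1 : t < 1 by rewrite ltr_pdivrMr// mul1r; lra.
  have tE : t * (2 * (n%:R + 1)) = 1 - x by rewrite divfK// gt_eqF.
  have [| |+ _] := H (1 - t); try lra.
  have := @bernoulli_le t n (ltW t0) (ltW t1); nra.
pose t := (x - 1) / (2 * x * (n%:R + 1)).
have p : 0 < 2 * x * (n%:R + 1) :> R by rewrite !mulr_gt0//; lra.
have t0 : 0 < t by rewrite divr_gt0// subr_gt0.
have t1 : t < 1 by rewrite ltr_pdivrMr// mul1r; nra.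
have tE : t * (2 * x * (n%:R + 1)) = x - 1 by rewrite divfK// gt_eqF.
have [| |_] := H (1 - t); try lra.
have := ler_wpM2l x0 (@bernoulli_le t n (ltW t0) (ltW t1)).
have : 0 <= x * n%:R * t by rewrite mulr_ge0 ?(ltW t0)// mulr_ge0.
nra.
Qed.

(* Scaling expresses the moment of the disc of squared radius s by that of the
   unit disc, and on the annulus in between the integrand lies in [s^n, 1]; let s
   tend to 1. *)
Lemma moment n : (\int[vm]_w ((sqn (c0 w)) ^+ n)%:E = (n.+1%:R^-1)%:E)%E.
Proof.
have V0 := ball_volume_gt0 R 0.
pose J (s : R) k : \bar R := (\int[lamC]_u (\1_(disc s) u * (sqn u) ^+ k)%:E)%E.
have mJ s k : measurable_fun setT (fun u : C => (\1_(disc s) u * (sqn u) ^+ k)%:E).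
  apply/measurable_EFinP; apply: measurable_funM.
    by apply: measurable_indic; exact: measurable_disc.
  by apply: measurable_funX; apply: measurable_sqn; exact: measurable_id.
have J0 s k u : (0 <= (\1_(disc s) u * (sqn u) ^+ k)%:E :> \bar R)%E.
  by rewrite lee_fin mulr_ge0// exprn_ge0// sqn_ge0.
have JV : J 1 0%N = V%:E.
  by rewrite -disc_volume; apply: eq_integral => u _; rewrite expr0 mulr1.
have Js s k : 0 < s -> J s k = ((s ^+ k.+1)%:E * J 1%R k)%E.
  move=> s0; pose q := Num.sqrt s; have q0 : 0 < q by rewrite sqrtr_gt0.
  have q2 : q ^+ 2 = s by rewrite sqr_sqrtr// ltW.
  have sq u : sqn (q%:C%C * u) = s * sqn u.
    by rewrite sqnM {1}/sqn /= expr0n addr0 q2.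
  rewrite /J (lebesgueC_scale q0 (mJ s k) (J0 s k)) q2 exprS EFinM -muleA.
  congr (_ * _)%E; rewrite -ge0_integralZl//; last by rewrite lee_fin exprn_ge0// ltW.
  apply: eq_integral => u _; rewrite -EFinM; congr EFin; rewrite sq exprMn mulrCA.
  congr (_ * (_ * _)); rewrite !indicE.
  have E : disc s (q%:C%C * u) = disc 1 u.
    by rewrite /disc /= sq -[X in _ < X]mulr1 ltr_pM2l.
  by have [uD|uD] := pselect (disc 1 u);
    [rewrite !mem_set// E|rewrite !memNset// E].
have J1V : (J 1%R n <= V%:E)%E.
  rewrite -JV; apply: ge0_le_integral => //.
  move=> u _; rewrite lee_fin !indicE; have [uD|uD] := pselect (disc 1 u).
    by rewrite mem_set// !mul1r expr0 exprn_ile1 ?sqn_ge0// ltW.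
  by rewrite memNset// !mul0r.
have J1p s k : (0 <= J s k)%E by apply: integral_ge0.
pose l := fine (J 1 n).
have lE : J 1 n = l%:E.
  by rewrite fineK// ge0_fin_numE// (le_lt_trans J1V)// ltry.
have l0 : 0 <= l by rewrite fine_ge0.
(* Subtractions are moved across so that only nonnegative integrals occur. The content is s^n (1 -
   s) V <= (1 - s^(n+1)) l <= (1 - s) V, whose middle term is the moment over the annulus. *)
have key s : 0 < s -> s < 1 -> l + s * V <= s ^+ n.+1 * l + V /\
    s ^+ n.+1 * l + s ^+ n * V <= l + s ^+ n.+1 * V.
  move=> s0 s1.
  have JD a b s1' k1 s2' k2 : 0 <= a -> 0 <= b ->
      (\int[lamC]_u (a%:E * (\1_(disc s1') u * (sqn u) ^+ k1)%:E +
         b%:E * (\1_(disc s2') u * (sqn u) ^+ k2)%:E) =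
       a%:E * J s1' k1 + b%:E * J s2' k2)%E.
    move=> a0 b0; rewrite ge0_integralD//.
    - by congr (_ + _)%E; rewrite ge0_integralZl.
    - by move=> u _; rewrite mule_ge0.
    - by apply: emeasurable_funM => //; exact: measurable_cst.
    - by move=> u _; rewrite mule_ge0.
    - by apply: emeasurable_funM => //; exact: measurable_cst.
  have Jle a b s1' k1 s2' k2 a' b' s1'' k1' s2'' k2' :
      0 <= a -> 0 <= b -> 0 <= a' -> 0 <= b' ->
      (forall u, a * (\1_(disc s1') u * (sqn u) ^+ k1) +
         b * (\1_(disc s2') u * (sqn u) ^+ k2) <=
         a' * (\1_(disc s1'') u * (sqn u) ^+ k1') +
         b' * (\1_(disc s2'') u * (sqn u) ^+ k2')) ->
      (a%:E * J s1' k1 + b%:E * J s2' k2 <= a'%:E * J s1'' k1' + b'%:E * J s2'' k2')%E.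
    move=> a0 b0 a0' b0' H; rewrite -!JD//; apply: ge0_le_integral => //.
    - by move=> u _; rewrite adde_ge0// mule_ge0.
    - by apply: emeasurable_funD; apply: emeasurable_funM => //; exact: measurable_cst.
    - by apply: emeasurable_funD; apply: emeasurable_funM => //; exact: measurable_cst.
    - by move=> u _; rewrite -!EFinM -!EFinD lee_fin.
  have sn1 : s ^+ n <= 1 by rewrite exprn_ile1// ltW.
  have case3 u : [\/ \1_(disc s) u = 1 :> R /\ \1_(disc 1) u = 1 :> R,
     [/\ \1_(disc s) u = 0 :> R, \1_(disc 1) u = 1 :> R & s ^+ n <= sqn u ^+ n <= 1] |
     \1_(disc s) u = 0 :> R /\ \1_(disc 1) u = 0 :> R].
    rewrite !indicE; have [us|us] := pselect (disc s u).
      apply: Or31; rewrite !mem_set//; exact: lt_trans us s1.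
    have [u1|u1] := pselect (disc 1 u).
      apply: Or32; rewrite memNset// mem_set//; split => //.
      rewrite exprn_ile1 ?sqn_ge0 ?(ltW u1)// andbT.
      apply: lerXn2r; rewrite ?nnegrE ?sqn_ge0 ?(ltW s0)//.
      by rewrite leNgt; apply/negP.
    by apply: Or33; rewrite !memNset.
  split; rewrite -lee_fin !EFinD !EFinM -lE -JV.
    have := Jle 1 1 1 n s 0%N 1 1 s n 1 0%N ler01 ler01 ler01 ler01.
    rewrite !mul1e !(Js s)// expr1; apply => u; rewrite !mul1r expr0.
    by case: (case3 u) => [[-> ->]|[-> -> /andP[]]|[-> ->]]; lra.
  have sn0 : 0 <= s ^+ n by rewrite exprn_ge0// ltW.
  have := Jle 1 (s ^+ n) s n 1 0%N 1 (s ^+ n) 1 n s 0%N ler01 sn0 ler01 sn0.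
  rewrite !mul1e !(Js s)// expr1 muleA -EFinM -exprSr; apply => u; rewrite !mul1r expr0.
  by case: (case3 u) => [[-> ->]|[-> -> /andP[]]|[-> ->]]; lra.
rewrite (@integral_vbf1 (fun u => ((sqn u) ^+ n)%:E)); last 2 first.
- apply/measurable_EFinP/measurable_funX/measurable_sqn; exact: measurable_id.
- by move=> u; rewrite lee_fin exprn_ge0// sqn_ge0.
have -> : (\int[lamC]_u ((\1_(disc 1) u)%:E * (sqn u ^+ n)%:E) = l%:E)%E.
  by rewrite -lE; apply: eq_integral => u _; rewrite EFinM.
rewrite -EFinM; congr EFin.
have n1 : n.+1%:R != 0 :> R by rewrite pnatr_eq0.
apply: (mulIf n1); rewrite mulVf//; apply: (@eq1_of_pinch n).
  by rewrite !mulr_ge0// invr_ge0 ltW.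
move=> s s0 s1; have [k1 k2] := key s s0 s1.
pose m := V^-1 * l; have m0 : 0 <= m by rewrite mulr_ge0// invr_ge0 ltW.
have VN : V != 0 by rewrite gt_eqF.
have lm : l = m * V by rewrite /m mulrAC mulVf// mul1r.
have {}k1 : m * (1 - s ^+ n.+1) <= 1 - s.
  by rewrite -(ler_pM2r V0); move: k1; rewrite lm; lra.
have {}k2 : s ^+ n * (1 - s) <= m * (1 - s ^+ n.+1).
  rewrite -(ler_pM2r V0); move: k2; rewrite lm (exprSr s n); lra.
(* Division by 1 - s leaves s^n <= m S <= 1, and (n+1) s^n <= S <= n+1; together these are the two
   bounds of [eq1_of_pinch] for m (n+1). *)
pose S := \sum_(i < n.+1) s ^+ i.
have SE : 1 - s ^+ n.+1 = (1 - s) * S.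
  by rewrite -opprB subrX1 /S -mulNr opprB.
have s1' : 0 < 1 - s by rewrite subr_gt0.
have {}k1 : m * S <= 1.
  by rewrite -(ler_pM2r s1') mul1r; move: k1; rewrite SE; lra.
have {}k2 : s ^+ n <= m * S.
  by rewrite -(ler_pM2r s1'); move: k2; rewrite SE; lra.
have S1 : S <= n.+1%:R.
  rewrite /S -[X in X%:R]card_ord -sumr_const; apply: ler_sum => i _.
  by rewrite exprn_ile1// ltW.
have S2 : n.+1%:R * s ^+ n <= S.
  rewrite /S -[X in X%:R]card_ord mulr_natl -sumr_const; apply: ler_sum => i _.
  by apply: ler_wiXn2l; rewrite ?ltW// -ltnS.
rewrite -/m; split; first by apply: le_trans k2 _; exact: ler_wpM2l.
by apply: le_trans k1; rewrite -mulrA; exact: ler_wpM2l.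
Qed.

End disc_average.

(** * The binomial series *)

Section binomial_series.
Variable R : realType.
Local Notation C := R[i].
Variable alpha : R.
Hypotheses (al0 : 0 < alpha) (al2 : alpha <= 2).

(** (alpha)_n / n!, the Taylor coefficient of (1 - t)^(-alpha). *)
Fixpoint bcoef n : R :=
  if n is k.+1 then bcoef k * (alpha + k%:R) / k.+1%:R else 1.

Lemma bcoefS n : n.+1%:R * bcoef n.+1 = (alpha + n%:R) * bcoef n.
Proof.
have n1 : n.+1%:R != 0 :> R by rewrite pnatr_eq0.
by rewrite /=; field.
Qed.

Lemma bcoef_gt0 n : 0 < bcoef n.
Proof.
by elim: n => //= n IH; rewrite divr_gt0// mulr_gt0// ltr_wpDr.
Qed.

(** For alpha = 2 this is an equality: n + 1 is the coefficient of (1 - t)^(-2). *)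
Lemma bcoef_le n : bcoef n <= n.+1%:R.
Proof.
elim: n => //= n IH; rewrite ler_pdivrMr// -!natr1.
have n0 : 0 <= n%:R :> R by [].
have := bcoef_gt0 n; move: IH; rewrite -natr1 => IH b0.
apply: (@le_trans _ _ ((n%:R + 1) * (2 + n%:R))); last by nra.
apply: ler_pM => //; first exact: ltW.
- by rewrite addr_ge0// ltW.
- by rewrite lerD2r.
Qed.

Definition bsum N (u : C) : C := \sum_(n < N) (bcoef n)%:C%C * u ^+ n.

(** The two parts of the partial sum at t u as real polynomials in t, so that formal derivatives are
    available. *)
Let reX N (u : C) : {poly R} := \sum_(n < N) (bcoef n * complex.Re (u ^+ n)) *: 'X^n.
Let imX N (u : C) : {poly R} := \sum_(n < N) (bcoef n * complex.Im (u ^+ n)) *: 'X^n.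

Let bsum_poly N u : bsum N u = Complex (reX N u).[1] (imX N u).[1].
Proof.
rewrite /bsum /reX /imX; elim: N => [|N IH]; first by rewrite !big_ord0 !horner0.
rewrite !big_ord_recr /= IH !hornerD !hornerZ !hornerXn !expr1n !mulr1.
case: (u ^+ N) => a b /=; apply/eqP; rewrite eq_complex /=.
by apply/andP; split; apply/eqP; ring.
Qed.

(** Real and imaginary parts of (1 - t u) p' = alpha u p - N b_N u^N t^(N-1), the differential
    equation of the binomial series with its truncation error. For N = 0 the factor N makes the
    exponent harmless. *)
Let rel N u t : let x := complex.Re u in let y := complex.Im u in
  ((1 - x * t) * (reX N u)^`().[t] + y * t * (imX N u)^`().[t] =
    alpha * (x * (reX N u).[t] - y * (imX N u).[t])
    - N%:R * bcoef N * complex.Re (u ^+ N) * t ^+ N.-1) /\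
  ((1 - x * t) * (imX N u)^`().[t] - y * t * (reX N u)^`().[t] =
    alpha * (x * (imX N u).[t] + y * (reX N u).[t])
    - N%:R * bcoef N * complex.Im (u ^+ N) * t ^+ N.-1).
Proof.
move=> x y; elim: N => [|N [IH1 IH2]].
  by rewrite /reX /imX !big_ord0 deriv0 !horner0; split; ring.
have -> : reX N.+1 u = reX N u + (bcoef N * complex.Re (u ^+ N)) *: 'X^N.
  by rewrite /reX big_ord_recr.
have -> : imX N.+1 u = imX N u + (bcoef N * complex.Im (u ^+ N)) *: 'X^N.
  by rewrite /imX big_ord_recr.
rewrite !derivD !hornerD !derivZ !hornerZ derivXn hornerMn !hornerXn /=.
set p := (reX N u).[t] in IH1 IH2 *; set q := (imX N u).[t] in IH1 IH2 *.
set p' := (reX N u)^`().[t] in IH1 IH2 *; set q' := (imX N u)^`().[t] in IH1 IH2 *.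
have bS := bcoefS N.
have uS : complex.Re (u ^+ N.+1) = x * complex.Re (u ^+ N) - y * complex.Im (u ^+ N) /\
   complex.Im (u ^+ N.+1) = x * complex.Im (u ^+ N) + y * complex.Re (u ^+ N).
  by rewrite exprS /x /y; case: (u) (u ^+ N) => [a b] [a' b'].
case: uS => -> ->; rewrite -/(bcoef N.+1) bS.
have tE : t ^+ N.-1 * t * N%:R = t ^+ N * N%:R.
  by case: (N) => [|n]; rewrite ?mulr0//= exprSr.
rewrite -(mulr_natr (t ^+ N.-1)).
set T := t ^+ N.-1 in IH1 IH2 tE *; set T' := t ^+ N in tE *.
set a := complex.Re (u ^+ N) in IH1 IH2 *; set b := complex.Im (u ^+ N) in IH1 IH2 *.
set cN := bcoef N in IH1 IH2 *.
split; [move: IH1|move: IH2] => E.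
- have -> : (1 - x * t) * (p' + cN * a * (T * N%:R)) + y * t * (q' + cN * b * (T * N%:R)) =
    ((1 - x * t) * p' + y * t * q') + cN * a * (T * N%:R)
     - x * cN * a * (T * t * N%:R) + y * cN * b * (T * t * N%:R) by ring.
  by rewrite E tE; ring.
- have -> : (1 - x * t) * (q' + cN * b * (T * N%:R)) - y * t * (p' + cN * a * (T * N%:R)) =
    ((1 - x * t) * q' - y * t * p') + cN * b * (T * N%:R)
     - x * cN * b * (T * t * N%:R) - y * cN * a * (T * t * N%:R) by ring.
  by rewrite E tE; ring.
Qed.

Lemma sqnX (u : C) n : sqn (u ^+ n) = sqn u ^+ n.
Proof.
elim: n => [|n IH]; first by rewrite /sqn /= expr1n expr0n addr0.
by rewrite !exprS sqnM IH.
Qed.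

Let normX_le (u : C) r n : 0 <= r -> sqn u <= r ^+ 2 ->
  `|complex.Re (u ^+ n)| <= r ^+ n /\ `|complex.Im (u ^+ n)| <= r ^+ n.
Proof.
move=> r0 ur; have nr : normc (u ^+ n) <= r ^+ n.
  rewrite -ler_sqr ?nnegrE ?normc_ge0 ?exprn_ge0// -sqnE sqnX -exprM mulnC exprM.
  by rewrite lerXn2r ?nnegrE ?sqn_ge0 ?exprn_ge0.
by split; apply: le_trans nr; [exact: norm_Re_le|exact: norm_Im_le].
Qed.

Let horner_le (u : C) r N t (s : C -> R) : 0 <= r -> r <= 1 -> 0 <= t -> t <= 1 ->
  (forall n, `|s (u ^+ n)| <= r ^+ n) ->
  `|(\sum_(n < N) (bcoef n * s (u ^+ n)) *: 'X^n : {poly R}).[t]| <= N%:R ^+ 2.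
Proof.
move=> r0 r1 t0 t1 H; rewrite horner_sum; apply: le_trans (ler_norm_sum _ _ _) _.
apply: (@le_trans _ _ (\sum_(n < N) N%:R)); last first.
  by rewrite sumr_const card_ord expr2 mulr_natl.
apply: ler_sum => n _; rewrite hornerZ hornerXn !normrM (gtr0_norm (bcoef_gt0 n)).
rewrite (ger0_norm (exprn_ge0 _ t0)) -[leRHS]mulr1; apply: ler_pM.
- by rewrite mulr_ge0// ltW// bcoef_gt0.
- exact: exprn_ge0.
- rewrite -[leRHS]mulr1; apply: ler_pM => //; first by rewrite ltW// bcoef_gt0.
    by apply: le_trans (bcoef_le n) _; rewrite ler_nat.
  by apply: le_trans (H n) _; rewrite exprn_ile1.
- exact: exprn_ile1.
Qed.

Let natX_le (q : R) n : 0 <= q -> q < 1 -> n.+1%:R * q ^+ n <= (1 - q)^-1.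
Proof.
move=> q0 q1; have q1' : 0 < 1 - q by rewrite subr_gt0.
rewrite -[leRHS]div1r ler_pdivlMr//.
apply: (@le_trans _ _ ((\sum_(i < n.+1) q ^+ i) * (1 - q))).
  apply: ler_wpM2r; first exact: ltW.
  rewrite -[X in X%:R]card_ord mulr_natl -sumr_const; apply: ler_sum => i _.
  by apply: ler_wiXn2l; rewrite ?(ltW q1)// -ltnS.
rewrite mulrC -opprB mulNr -subrX1 opprB lerBlDr lerDl exprn_ge0//.
Qed.

(* The function t |-> |bsum N (t u)|^2 |1 - t u|^(2 alpha) is 1 at t = 0, and the
   differential equation of the binomial series makes its derivative
   exponentially small in N, uniformly in |u| <= r. *)
Lemma bsum_approx (r : R) : 0 < r -> r < 1 ->
  exists K q : R, [/\ 0 <= K, 0 < q, q < 1 & forall N u, sqn u <= r ^+ 2 ->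
    `|sqn (bsum N.+1 u) * (sqn (1 - u)) `^ alpha - 1| <= K * q ^+ N.+1].
Proof.
(* The error will be of order N^3 (N + 1) r^N; writing r = q^5, four factors q^N absorb the powers
   of N and one remains. *)
move=> r0 r1; pose q := r `^ (5%:R)^-1.
have q0 : 0 < q by rewrite powR_gt0.
have q5 : q ^+ 5 = r.
  by rewrite -powR_mulrn ?powR_ge0// -powRrM mulVf ?pnatr_eq0// powRr1// ltW.
have q1 : q < 1.
  rewrite ltNge; apply/negP => q1; move: r1; rewrite -q5 ltNge => /negP; apply.
  exact: exprn_ege1.
pose M := (1 - q)^-1; have M0 : 0 < M by rewrite invr_gt0 subr_gt0.
(* |1 - t u|^2 stays in [(1 - r)^2, 5]; one of the two terms bounds its power, according to the sign
   of alpha - 1. *)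
pose K0 := ((1 - r) ^+ 2) `^ (alpha - 1) + 5 `^ (alpha - 1).
have K00 : 0 <= K0 by rewrite addr_ge0 ?powR_ge0.
exists (K0 * (16 * M ^+ 4)), q; split => //.
  by rewrite mulr_ge0// mulr_ge0// exprn_ge0// (ltW M0).
move=> N' u ur; set N := N'.+1.
set x := complex.Re u; set y := complex.Im u.
(* [H] and [W] are the squared moduli of the partial sum and of 1 - t u, as polynomials in t. *)
pose H : {poly R} := reX N u ^+ 2 + imX N u ^+ 2.
pose W : {poly R} := (1 - x *: 'X) ^+ 2 + (y *: 'X) ^+ 2.
have WE t : W.[t] = (1 - x * t) ^+ 2 + (y * t) ^+ 2 by rewrite /W !hornerE !expr2 !hornerE.
have [xr yr] : `|x| <= r /\ `|y| <= r.
  by have [] := @normX_le u r 1 (ltW r0) ur; rewrite !expr1.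
have Wb t : 0 <= t -> t <= 1 -> (1 - r) ^+ 2 <= W.[t] <= 5.
  move=> t0 t1; rewrite WE.
  have xt : `|x * t| <= r.
    by rewrite normrM (ger0_norm t0) -[leRHS]mulr1 ler_pM.
  have yt : `|y * t| <= r.
    by rewrite normrM (ger0_norm t0) -[leRHS]mulr1 ler_pM.
  move: xt yt; rewrite !ler_norml => /andP[? ?] /andP[? ?]; apply/andP; split; nra.
have W0 t : 0 <= t -> t <= 1 -> 0 < W.[t].
  move=> t0 t1; have /andP[+ _] := Wb t t0 t1; apply: lt_le_trans.
  by rewrite exprn_gt0// subr_gt0.
pose g (t : R) := H.[t] * W.[t] `^ alpha.
pose dg (t : R) := W.[t] `^ (alpha - 1) * (H^`().[t] * W.[t] + alpha * H.[t] * W^`().[t]).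
have Dg (t : R) : 0 <= t -> t <= 1 -> is_derive t (1 : R) (g : R -> R) (dg t).
  move=> t0 t1; have Wt := W0 t t0 t1.
  have D1 : is_derive t (1 : R) ((fun t => W.[t] `^ alpha) : R -> R)
      (alpha * W.[t] `^ (alpha - 1) * W^`().[t]).
    exact: (is_derive1_comp (is_derive1_powR alpha Wt) (is_derive_poly W t)).
  have := is_deriveM (is_derive_poly H t) D1.
  rewrite (_ : _ *: _ + _ *: _ = dg t)//.
  have -> : W.[t] `^ alpha = W.[t] `^ (alpha - 1) * W.[t].
    rewrite -[X in _ = _ * X]powRr1 ?(ltW Wt)// -powRD ?subrK//.
    by rewrite (gt_eqF Wt) implybT.
  by rewrite /dg /GRing.scale /=; ring.
have [t + gE] : exists2 c, c \in `](0:R), 1[%R & g 1 - g 0 = dg c * (1 - 0).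
  apply: MVT => //.
    by move=> t; rewrite in_itv /= => /andP[t0 t1]; apply: Dg; exact: ltW.
  apply: derivable_within_continuous => t; rewrite in_itv /= => /andP[t0 t1].
  by apply: ex_derive; exact: Dg.
rewrite in_itv /= => /andP[/ltW t0 /ltW t1].
have g0 : g 0 = 1.
  rewrite /g WE !mulr0 subr0 expr1n expr0n addr0 powR1 mulr1 /H.
  rewrite hornerD !horner_exp /reX /imX !big_ord_recl /= !hornerD !hornerZ !hornerXn.
  rewrite !horner_sum !big1; last first.
  - by move=> i _; rewrite hornerZ hornerXn expr0n /= mulr0.
  - by move=> i _; rewrite hornerZ hornerXn expr0n /= mulr0.
  by rewrite /=; ring.
have g1 : g 1 = sqn (bsum N u) * (sqn (1 - u)) `^ alpha.
  rewrite bsum_poly /g /H hornerD !horner_exp; congr (_ * _ `^ _).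
  rewrite WE !mulr1 /x /y; case: (u) => a b; rewrite /sqn /=; ring.
move: gE; rewrite subr0 mulr1 g0 g1 => ->.
have /andP[Wl Wu] := Wb t t0 t1; have Wt := W0 t t0 t1.
have K0E : W.[t] `^ (alpha - 1) <= K0.
  have [a1|a1] := leP 1 alpha.
    apply: ler_wpDl; first exact: powR_ge0.
    by apply: ge0_ler_powR; rewrite ?nnegrE ?subr_ge0// ltW.
  apply: ler_wpDr; first exact: powR_ge0.
  rewrite -opprB; apply: ler_powRN => //; first by rewrite subr_gt0.
  by rewrite exprn_gt0// subr_gt0.
rewrite /dg normrM (ger0_norm (powR_ge0 _ _)) -[leRHS]mulrA; apply: ler_pM => //.
  exact: powR_ge0.
have [R1 R2] := rel N u t.
have [uR uI] := @normX_le u r N (ltW r0) ur.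
have pB := @horner_le u r N t (@complex.Re R) (ltW r0) (ltW r1) t0 t1
   (fun n => (@normX_le u r n (ltW r0) ur).1).
have qB := @horner_le u r N t (@complex.Im R) (ltW r0) (ltW r1) t0 t1
   (fun n => (@normX_le u r n (ltW r0) ur).2).
rewrite -/(reX N u) in pB; rewrite -/(imX N u) in qB.
rewrite -/x -/y in R1 R2.
have HE : H^`().[t] = 2 * ((reX N u).[t] * (reX N u)^`().[t] + (imX N u).[t] * (imX N u)^`().[t]).
  by rewrite /H derivD !deriv_exp !expr1 hornerD !hornerMn !hornerM; ring.
have WE' : W^`().[t] = - 2 * x * (1 - x * t) + 2 * y * (y * t).
  have d1 : (1 : {poly R})^`() = 0 by rewrite -polyC1 derivC.
  rewrite /W derivD !deriv_exp derivB d1 !derivZ derivX !expr1 hornerD !hornerMn !hornerM.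
  rewrite sub0r -polyC1 !(hornerD, hornerN, hornerZ, hornerX, hornerC).
  by ring.
have HE0 : H.[t] = (reX N u).[t] ^+ 2 + (imX N u).[t] ^+ 2.
  by rewrite /H hornerD !horner_exp.
rewrite HE WE' HE0 WE.
move: R1 R2 pB qB uR uI.
set p := (reX N u).[t]; set p' := (reX N u)^`().[t].
set qq := (imX N u).[t]; set q' := (imX N u)^`().[t].
move=> R1 R2 pB qB uR uI.
(* By [rel] the terms carrying alpha cancel in the derivative and only these two truncation errors
   remain. *)
pose r1' := N%:R * bcoef N * complex.Re (u ^+ N) * t ^+ N.-1.
pose r2' := N%:R * bcoef N * complex.Im (u ^+ N) * t ^+ N.-1.
have -> : 2 * (p * p' + qq * q') * ((1 - x * t) ^+ 2 + (y * t) ^+ 2) +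
    alpha * (p ^+ 2 + qq ^+ 2) * (- 2 * x * (1 - x * t) + 2 * y * (y * t)) =
    - 2 * (r1' * (p * (1 - x * t) + qq * (y * t)) + r2' * (qq * (1 - x * t) - p * (y * t))).
  have -> : 2 * (p * p' + qq * q') * ((1 - x * t) ^+ 2 + (y * t) ^+ 2) =
     2 * (((1 - x * t) * p' + y * t * q') * ((1 - x * t) * p + y * t * qq) +
          ((1 - x * t) * q' - y * t * p') * ((1 - x * t) * qq - y * t * p)) by ring.
  by rewrite R1 R2 /r1' /r2'; ring.
pose D := N%:R * N.+1%:R * r ^+ N.
have D0 : 0 <= D by rewrite !mulr_ge0// exprn_ge0// ltW.
have rB s : `|s| <= r ^+ N -> `|N%:R * bcoef N * s * t ^+ N.-1| <= D.
  have Nb : 0 <= N%:R * bcoef N by rewrite mulr_ge0// ltW// bcoef_gt0.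
  move=> sr; rewrite (normrM (N%:R * bcoef N * s)) (normrM (N%:R * bcoef N)).
  rewrite (ger0_norm (exprn_ge0 _ t0)) (ger0_norm Nb).
  rewrite -[leRHS]mulr1; apply: ler_pM => //.
  - by rewrite mulr_ge0.
  - exact: exprn_ge0.
  - apply: ler_pM => //.
    by apply: ler_wpM2l => //; exact: bcoef_le.
  - exact: exprn_ile1.
have r1B : `|r1'| <= D by exact: rB.
have r2B : `|r2'| <= D by exact: rB.
have lB : `|1 - x * t| <= 2.
  have : `|x * t| <= 1 by rewrite normrM (ger0_norm t0) mulr_ile1// (le_trans xr (ltW r1)).
  by rewrite !ler_norml => /andP[? ?]; apply/andP; split; lra.
have mB : `|y * t| <= 2.
  have : `|y * t| <= 1 by rewrite normrM (ger0_norm t0) mulr_ile1// (le_trans yr (ltW r1)).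
  by rewrite !ler_norml => /andP[? ?]; apply/andP; split; lra.
have prodB (a b : R) : `|a| <= N%:R ^+ 2 -> `|b| <= 2 -> `|a * b| <= 2 * N%:R ^+ 2.
  by move=> aB bB; rewrite normrM [leRHS]mulrC; apply: ler_pM.
have sB (s a b : R) : `|s| <= D -> `|a| <= 2 * N%:R ^+ 2 -> `|b| <= 2 * N%:R ^+ 2 ->
    `|s * (a + b)| <= D * (4 * N%:R ^+ 2).
  move=> sD aB bB; rewrite normrM; apply: ler_pM => //.
  by apply: le_trans (ler_normD _ _) _; lra.
have F : `|r1' * (p * (1 - x * t) + qq * (y * t)) +
    r2' * (qq * (1 - x * t) - p * (y * t))| <= D * (8 * N%:R ^+ 2).
  apply: le_trans (ler_normD _ _) _.
  have := sB r1' (p * (1 - x * t)) (qq * (y * t)) r1B (prodB _ _ pB lB) (prodB _ _ qB mB).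
  have := sB r2' (qq * (1 - x * t)) (- (p * (y * t))) r2B (prodB _ _ qB lB).
  by rewrite normrN => /(_ (prodB _ _ pB mB)); lra.
rewrite normrM normrN normr_nat.
apply: (@le_trans _ _ (2 * (D * (8 * N%:R ^+ 2)))); first by rewrite ler_pM2l.
rewrite /D -q5 -exprM mulnC exprM.
have NqM : N.+1%:R * q ^+ N <= M by apply: natX_le => //; exact: ltW.
have NqM' : N%:R * q ^+ N <= M.
  by apply: le_trans NqM; apply: ler_wpM2r; rewrite ?exprn_ge0 ?ler_nat// ltW.
have X : (N%:R * q ^+ N) ^+ 3 * (N.+1%:R * q ^+ N) <= M ^+ 3 * M.
  apply: ler_pM => //; rewrite ?exprn_ge0// ?mulr_ge0// ?exprn_ge0 ?(ltW q0)//.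
  by rewrite lerXn2r// nnegrE ?(ltW M0)// mulr_ge0// exprn_ge0// ltW.
have := ler_wpM2r (exprn_ge0 N (ltW q0)) X.
move: (q ^+ N) (N%:R : R) (N.+1%:R : R) => Q n1 n2; lra.
Qed.

End binomial_series.

Lemma qn_lincomb_orthogonal (R : realType) (T : Type) (P : (T -> R[i]) -> Prop)
    (ip : (T -> R[i]) -> (T -> R[i]) -> R[i]) (ph : prehilbert P ip) n
    (c : nat -> R[i]) (e : nat -> T -> R[i]) :
  (forall k, P (e k)) -> (forall i j, (i < j)%N -> ip (e i) (e j) = 0) ->
  qn ip (lincomb n c e) = \sum_(k < n) sqn (c k) * qn ip (e k).
Proof.
move=> Pe oe; have Pl : P (lincomb n c e) by apply: (ph_lincomb ph).
apply: complexI; rewrite -(qnE ph Pl) (ip_lincombl ph)// rmorph_sum /=.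
apply: eq_bigr => k _; rewrite (ip_lincombr ph)// (bigD1 k)//= big1 ?addr0.
  by rewrite (qnE ph (Pe k)) rmorphM /= sqn_mulJ mulrA.
move=> j jk; have [jlk|klj|/ord_inj jk'] := ltngtP j k.
- by rewrite (ph_conj ph (Pe j) (Pe k)) oe// conjc0 mulr0.
- by rewrite oe// mulr0.
- by rewrite jk' eqxx in jk.
Qed.

Lemma eq_integral_vbf (R : realType) d (f g : d.-tuple R[i] -> \bar R) :
  measurable_fun setT f -> measurable_fun setT g ->
  (forall z, (0 <= f z)%E) -> (forall z, (0 <= g z)%E) ->
  (forall z, unit_ball z -> f z = g z) ->
  (\int[@vbf R d]_z f z = \int[@vbf R d]_z g z)%E.
Proof.
move=> mf mg f0 g0 fg; rewrite !ge0_integral_vbf//; congr (_ * _)%E.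
by apply: eq_integral => z /set_mem; exact: fg.
Qed.

(** * E(alpha) on the disc as a series *)

Section disc_energy.
Variable R : realType.
Local Notation C := R[i].
Local Notation C1 := (1.-tuple C).
Local Notation vm := (@vbf R 1).
Local Notation B := (@unit_ball R 1).
Local Notation c0 w := (tnth w ord0).
Variable alpha : R.
Hypotheses (al0 : 0 < alpha) (al1 : alpha < 3 / 2).
Local Notation b := (bcoef alpha).

Let al2 : alpha <= 2.
Proof. by move: al1; lra. Qed.
Let alpha_lt : alpha < (1%:R + 2) / 2.
Proof. by move: al1; lra. Qed.

Let ph := L2_prehilbert vm.
Let e n : C1 -> C := rB (fun w : C1 => c0 w ^+ n).

Let measurable_sqnX n : measurable_fun setT (fun w : C1 => ((sqn (c0 w)) ^+ n)%:E).
Proof.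
by apply/measurable_EFinP/measurable_funX/measurable_sqn; exact: measurable_tnth.
Qed.

Let qn_e n : qn (L2ip vm) (e n) = n.+1%:R^-1.
Proof.
apply: EFin_inj; rewrite L2_qn; last exact: L2_pow.
rewrite -moment; apply: eq_integral_vbf => //.
- by apply/measurable_EFinP/measurable_sqn; case: (L2_pow R n).
- by move=> z; rewrite lee_fin sqn_ge0.
- by move=> z; rewrite lee_fin exprn_ge0// sqn_ge0.
- by move=> z zB; rewrite /e rB_in// sqnX.
Qed.

Let hdot1 (z w : C1) : hdot z w = c0 z * conjc (c0 w).
Proof. by rewrite /hdot big_ord1. Qed.

Let psum (z : C1) N : R := \sum_(n < N) b n ^+ 2 / n.+1%:R * sqn (c0 z) ^+ n.

Let F (z : C1) N : C1 -> C := rB (fun w => bsum alpha N (hdot z w)).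

Let FE z N w : sqn (F z N w) =
  sqn (lincomb N (fun n => (b n)%:C%C * conjc (c0 z) ^+ n) e w).
Proof.
have [wB|wB] := pselect (B w); last first.
  rewrite /F rB_out// /lincomb big1 ?sqn0// => n _.
  by rewrite /e rB_out// mulr0.
rewrite /F rB_in// -sqn_conj; congr sqn; rewrite /bsum rmorph_sum /lincomb.
apply: eq_bigr => n _; rewrite /e rB_in// rmorphM rmorphXn /= oppr0 -mulrA.
by rewrite hdot1 rmorphM /= conjcK exprMn.
Qed.

Let measurable_F z N : measurable_fun setT (fun w => (sqn (F z N w))%:E).
Proof.
under eq_fun do rewrite FE.
apply/measurable_EFinP/measurable_sqn.
by have [] := ph_lincomb ph (fun n => (b n)%:C%C * conjc (c0 z) ^+ n)
   (fun k (_ : (k < N)%N) => L2_pow R k).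
Qed.

Let integral_F z N : (\int[vm]_w (sqn (F z N w))%:E = (psum z N)%:E)%E.
Proof.
transitivity (qn (L2ip vm) (lincomb N (fun n => (b n)%:C%C * conjc (c0 z) ^+ n) e))%:E.
  rewrite L2_qn; first by apply: eq_integral => w _; rewrite FE.
  by apply: (ph_lincomb ph) => k _; exact: L2_pow.
congr EFin; rewrite (qn_lincomb_orthogonal ph) => [|k|i j ij]; last 2 first.
- exact: L2_pow.
- exact: L2ip_pow.
apply: eq_bigr => n _; rewrite qn_e sqnM sqnX sqn_conj {1}/sqn /= expr0n addr0.
by rewrite mulrAC.
Qed.

Let J (z : C1) : \bar R := (\int[vm]_w (sqn (kerB (@kapC R 1 alpha) (z, w)))%:E)%E.

Let measurable_kz z : measurable_fun setT (fun w => (sqn (kerB (@kapC R 1 alpha) (z, w)))%:E).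
Proof.
apply/measurable_EFinP/measurable_sqn.
by have [] := kerB_section_L2 (@measurable_kapC R 0 alpha) (@sqn_kapC R 1 alpha) z.
Qed.

Let J_fin z : J z \is a fin_num.
Proof.
have [_ iJ] := kerB_section_L2 (@measurable_kapC R 0 alpha) (@sqn_kapC R 1 alpha) z.
exact: integrable_fin_num iJ.
Qed.

Let J_ge0 z : (0 <= J z)%E.
Proof. by apply: integral_ge0 => w _; rewrite lee_fin sqn_ge0. Qed.

(** The error in [bsum_approx] is relative to the kernel and uniform in w, so integration in w turns
    it into a multiple of the finite number J z, while the partial sums integrate exactly by
    orthogonality. *)
Let F_approx z : B z -> exists K q : R, [/\ 0 <= K, 0 < q, q < 1 & forall N,
  `|psum z N.+1 - fine (J z)| <= K * q ^+ N.+1 * fine (J z)].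
Proof.
move=> zB; have : sqn (c0 z) < 1 by move: zB; rewrite unit_ball1E.
(* By the arithmetic-geometric mean inequality r^2 >= |z|^2 >= |<z, w>|^2, and still r < 1. *)
have s0 := sqn_ge0 (c0 z) => s1; pose r := (1 + sqn (c0 z)) / 2.
have r0 : 0 < r by rewrite /r divr_gt0//; lra.
have r1 : r < 1 by rewrite /r ltr_pdivrMr// mul1r; lra.
have [K [q [K0 q0 q1 Kq]]] := bsum_approx al0 al2 r0 r1.
exists K, q; split => // N; set ep := K * _.
have ep0 : 0 <= ep by rewrite mulr_ge0// exprn_ge0// ltW.
have pw w : sqn (kerB (@kapC R 1 alpha) (z, w)) <= sqn (F z N.+1 w) +
      ep * sqn (kerB (@kapC R 1 alpha) (z, w)) /\
    sqn (F z N.+1 w) <= sqn (kerB (@kapC R 1 alpha) (z, w)) +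
      ep * sqn (kerB (@kapC R 1 alpha) (z, w)).
  have [wB|wB] := pselect (B w); last first.
    by rewrite /F /kerB /= rB_in// !rB_out// sqn0 mulr0 addr0.
  rewrite kerB_in// sqn_kapC// /F rB_in//.
  have ur : sqn (hdot z w) <= r ^+ 2.
    rewrite hdot1 sqnM sqn_conj.
    have : sqn (c0 w) < 1 by move: wB; rewrite unit_ball1E.
    have := sqn_ge0 (c0 w); move: s0; rewrite /r.
    move: (sqn (c0 z)) (sqn (c0 w)) => s t *.
    have : s * t <= s by rewrite -[leRHS]mulr1 ler_wpM2l// ltW.
    have := sqr_ge0 (1 - s).
    have -> : ((1 + s) / 2) ^+ 2 = s + (1 - s) ^+ 2 / 4 by field.
    lra.
  have := Kq N _ ur; rewrite -/ep -/(sqd z w).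
  have A0 : 0 < sqd z w `^ (- alpha) by rewrite powR_gt0// sqd_gt0.
  have E : sqd z w `^ alpha = (sqd z w `^ (- alpha))^-1 by rewrite powRN invrK.
  rewrite E; move: (sqd z w `^ (- alpha)) A0 => A A0; set G := sqn (bsum _ _ _).
  rewrite ler_distl => /andP[]; rewrite ler_pdivlMr// ler_pdivrMr//.
  by move=> *; split; lra.
have fin1 : (fine (J z))%:E = J z by rewrite (fineK (J_fin z)).
have up : (J z <= (psum z N.+1)%:E + ep%:E * J z)%E /\
    ((psum z N.+1)%:E <= J z + ep%:E * J z)%E.
  rewrite -integral_F /J -ge0_integralZl//; last by move=> w _; rewrite lee_fin sqn_ge0.
  have mk2 : measurable_fun setT (fun w => (ep%:E * (sqn (kerB (@kapC R 1 alpha) (z, w)))%:E)%E).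
    by apply: emeasurable_funM; [exact: measurable_cst|exact: measurable_kz].
  have k20 w : setT w -> (0 <= ep%:E * (sqn (kerB (@kapC R 1 alpha) (z, w)))%:E)%E.
    by move=> _; rewrite -EFinM lee_fin mulr_ge0// sqn_ge0.
  have k0 w : setT w -> (0 <= (sqn (kerB (@kapC R 1 alpha) (z, w)))%:E)%E.
    by move=> _; rewrite lee_fin sqn_ge0.
  have F0 w : setT w -> (0 <= (sqn (F z N.+1 w))%:E)%E.
    by move=> _; rewrite lee_fin sqn_ge0.
  split.
    rewrite -(ge0_integralD _ measurableT F0 (measurable_F z N.+1) k20 mk2).
    apply: ge0_le_integral => //.
    - by apply: emeasurable_funD.
    - by move=> w _; rewrite -EFinM -EFinD lee_fin; case: (pw w).
  rewrite -(ge0_integralD _ measurableT k0 (measurable_kz z) k20 mk2).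
  apply: ge0_le_integral => //.
  - by apply: emeasurable_funD.
  - by move=> w _; rewrite -EFinM -EFinD lee_fin; case: (pw w).
move: up; rewrite -fin1 -EFinM -!EFinD !lee_fin => -[u1 u2].
by rewrite ler_distl; apply/andP; split; lra.
Qed.

Let Jseries z : B z ->
  J z = (\sum_(0 <= n <oo) (b n ^+ 2 / n.+1%:R * sqn (c0 z) ^+ n)%:E)%E.
Proof.
move=> zB; apply/esym/cvg_lim => //.
have -> : (fun n => (\sum_(0 <= k < n) (b k ^+ 2 / k.+1%:R * sqn (c0 z) ^+ k)%:E)%E) =
    EFin \o psum z.
  by apply/funext => n; rewrite big_mkord /= sumEFin.
rewrite -(fineK (J_fin z)); apply/fine_cvgP; split; first exact: nearW.
rewrite (_ : fine \o (EFin \o psum z) = psum z)//.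
rewrite -cvg_shiftS /=; apply/cvgrPdist_le => eps eps0.
have [K [q [K0 q0 q1 Kq]]] := F_approx zB.
have cq : (fun N => K * q ^+ N.+1 * fine (J z)) @ \oo --> (0 : R).
  have : geometric (K * fine (J z)) q @ \oo --> (0 : R).
    by apply: cvg_geometric; rewrite gtr0_norm.
  rewrite -cvg_shiftS; apply: cvg_trans; apply: near_eq_cvg; apply: nearW => n /=.
  by rewrite mulrAC.
move/cvgrPdist_le: cq => /(_ _ eps0); apply: filterS => N /=.
rewrite sub0r normrN => H; rewrite distrC; apply: le_trans (Kq N) _.
exact: le_trans (ler_norm _) H.
Qed.

Lemma kernel_energy_series : kernel_energy 0 alpha =
  (\sum_(0 <= n <oo) ((b n / n.+1%:R) ^+ 2)%:E)%E.
Proof.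
have t0 n (z : C1) : (0 <= (b n ^+ 2 / n.+1%:R * sqn (c0 z) ^+ n)%:E)%E.
  by rewrite lee_fin mulr_ge0 ?exprn_ge0 ?sqn_ge0// mulr_ge0 ?sqr_ge0// invr_ge0.
have mt n : measurable_fun setT (fun z : C1 => (b n ^+ 2 / n.+1%:R * sqn (c0 z) ^+ n)%:E).
  under eq_fun do rewrite EFinM.
  by apply: emeasurable_funM => //; exact: measurable_cst.
transitivity (\int[vm]_z \sum_(0 <= n <oo) (b n ^+ 2 / n.+1%:R * sqn (c0 z) ^+ n)%:E)%E.
  apply: eq_integral_vbf.
  - apply: (measurable_fun_fubini_tonelli_F
      (fun p : C1 * C1 => (sqn (kerB (@kapC R 1 alpha) p))%:E)).
      by apply/measurable_EFinP/measurable_sqn; exact: measurable_kapC.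
    by move=> p; rewrite lee_fin sqn_ge0.
  - by apply: ge0_emeasurable_sum => // k z _ _; exact: t0.
  - exact: J_ge0.
  - by move=> z; apply: nneseries_ge0 => n _ _; exact: t0.
  - exact: Jseries.
rewrite integral_nneseries//; apply: eq_eseriesr => n _.
under eq_integral do rewrite EFinM.
rewrite ge0_integralZl//; last 2 first.
- by move=> z _; rewrite lee_fin exprn_ge0// sqn_ge0.
- by rewrite lee_fin mulr_ge0 ?sqr_ge0// invr_ge0.
by rewrite moment -EFinM; congr EFin; rewrite expr_div_n expr2 invfM; ring.
Qed.

End disc_energy.

(** * The Gamma function *)

Section gamma_function.
Variable R : realType.
Local Notation lam := (@lebesgue_measure R).
Local Notation D := (`]0%R, +oo[%classic : set R).
Implicit Types x t s p : R.

Definition gam x t : R := t `^ (x - 1) * expR (- t).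
Definition eGamma x : \bar R := (\int[lam]_(t in D) (gam x t)%:E)%E.

Lemma gam_ge0 x t : 0 <= gam x t.
Proof. by rewrite mulr_ge0 ?powR_ge0 ?expR_ge0. Qed.

Lemma measurable_gam x : measurable_fun setT (gam x).
Proof.
apply: measurable_funM; first exact: measurable_powR.
by apply: (measurableT_comp (@measurable_expR R)); exact: measurable_funN.
Qed.

Let mD : measurable D. Proof. exact: measurable_itv. Qed.

Let mEgam x (A : set R) : measurable_fun A (fun t => (gam x t)%:E).
Proof. by apply: measurable_funTS; apply/measurable_EFinP; exact: measurable_gam. Qed.

(** The inequality y <= exp y at y = t / (2 p), raised to the power p. *)
Lemma powR_le_expR p : 0 < p ->
  exists2 K : R, 0 <= K & forall t, 0 < t -> t `^ p <= K * expR (t / 2).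
Proof.
move=> p0; have p2 : 0 < 2 * p by rewrite mulr_gt0.
exists ((2 * p) `^ p); first exact: powR_ge0.
move=> t t0; have tE : t = (2 * p) * (t / (2 * p)) by field; rewrite gt_eqF.
rewrite {1}tE (powRM _ (ltW p2) (divr_ge0 (ltW t0) (ltW p2))).
apply: ler_wpM2l; first exact: powR_ge0.
have -> : expR (t / 2) = expR (t / (2 * p)) `^ p.
  by rewrite -expRM; congr expR; field; rewrite gt_eqF.
apply: ge0_ler_powR; rewrite ?nnegrE ?expR_ge0 ?divr_ge0 ?(ltW p0) ?(ltW t0) ?(ltW p2)//.
by apply: le_trans (expR_ge1Dx _); rewrite lerDr.
Qed.

Let half_exp : (\int[lam]_(t in `[0%R, +oo[) (expR (- t / 2))%:E <= 2%:E)%E.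
Proof.
have h0 : 0 < 2^-1 :> R by rewrite invr_gt0.
have H := integral_exponential_pdf h0.
have : (\int[lam]_(t in `[0%R, +oo[) (2%:E * (exponential_pdf 2^-1 t)%:E) <= 2%:E)%E.
  rewrite ge0_integralZl//; last 2 first.
  - by apply/measurable_EFinP/measurable_funTS; exact: measurable_exponential_pdf.
  - by move=> t _; rewrite lee_fin exponential_pdf_ge0 ?ltW.
  rewrite -[leRHS]mule1; apply: lee_wpmul2l => //; rewrite -H.
  apply: ge0_subset_integral => //.
  - by apply/measurable_EFinP; exact: measurable_exponential_pdf.
  - by move=> t _; rewrite lee_fin exponential_pdf_ge0 ?ltW.
apply: le_trans; rewrite le_eqVlt; apply/orP; left; apply/eqP.
apply: eq_integral => t; rewrite inE /= in_itv /= andbT => t0.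
rewrite -EFinM exponential_pdfE//=; congr EFin.
by rewrite mulrA divff ?mul1r//; congr expR; ring.
Qed.

Lemma eGamma_lty x : 0 < x -> (eGamma x < +oo)%E.
Proof.
move=> x0.
have [K K0 HK] : exists2 K : R, 0 <= K & forall t, 1 < t -> t `^ (x - 1) <= K * expR (t / 2).
  have [x1|x1] := leP x 1.
    exists 1 => // t t1; rewrite mul1r; apply: (@le_trans _ _ 1).
      rewrite -opprB powRN invf_le1 ?powR_gt0 ?(lt_trans _ t1)//.
      by rewrite -[leLHS](powRr0 t) ler_powR ?subr_ge0// ltW.
    by rewrite -expR0 ler_expR divr_ge0// ltW// (lt_trans _ t1).
  have [|K K0 HK] := @powR_le_expR (x - 1); first by rewrite subr_gt0.
  by exists K => // t t1; apply: HK; exact: lt_trans t1.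
have DU : D = `]0%R, 1%R]%classic `|` `]1%R, +oo[%classic.
  rewrite -itv_bndbnd_setU//; first by rewrite bnd_simp.
rewrite /eGamma DU ge0_integral_setU//=; last 2 first.
- by move=> t _; rewrite lee_fin gam_ge0.
- apply/disj_setPS => t /= []; rewrite !in_itv /= andbT => /andP[_ t1] /(le_lt_trans t1).
  by rewrite ltxx.
apply: lte_add_pinfty.
  apply: (@le_lt_trans _ _ (\int[lam]_(t in `]0%R, 1%R]) (t `^ (x - 1))%:E)%E).
    apply: ge0_le_integral => //.
    - by move=> t _; rewrite lee_fin gam_ge0.
    - exact: mEgam.
    - by apply: measurable_funTS; apply/measurable_EFinP; exact: measurable_powR.
    move=> t /=; rewrite in_itv /= => /andP[t0 _].
    by rewrite lee_fin ler_piMr ?powR_ge0// -expR0 ler_expR lerNl oppr0 ltW.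
  by apply: le_lt_trans (integral_powR01 _) _; [lra|rewrite ltry].
apply: (@le_lt_trans _ _ (\int[lam]_(t in `[0%R, +oo[) (K%:E * (expR (- t / 2))%:E))%E).
  apply: (@le_trans _ _ (\int[lam]_(t in `]1%R, +oo[) (K%:E * (expR (- t / 2))%:E))%E).
    have me : measurable_fun setT (fun t => expR (- t / 2) : R).
      apply: (measurableT_comp (@measurable_expR R)); apply: measurable_funM => //.
    apply: ge0_le_integral => //.
    - by move=> t _; rewrite lee_fin gam_ge0.
    - exact: mEgam.
    - by apply: measurable_funTS; apply: emeasurable_funM => //; exact/measurable_EFinP.
    move=> t /=; rewrite in_itv /= andbT => t1; rewrite -EFinM lee_fin.
    have -> : expR (- t / 2) = expR (t / 2) * expR (- t) by rewrite -expRD; congr expR; field.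
    by rewrite mulrA ler_wpM2r ?expR_ge0// HK.
  have me : measurable_fun setT (fun t => expR (- t / 2) : R).
    by apply: (measurableT_comp (@measurable_expR R)); apply: measurable_funM => //.
  apply: ge0_subset_integral => //.
  - by apply: measurable_funTS; apply: emeasurable_funM => //; exact/measurable_EFinP.
  - by move=> t _; rewrite mule_ge0// lee_fin expR_ge0.
  move=> t /=; rewrite !in_itv /= !andbT => t1; exact: ltW (lt_trans _ t1).
have me : measurable_fun (`[0%R, +oo[%classic : set R) (fun t : R => (expR (- t / 2))%:E).
  apply: measurable_funTS; apply/measurable_EFinP.
  by apply: (measurableT_comp (@measurable_expR R)); apply: measurable_funM => //.
have e0 (t : R) : `[0%R, +oo[%classic t -> (0 <= (expR (- t / 2))%:E)%E.
  by move=> _; rewrite lee_fin expR_ge0.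
have K0' : (0 <= K%:E)%E by rewrite lee_fin.
rewrite (ge0_integralZl lam (measurable_itv _) me e0 K0').
apply: (@le_lt_trans _ _ (K%:E * 2%:E)%E); first exact: lee_wpmul2l.
by rewrite -EFinM ltry.
exact: mEgam.
Qed.

Lemma eGamma_ge0 x : (0 <= eGamma x)%E.
Proof. by apply: integral_ge0 => t _; rewrite lee_fin gam_ge0. Qed.

Lemma GammaE x : 0 < x -> (Gamma x)%:E = eGamma x.
Proof.
by move=> x0; rewrite /Gamma /Rintegral fineK// ge0_fin_numE ?eGamma_ge0// eGamma_lty.
Qed.

Lemma Gamma_gt0 x : 0 < x -> 0 < Gamma x.
Proof.
move=> x0; rewrite -lte_fin GammaE//.
(* A lower bound of the integrand on [1, 2]; the minimum covers both signs of x - 1. *)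
pose q : R := expR (- 2) * Num.min 1 (2 `^ (x - 1)).
have q0 : 0 < q by rewrite mulr_gt0 ?expR_gt0// lt_min ltr01 powR_gt0.
apply: (@lt_le_trans _ _ (\int[lam]_(t in `[1%R, 2%R]) q%:E)%E).
  have L : lam `[(1 : R), 2]%classic = 1%:E.
    by rewrite lebesgue_measure_itv /= lte_fin ltr1n -EFinB; congr EFin; ring.
  rewrite integral_cst; last exact: measurable_itv.
  by rewrite [X in (_ * X)%E](_ : _ = 1%:E) ?mule1 ?lte_fin//; exact: L.
apply: (@le_trans _ _ (\int[lam]_(t in `[1%R, 2%R]) (gam x t)%:E)%E).
  apply: ge0_le_integral => //.
  - by move=> t _; rewrite lee_fin ltW.
  - exact: mEgam.
  move=> t /=; rewrite in_itv /= => /andP[t1 t2]; rewrite lee_fin /q mulrC.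
  have t0 : 0 < t by exact: lt_le_trans t1.
  apply: ler_pM; rewrite ?expR_ge0 ?le_min ?powR_ge0 ?ler01//; last by rewrite ler_expR lerN2.
  rewrite ge_min; have [x1|x1] := leP 1 x.
    by apply/orP; left; rewrite -[leLHS](powRr0 t) ler_powR ?subr_ge0.
  apply/orP; right; rewrite -opprB; apply: ler_powRN => //; by rewrite subr_gt0.
apply: ge0_subset_integral => //.
- exact: mEgam.
- by move=> t _; rewrite lee_fin gam_ge0.
- by move=> t /=; rewrite !in_itv /= andbT => /andP[t1 _]; exact: lt_le_trans t1.
Qed.

Let der_pow x t : 0 < t -> is_derive t (1 : R) (fun t : R => t `^ x) (x * t `^ (x - 1)).
Proof. exact: is_derive1_powR. Qed.

Let der_exp t : is_derive t (1 : R) (fun t : R => expR (- t)) (- expR (- t)).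
Proof.
have H := is_derive1_comp (is_derive_expR (- t)) (is_deriveN (is_derive_id t (1:R))).
by apply: is_derive_eq H _; rewrite mulrN1.
Qed.

(** Away from 0 and infinity integration by parts applies directly; n + 2 makes the interval
    nondegenerate already for n = 0. *)
Let Ieps x (n : nat) : \bar R :=
  (\int[lam]_(t in `[(n.+2%:R^-1)%R, (n.+2%:R)%R]) (gam x t)%:E)%E.

Let parts x (n : nat) : 0 < x ->
  fine (Ieps (x + 1) n) + n.+2%:R `^ x * expR (- n.+2%:R) =
  x * fine (Ieps x n) + n.+2%:R^-1 `^ x * expR (- n.+2%:R^-1).
Proof.
move=> x0; rewrite /Ieps; set u : R := n.+2%:R^-1; set v : R := n.+2%:R.
have v0 : 0 < v :> R by []; have u0 : 0 < u by rewrite invr_gt0.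
have uv : u < v.
  by apply: (@lt_trans _ _ 1); rewrite /u /v ?invf_lt1 ?ltr1n.
have cpow (p : R) t : 0 < t -> {for t, continuous (fun t : R => t `^ p)}.
  move=> t0; apply/differentiable_continuous/derivable1_diffP.
  by apply: ex_derive; exact: der_pow.
have cexp (t : R) : {for t, continuous (fun t : R => expR (- t))}.
  by apply/differentiable_continuous/derivable1_diffP; apply: ex_derive.
have cwithin (f : R -> R) : (forall t, 0 < t -> {for t, continuous f}) ->
    {within `[u, v], continuous f}.
  move=> cf; apply: continuous_in_subspaceT => t; rewrite inE /= in_itv /= => /andP[ut _].
  by apply: cf; exact: lt_le_trans ut.
have LR (f df : R -> R) : (forall t, 0 < t -> is_derive t (1 : R) f (df t)) ->
    derivable_oo_LRcontinuous f u v.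
  move=> df'; have cf t : 0 < t -> {for t, continuous f}.
    by move=> t0; apply/differentiable_continuous/derivable1_diffP; have := df' t t0 => d; apply: ex_derive.
  split.
  - move=> t; rewrite in_itv /= => /andP[ut _]; have := df' t (lt_trans u0 ut) => d.
    exact: ex_derive.
  - exact/cvg_at_right_filter/cf.
  - exact/cvg_at_left_filter/cf.
have P := @integration_by_parts R (fun t => t `^ x) (fun t => expR (- t))
  (fun t => x * t `^ (x - 1)) (fun t => - expR (- t)) u v uv.
have {}P : (\int[lam]_(t in `[u, v]) (t `^ x * - expR (- t))%:E =
    (v `^ x * expR (- v) - u `^ x * expR (- u))%:E -
    \int[lam]_(t in `[u, v]) (x * t `^ (x - 1) * expR (- t))%:E)%E.
  apply: P.
  - by apply: cwithin => t t0; apply: continuousM; [exact: cst_continuous|exact: cpow].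
  - by apply: (LR _ (fun t => x * t `^ (x - 1))) => t; exact: der_pow.
  - move=> t; rewrite in_itv /= => /andP[ut _]; rewrite derive1E.
    by have := der_pow x (lt_trans u0 ut) => d; rewrite derive_val.
  - by apply: cwithin => t t0; apply: continuousN; exact: cexp.
  - by apply: (LR _ (fun t => - expR (- t))) => t _; exact: der_exp.
  - by move=> t _; rewrite derive1E; have := der_exp t => d; rewrite derive_val.
pose I1 := (\int[lam]_(t in `[u, v]) (gam (x + 1) t)%:E)%E.
pose I0 := (\int[lam]_(t in `[u, v]) (gam x t)%:E)%E.
have sub : `[u, v]%classic `<=` D.
  by move=> t /=; rewrite !in_itv /= andbT => /andP[ut _]; exact: lt_le_trans ut.
have fin y : 0 < y -> (\int[lam]_(t in `[u, v]) (gam y t)%:E)%E \is a fin_num.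
  move=> y0; rewrite ge0_fin_numE; last first.
    by apply: integral_ge0 => t _; rewrite lee_fin gam_ge0.
  apply: le_lt_trans (eGamma_lty y0); apply: ge0_subset_integral => //.
  - exact: mEgam.
  - by move=> t _; rewrite lee_fin gam_ge0.
have e1 : (\int[lam]_(t in `[u, v]) (t `^ x * - expR (- t))%:E = - I1)%E.
  rewrite /I1 -integral_ge0N; last by move=> t _; rewrite lee_fin gam_ge0.
  by apply: eq_integral => t _; rewrite -EFinN /gam addrK mulrN.
have e0 : (\int[lam]_(t in `[u, v]) (x * t `^ (x - 1) * expR (- t))%:E = x%:E * I0)%E.
  rewrite /I0 -ge0_integralZl//.
  - by apply: eq_integral => t _; rewrite -EFinM /gam mulrA.
  - exact: mEgam.
  - by move=> t _; rewrite lee_fin gam_ge0.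
  - by rewrite lee_fin ltW.
have x10 : 0 < x + 1 by rewrite addr_gt0.
have alg (i1 i0 : \bar R) (A : R) : i1 \is a fin_num -> i0 \is a fin_num ->
    (- i1 = A%:E - x%:E * i0)%E -> fine i1 + A = x * fine i0.
  by case: i1 => [r1||]//; case: i0 => [r0||]// _ _ [E]; rewrite /=; lra.
rewrite e1 e0 in P; have := alg _ _ _ (fin _ x10) (fin _ x0) P; lra.
Qed.

Let cvg_gam x : 0 < x ->
  Ieps x n @[n --> \oo] --> (Gamma x)%:E.
Proof.
move=> x0; rewrite GammaE// /eGamma; pose F n : set R := `[(n.+2%:R^-1 : R), (n.+2%:R : R)]%classic.
have UF : \bigcup_n F n = D.
  apply/seteqP; split=> t /=.
    move=> [n _]; rewrite /F /= !in_itv /= andbT => /andP[nx _].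
    by apply: lt_le_trans nx; rewrite invr_gt0.
  rewrite in_itv /= andbT => t0.
  exists (Num.truncn t^-1 + Num.truncn t)%N => //; rewrite /F /= in_itv /=; apply/andP; split.
    rewrite -[leRHS]invrK lef_pV2 ?posrE ?invr_gt0//.
    apply/ltW; apply: lt_le_trans (truncnS_gt _) _.
    by rewrite ler_nat ltnS leqW// leq_addr.
  apply/ltW; apply: lt_le_trans (truncnS_gt _) _.
  by rewrite ler_nat ltnS leqW// leq_addl.
rewrite -UF; apply: ge0_nondecreasing_set_cvg_integral => //.
- move=> m n mn; apply/subsetPset => t; rewrite /F /= !in_itv /= => /andP[mx xm].
  apply/andP; split; last by apply: le_trans xm _; rewrite ler_nat.
  by rewrite (le_trans _ mx)// lef_pV2 ?posrE// ler_nat.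
- by move=> n; exact: mEgam.
- by move=> n t _; rewrite lee_fin gam_ge0.
Qed.

Lemma GammaS x : 0 < x -> Gamma (x + 1) = x * Gamma x.
Proof.
move=> x0; have x10 : 0 < x + 1 by rewrite addr_gt0.
have inv0 : (fun n => n.+2%:R^-1) @ \oo --> (0 : R).
  have := @cvg_harmonic R; rewrite -cvg_shiftS; exact.
have Z (u : nat -> R) (K : R) : (forall n, 0 <= u n) ->
    (forall n, u n <= K * expR (- n.+2%:R / 2)) -> u @ \oo --> (0 : R).
  move=> u0 uK; apply: (@squeeze_cvgr _ _ _ _ (cst 0) (fun n => `|K| * 2 * n.+2%:R^-1)).
  - apply: nearW => n; rewrite u0 /=; apply: le_trans (uK n) _.
    apply: (@le_trans _ _ (`|K| * expR (- n.+2%:R / 2))).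
      by rewrite ler_wpM2r ?expR_ge0// ler_norm.
    rewrite -mulrA ler_wpM2l// mulNr expRN -[X in _ <= X]invrK invfM invrK.
    rewrite lef_pV2 ?posrE ?expR_gt0 ?mulr_gt0 ?invr_gt0//.
    by apply: le_trans (expR_ge1Dx _); rewrite mulrC lerDr.
  - exact: cvg_cst.
  - by rewrite -[X in _ --> X](mulr0 (`|K| * 2)); apply: cvgM => //; exact: cvg_cst.
have T1 : (fun n => n.+2%:R `^ x * expR (- n.+2%:R)) @ \oo --> (0 : R).
  have [K K0 HK] := powR_le_expR x0; apply: (Z _ K) => n.
    by rewrite mulr_ge0 ?powR_ge0 ?expR_ge0.
  have -> : expR (- n.+2%:R / 2) = expR (n.+2%:R / 2) * expR (- n.+2%:R) :> R.
    by rewrite -expRD; congr expR; field.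
  by rewrite mulrA ler_wpM2r ?expR_ge0// HK.
have T2 : (fun n => n.+2%:R^-1 `^ x * expR (- n.+2%:R^-1)) @ \oo --> (0 : R).
  apply/cvgrPdist_le => eps eps0; pose Y := eps `^ (- x^-1).
  have Y0 : 0 < Y by rewrite powR_gt0.
  exists (Num.truncn Y) => // n /= Yn; have n0 : 0 < n.+2%:R :> R by [].
  rewrite sub0r normrN ger0_norm ?mulr_ge0 ?powR_ge0 ?expR_ge0//.
  apply: (@le_trans _ _ (n.+2%:R^-1 `^ x)).
    by rewrite ler_piMr ?powR_ge0// -expR0 ler_expR lerNl oppr0 invr_ge0.
  have -> : n.+2%:R^-1 `^ x = n.+2%:R `^ (- x) :> R by rewrite -powR_inv1// -powRrM mulN1r.
  have -> : eps = Y `^ (- x) by rewrite /Y -powRrM mulrNN mulVf ?powRr1 ?ltW// gt_eqF.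
  apply: ler_powRN => //; apply/ltW/(lt_le_trans (truncnS_gt _)).
  by rewrite ler_nat ltnS (leq_trans Yn).
have [_ C1] := (fine_cvgP _ _).1 (cvg_gam x10).
have [_ C0] := (fine_cvgP _ _).1 (cvg_gam x0).
have C : (fun n => x * fine (Ieps x n) + n.+2%:R^-1 `^ x * expR (- n.+2%:R^-1)
    - n.+2%:R `^ x * expR (- n.+2%:R)) @ \oo --> x * Gamma x + 0 - 0.
  by apply: cvgB T1; apply: cvgD T2; apply: cvgM C0; exact: cvg_cst.
rewrite addr0 subr0 in C.
apply: (@cvg_unique _ _ _ _ _ _ C1) => //.
apply: cvg_trans C; apply: near_eq_cvg; apply: nearW => n /=.
by rewrite -parts// addrK.
Qed.

(** The weighted arithmetic-geometric mean inequality (t / x)^s <= 1 - s + s t / x, integrated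
    against t^(x - 1) exp(-t); [GammaS] collapses the right side. *)
Lemma Gamma_addr_le x s : 0 < x -> 0 <= s -> s <= 1 ->
  Gamma (x + s) <= x `^ s * Gamma x.
Proof.
move=> x0 s0 s1; have xs0 : 0 < x + s by rewrite ltr_pwDl.
have x10 : 0 < x + 1 by rewrite addr_gt0.
rewrite -lee_fin GammaE//.
have a0 : 0 <= x `^ s * (1 - s) by rewrite mulr_ge0 ?powR_ge0// subr_ge0.
have b0 : 0 <= x `^ s * (s / x) by rewrite mulr_ge0 ?powR_ge0// divr_ge0// ltW.
apply: (@le_trans _ _ (\int[lam]_(t in D) ((x `^ s * (1 - s))%:E * (gam x t)%:E +
    (x `^ s * (s / x))%:E * (gam (x + 1) t)%:E))%E).
  apply: ge0_le_integral => //.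
  - by move=> t _; rewrite lee_fin gam_ge0.
  - exact: mEgam.
  - apply: emeasurable_funD; apply: emeasurable_funM;
      by [exact: measurable_cst|exact: mEgam].
  move=> t /=; rewrite in_itv /= andbT => t0.
  rewrite -!EFinM -EFinD lee_fin /gam.
  have tp (p : R) : t `^ (x + p - 1) = t `^ (x - 1) * t `^ p.
    rewrite -powRD; last by rewrite (gt_eqF t0) implybT.
    by congr (_ `^ _); ring.
  rewrite !tp powRr1 ?(ltW t0)//.
  have Y : t `^ s <= x `^ s * (1 - s + s * (t / x)).
    have tE : t = x * (t / x) by rewrite mulrC divfK// gt_eqF.
    rewrite {1}tE powRM ?(ltW x0) ?(divr_ge0 (ltW t0) (ltW x0))//.
    apply: ler_wpM2l; first exact: powR_ge0.
    have y0 : 0 < t / x by rewrite divr_gt0.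
    move: (t / x) y0 => y y0.
    have [->|sn0] := eqVneq s 0; first by rewrite powRr0 subr0 mul0r addr0.
    have [->|sn1] := eqVneq s 1; first by rewrite powRr1 ?(ltW y0)// subrr add0r mul1r lexx.
    have sp : 0 < s by rewrite lt_neqAle eq_sym sn0.
    have sm : 0 < 1 - s by rewrite subr_gt0 lt_neqAle sn1.
    have := @conjugate_powR R 1 (y `^ s) (1 - s)^-1 s^-1 ler01 (powR_ge0 _ _).
    rewrite !invr_gt0 => /(_ sm sp); rewrite !invrK subrK => /(_ erefl).
    by rewrite mul1r powR1 mul1r -powRrM mulfV// powRr1 ?(ltW y0)// [y * s]mulrC.
  have G0 : 0 <= t `^ (x - 1) * expR (- t) by rewrite mulr_ge0 ?powR_ge0 ?expR_ge0.
  have := ler_wpM2l G0 Y; lra.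
rewrite ge0_integralD//; last 4 first.
- by move=> t _; rewrite -EFinM lee_fin mulr_ge0// gam_ge0.
- by apply: emeasurable_funM; [exact: measurable_cst|exact: mEgam].
- by move=> t _; rewrite -EFinM lee_fin mulr_ge0// gam_ge0.
- by apply: emeasurable_funM; [exact: measurable_cst|exact: mEgam].
have gz y (c : R) : 0 <= c ->
    (\int[lam]_(t in D) (c%:E * (gam y t)%:E) = c%:E * eGamma y)%E.
  move=> c0; apply: ge0_integralZl => //; first exact: mEgam.
  by move=> t _; rewrite lee_fin gam_ge0.
rewrite !gz// -!GammaE// GammaS// -!EFinM -EFinD lee_fin.
rewrite le_eqVlt; apply/orP; left; apply/eqP; field; exact: lt0r_neq0.
Qed.

Lemma Gamma1 : Gamma 1 = 1 :> R.
Proof.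
have mexp (A : set R) : measurable_fun A (fun t : R => (expR (- t))%:E).
  apply: measurable_funTS; apply/measurable_EFinP.
  by apply: (measurableT_comp (@measurable_expR R)); exact: measurable_funN.
apply: EFin_inj; rewrite GammaE// /eGamma -(integral_exponential_pdf (@ltr01 R)).
transitivity (\int[lam]_(t in D) (expR (- t))%:E)%E.
  by apply: eq_integral => t _; rewrite /gam subrr powRr0 mul1r.
rewrite integral_itv_obnd_cbnd// [LHS]integral_mkcond; apply: eq_integral => t _.
rewrite patchE /exponential_pdf patchE; case: ifPn => // _.
by rewrite mul1r mulN1r.
Qed.

(** The algebra of the next lemma: g, gp, gm stand for Gamma at A, A + s, A - s, and g1, g2 for
    Gamma at A - 1 and A + s - 1. *)
Let ratio_alg (A s g gp gm g1 g2 : R) : 1 < A -> 0 <= s -> s < 1 ->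
  0 < g -> 0 < gp -> 0 < gm -> g = (A - 1) * g1 -> gp = (A + s - 1) * g2 ->
  gp <= A `^ s * g -> gm <= (A - 1) `^ (1 - s) * g1 ->
  g <= (A - s) `^ s * gm -> g <= (A + s - 1) `^ (1 - s) * g2 ->
  (A - 1) * (gp * gm) <= A * g ^+ 2 /\ (A - 1) * g ^+ 2 <= A * (gp * gm).
Proof.
move=> A1 s0 s1 g0 gp0 gm0 gE gpE I1 I2 I3 I4.
have A0 : 0 < A by lra.
have Am : 0 < A - 1 by lra.
have As : 0 < A - s by lra.
have Aps1 : 0 < A + s - 1 by lra.
have os0 : 0 <= 1 - s by lra.
have split1 (y : R) : 0 < y -> y `^ (1 - s) * y `^ s = y.
  by move=> y0; rewrite -powRD ?subrK ?powRr1 ?(ltW y0)// (gt_eqF y0) implybT.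
have I2' : gm * (A - 1) `^ s <= g.
  have := ler_wpM2r (powR_ge0 (A - 1) s) I2.
  by rewrite mulrAC (split1 _ Am) -gE.
have I4' : g * (A + s - 1) `^ s <= gp.
  have := ler_wpM2r (powR_ge0 (A + s - 1) s) I4.
  by rewrite mulrAC (split1 _ Aps1) -gpE.
have mono (x y : R) : 0 < x -> 0 < y -> x <= y ->
    x `^ s <= y `^ s /\ x `^ (1 - s) <= y `^ (1 - s).
  by move=> x0 y0 xy; split; apply: ge0_ler_powR; rewrite ?nnegrE ?(ltW x0) ?(ltW y0).
(* For s < 1 the power (A / (A - 1))^s is at most A / (A - 1), so a quotient x / y with x <= A and y
   >= A - 1, raised to s, costs no more. *)
have frac (x y : R) : 0 < x -> 0 < y -> x <= A -> A - 1 <= y ->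
    (A - 1) * x `^ s <= A * y `^ s.
  move=> x0 y0 xA Ay.
  have [m1 _] := mono x A x0 A0 xA; have [m2 _] := mono _ _ Am y0 Ay.
  have AA : A - 1 <= A by lra.
  have [_ m3] := mono _ _ Am A0 AA.
  have sA := split1 _ A0; have sAm := split1 _ Am.
  have pA := powR_ge0 A s; have pAm := powR_ge0 (A - 1) s.
  move: (x `^ s) (y `^ s) (A `^ s) ((A - 1) `^ s) (A `^ (1 - s)) ((A - 1) `^ (1 - s))
    m1 m2 m3 sA sAm pA pAm => X Y a am b bm m1 m2 m3 sA sAm pA pAm.
  apply: (@le_trans _ _ ((A - 1) * a)); first by rewrite ler_pM2l.
  apply: (@le_trans _ _ (A * am)); last by rewrite ler_pM2l.
  have -> : (A - 1) * a = bm * (am * a) by rewrite mulrA sAm.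
  have -> : A * am = b * (am * a) by rewrite -{1}sA; ring.
  by rewrite ler_wpM2r// mulr_ge0.
have F1 := frac A (A - 1) A0 Am (lexx _) (lexx _).
have F2 : (A - 1) * (A - s) `^ s <= A * (A + s - 1) `^ s by apply: frac => //; lra.
have p1 : 0 < (A - 1) `^ s by rewrite powR_gt0.
have p2 : 0 < (A + s - 1) `^ s by rewrite powR_gt0.
have p3 : 0 < A `^ s by rewrite powR_gt0.
have p4 : 0 < (A - s) `^ s by rewrite powR_gt0.
move: (A `^ s) ((A - 1) `^ s) ((A + s - 1) `^ s) ((A - s) `^ s) F1 F2 p1 p2 p3 p4 I1 I2' I3 I4'
  => a am aps as' F1 F2 p1 p2 p3 p4 I1' I2'' I3' I4''.
split.
- rewrite -(ler_pM2r p1); apply: (@le_trans _ _ ((A - 1) * (a * g * g))).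
    have -> : (A - 1) * (gp * gm) * am = (A - 1) * (gp * (gm * am)) by ring.
    rewrite ler_pM2l//; apply: ler_pM => //; first exact: ltW.
    by rewrite mulr_ge0// ltW.
  have -> : (A - 1) * (a * g * g) = (A - 1) * a * g ^+ 2 by ring.
  have -> : A * g ^+ 2 * am = A * am * g ^+ 2 by ring.
  by rewrite ler_wpM2r// sqr_ge0.
- rewrite -(ler_pM2r p2); apply: (@le_trans _ _ ((A - 1) * (as' * gm * gp))).
    have -> : (A - 1) * g ^+ 2 * aps = (A - 1) * (g * (g * aps)) by ring.
    rewrite ler_pM2l//; apply: ler_pM => //; first exact: ltW.
    by rewrite mulr_ge0// ltW.
  have -> : (A - 1) * (as' * gm * gp) = (A - 1) * as' * (gp * gm) by ring.
  have -> : A * (gp * gm) * aps = A * aps * (gp * gm) by ring.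
  by rewrite ler_wpM2r// mulr_ge0// ltW.
Qed.

(* Log-convexity in the weak form of Gamma_addr_le, used with the increments s
   and 1 - s on both sides of A. *)
Lemma Gamma_ratio_bounds (A s : R) : 1 < A -> 0 <= s -> s < 1 ->
  (A - 1) * (Gamma (A + s) * Gamma (A - s)) <= A * Gamma A ^+ 2 /\
  (A - 1) * Gamma A ^+ 2 <= A * (Gamma (A + s) * Gamma (A - s)).
Proof.
move=> A1 s0 s1; have A0 : 0 < A by exact: lt_trans A1.
have Am : 0 < A - 1 by rewrite subr_gt0.
have As : 0 < A - s by rewrite subr_gt0 (lt_trans s1).
have Aps : 0 < A + s by rewrite ltr_pwDl.
have Aps1 : 0 < A + s - 1 by rewrite addrAC ltr_pwDl.
have os0 : 0 <= 1 - s by rewrite subr_ge0 ltW.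
have os1 : 1 - s <= 1 by rewrite lerBlDr lerDl.
have E1 : A - 1 + 1 = A by rewrite subrK.
have E2 : A + s - 1 + 1 = A + s by rewrite subrK.
have E3 : A - 1 + (1 - s) = A - s by ring.
have E4 : A + s - 1 + (1 - s) = A by ring.
have E5 : A - s + s = A by rewrite subrK.
apply: (@ratio_alg A s _ _ _ (Gamma (A - 1)) (Gamma (A + s - 1)) A1 s0 s1
  (Gamma_gt0 A0) (Gamma_gt0 Aps) (Gamma_gt0 As)).
- by have := GammaS Am; rewrite E1.
- by have := GammaS Aps1; rewrite E2.
- exact: Gamma_addr_le A0 s0 (ltW s1).
- by have := Gamma_addr_le Am os0 os1; rewrite E3.
- by have := Gamma_addr_le As s0 (ltW s1); rewrite E5.
- by have := Gamma_addr_le Aps1 os0 os1; rewrite E4.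
Qed.

End gamma_function.

(** * Gauss's summation theorem *)

Lemma eq0_of_le_div (R : realType) (x M : R) :
  (forall K : nat, (0 < K)%N -> `|x| * K%:R <= M) -> x = 0.
Proof.
move=> H; apply/eqP; rewrite -normr_eq0 eq_le normr_ge0 andbT leNgt.
apply/negP => x0; have := H (Num.truncn (M / `|x|)).+1 (ltn0Sn _).
by rewrite leNgt -ltr_pdivrMl// mulrC truncnS_gt.
Qed.

Section gauss_sum.
Variable R : realType.
Variables (a S : R).
Hypotheses (a1 : -1 < a) (a2 : a < 1 / 2).

(** (a)_n^2 / ((c)_n n!), the terms of 2F1(a, a; c; 1). *)
Fixpoint gterm (c : R) n : R :=
  if n is k.+1 then gterm c k * ((a + k%:R) ^+ 2 / ((c + k%:R) * k.+1%:R)) else 1.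

Definition gsum c N : R := \sum_(n < N) gterm c n.

Hypothesis gsum1_le : forall N, gsum 1 N <= S.
Hypothesis gsum1_cvg : gsum 1 @ \oo --> S.

Let gterm_ge0 c n : 0 < c -> 0 <= gterm c n.
Proof.
move=> c0; elim: n => //= n IH; rewrite mulr_ge0// divr_ge0 ?sqr_ge0//.
by rewrite mulr_ge0// addr_ge0// ltW.
Qed.

(** The first factor gains 1 / c over its value at c = 1 and the others do not grow. Hence c (F(c) -
    1) <= S - 1: convergence at c = 1 carries over to all c >= 1, and F(c) tends to 1. *)
Let gterm_le c n : 1 <= c -> gterm c n.+1 * c <= gterm 1 n.+1.
Proof.
move=> c1; have c0 : 0 < c by lra.
elim: n => [|n IH].
  by rewrite /= !addr0 !mul1r mulr1 divr1 divfK// gt_eqF.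
rewrite [gterm c n.+2]/= [gterm 1 n.+2]/= -/(gterm c n.+1) -/(gterm 1 n.+1).
rewrite mulrAC; apply: ler_pM => //.
- by rewrite mulr_ge0 ?gterm_ge0// ltW.
- rewrite divr_ge0 ?sqr_ge0// mulr_ge0// addr_ge0// ltW//.
- apply: ler_wpM2l; first exact: sqr_ge0.
  rewrite lef_pV2 ?posrE ?mulr_gt0 ?addr_gt0//.
  by apply: ler_wpM2r => //; rewrite lerD2r.
Qed.

Let gsum_ge1 c N : 0 < c -> 1 <= gsum c N.+1.
Proof.
move=> c0; rewrite /gsum big_ord_recl lerDl sumr_ge0// => i _; exact: gterm_ge0.
Qed.

Let S1 : 1 <= S.
Proof. exact: le_trans (gsum_ge1 0 ltr01) (gsum1_le 1). Qed.

Let gsum_le c N : 1 <= c -> c * gsum c N <= c + S - 1.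
Proof.
move=> c1; case: N => [|N]; first by rewrite /gsum big_ord0 mulr0; have := S1; lra.
have : c * gsum c N.+1 <= c + (gsum 1 N.+1 - 1).
  rewrite /gsum !big_ord_recl /= mulrDr mulr1 lerD2l addrAC subrr add0r mulr_sumr.
  by apply: ler_sum => i _; rewrite mulrC; exact: (gterm_le i c1).
by have := gsum1_le N.+1; lra.
Qed.

Let gtermS c n : 0 < c -> gterm (c + 1) n * (c + n%:R) = gterm c n * c.
Proof.
move=> c0; elim: n => [|n IH]; first by rewrite /= addr0.
have cn : c + n%:R != 0 by rewrite gt_eqF// ltr_pwDl.
have cn1 : c + 1 + n%:R != 0 by rewrite gt_eqF// ltr_pwDl// addr_gt0.
have n1 : n.+1%:R != 0 :> R by rewrite pnatr_eq0.
rewrite /=; apply: (mulIf cn).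
have -> : gterm (c + 1) n * ((a + n%:R) ^+ 2 / ((c + 1 + n%:R) * n.+1%:R)) *
    (c + n.+1%:R) * (c + n%:R) =
    gterm (c + 1) n * (c + n%:R) * ((a + n%:R) ^+ 2 / n.+1%:R).
  by rewrite -[n.+1%:R]natr1; field; rewrite natr1 n1 cn1.
rewrite IH.
by rewrite -[n.+1%:R]natr1; field; rewrite natr1 n1 cn.
Qed.

(* Partial-sum form of the contiguous relation
   c (c - 2a) F(c) = (c - a)^2 F(c + 1) for F(c) = 2F1(a, a; c; 1). *)
Let gsum_rec c N : 0 < c ->
  c * (c - 2 * a) * gsum c N = (c - a) ^+ 2 * gsum (c + 1) N - c * (N%:R * gterm c N).
Proof.
move=> c0; elim: N => [|N IH]; first by rewrite /gsum !big_ord0; ring.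
have cn : c + N%:R != 0 by rewrite gt_eqF// ltr_pwDl.
have n1 : N.+1%:R != 0 :> R by rewrite pnatr_eq0.
have gS c' : gsum c' N.+1 = gsum c' N + gterm c' N by rewrite /gsum big_ord_recr.
rewrite !gS mulrDr IH (mulrDr ((c - a) ^+ 2)) [gterm c N.+1]/=.
have -> : gterm (c + 1) N = gterm c N * c / (c + N%:R) by rewrite -gtermS// mulfK.
by rewrite -[N.+1%:R]natr1; field; rewrite natr1 n1 cn.
Qed.

Definition ghyp c : R := limn (gsum c).

Let gsum_cvg c : 1 <= c -> gsum c @ \oo --> ghyp c.
Proof.
move=> c1; have c0 : 0 < c by lra.
apply: nondecreasing_is_cvgn.
  apply/nondecreasing_seqP => n; rewrite /gsum big_ord_recr /= lerDl.
  exact: gterm_ge0.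
exists ((c + S - 1) / c) => _ [n _ <-]; rewrite ler_pdivlMr// mulrC.
exact: gsum_le.
Qed.

Let ghyp_bounds c : 1 <= c -> 1 <= ghyp c /\ c * ghyp c <= c + S - 1.
Proof.
move=> c1; have c0 : 0 < c by lra.
split.
  rewrite /ghyp; apply: limr_ge; first by apply: cvgP (gsum_cvg c1).
  by exists 1%N => // -[//|n] _; exact: gsum_ge1.
rewrite mulrC -ler_pdivlMr//; apply: limr_le; first by apply: cvgP (gsum_cvg c1).
by apply: nearW => n; rewrite ler_pdivlMr// mulrC gsum_le.
Qed.

(* A positive limit of N * gterm c N would make the convergent series dominate
   the harmonic one. *)
Let ngterm_cvg0 c : 1 <= c -> (fun N => N%:R * gterm c N) @ \oo --> (0 : R).
Proof.
move=> c1; have c0 : 0 < c by lra.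
have cn0 : c != 0 by rewrite gt_eqF.
have c11 : 1 <= c + 1 by lra.
pose L := ((c - a) ^+ 2 * ghyp (c + 1) - c * (c - 2 * a) * ghyp c) / c.
have cL : (fun N => N%:R * gterm c N) @ \oo --> L.
  have E : (fun N => N%:R * gterm c N) =
      (fun N => ((c - a) ^+ 2 * gsum (c + 1) N - c * (c - 2 * a) * gsum c N) * c^-1).
    by apply/funext => N; rewrite gsum_rec//; field.
  rewrite E; apply: cvgM; last exact: cvg_cst.
  apply: cvgB; apply: cvgM; try exact: cvg_cst; exact: gsum_cvg.
suff L0 : L = 0 by rewrite -L0.
have Lge : 0 <= L.
  rewrite -(cvg_lim _ cL)//; apply: limr_ge; first exact: cvgP cL.
  by apply: nearW => N; rewrite mulr_ge0// gterm_ge0.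
apply/eqP; rewrite eq_le Lge andbT leNgt; apply/negP => Lp.
apply: (@dvg_harmonic R).
have L2 : 0 < L / 2 by rewrite divr_gt0.
have : \forall N \near \oo, L / 2 <= N%:R * gterm c N.
  move/cvgrPdist_le : cL => /(_ _ L2); apply: filterS => N /=.
  by rewrite ler_norml => /andP[_]; lra.
move=> [N0 _ H].
apply: nondecreasing_is_cvgn.
  apply/nondecreasing_seqP => n; rewrite /series /= big_nat_recr//= lerDl.
  by rewrite /harmonic invr_ge0.
exists (series harmonic N0 + (L / 2)^-1 * ((c + S - 1) / c)) => _ [n _ <-].
apply: (@le_trans _ _ (series harmonic N0 + (L / 2)^-1 * gsum c n)); last first.
  rewrite lerD2l; apply: ler_wpM2l; first by rewrite invr_ge0 ltW.
  by rewrite ler_pdivlMr// mulrC gsum_le.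
elim: n => [|n IH].
  by rewrite /gsum big_ord0 mulr0 addr0 /series /= big_geq// sumr_ge0// => i _; rewrite invr_ge0.
have gn0 := @gterm_ge0 c n c0.
rewrite {1}/series /= big_nat_recr//= -/(series harmonic n).
rewrite /gsum big_ord_recr /= -/(gsum c n).
have [nN|Nn] := ltnP n N0.
  apply: (@le_trans _ _ (series harmonic N0)).
    rewrite -(big_nat_recr n 0 harmonic)//= /series /=.
    rewrite (@big_cat_nat _ _ _ n.+1 0 N0)//= lerDl.
    by apply: sumr_ge0 => i _; rewrite invr_ge0.
  rewrite lerDl mulr_ge0 ?invr_ge0 ?(ltW L2)// addr_ge0//.
  by apply: sumr_ge0 => i _; exact: gterm_ge0.
rewrite mulrDr addrA lerD// /harmonic ler_pdivlMl// ler_pdivrMr//.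
apply: le_trans (H n Nn) _; rewrite mulrC; apply: ler_wpM2l => //.
by rewrite ler_nat.
Qed.

Let ghyp_rec c : 1 <= c -> c * (c - 2 * a) * ghyp c = (c - a) ^+ 2 * ghyp (c + 1).
Proof.
move=> c1; have c0 : 0 < c by lra.
have c11 : 1 <= c + 1 by lra.
have C1 : (fun N => c * (c - 2 * a) * gsum c N) @ \oo --> c * (c - 2 * a) * ghyp c.
  by apply: cvgM; [exact: cvg_cst|exact: gsum_cvg].
have C2 : (fun N => (c - a) ^+ 2 * gsum (c + 1) N - c * (N%:R * gterm c N)) @ \oo -->
    (c - a) ^+ 2 * ghyp (c + 1) - c * 0.
  apply: cvgB; apply: cvgM; try exact: cvg_cst; first exact: gsum_cvg.
  exact: ngterm_cvg0.
rewrite mulr0 subr0 in C2; apply: (@cvg_unique _ _ _ _ _ _ C1) => //.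
apply: cvg_trans C2; apply: near_eq_cvg; apply: nearW => N /=.
by rewrite gsum_rec.
Qed.

(** Gauss's formula says that this is 1. It is invariant under c -> c + 1, since Gamma(x + 1) = x
    Gamma(x) reproduces the factors of the contiguous relation. *)
Definition gconst (c : R) : R :=
  ghyp c * (Gamma (c - a) ^+ 2 / (Gamma (c - 2 * a) * Gamma c)).

Let gconst_rec c : 1 <= c -> gconst (c + 1) = gconst c.
Proof.
move=> c1; have ha1 := a1; have ha2 := a2; have c0 : 0 < c by lra.
have ca : 0 < c - a by lra.
have c2a : 0 < c - 2 * a by lra.
rewrite /gconst; have := ghyp_rec c1.
have -> : c + 1 - a = c - a + 1 by ring.
have -> : c + 1 - 2 * a = c - 2 * a + 1 by ring.
rewrite !GammaS//; have := Gamma_gt0 c0; have := Gamma_gt0 ca; have := Gamma_gt0 c2a.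
move: (Gamma c) (Gamma (c - a)) (Gamma (c - 2 * a)) (ghyp c) (ghyp (c + 1)).
move: ca c2a; move: (c - a) (c - 2 * a) => x y x0 y0 g gx gy h h1 gy0 gx0 g0 E.
have -> : h1 = c * y * h / x ^+ 2.
  by rewrite E mulrC mulKf// expf_neq0// gt_eqF.
by field; rewrite !gt_eqF.
Qed.

Let gconst_eq K : gconst (1 + K%:R) = gconst 1.
Proof.
elim: K => [|K <-]; first by rewrite addr0.
by rewrite -natr1 addrA gconst_rec// lerDl.
Qed.

(** By invariance the value may be computed at 1 + K, where it differs from 1 by O(1 / K): the
    series through [ghyp_bounds], the Gamma quotient through [Gamma_ratio_bounds]. *)
Let gconst1 : gconst 1 = 1.
Proof.
have ha1 := a1; have ha2 := a2.
apply/eqP; rewrite -subr_eq0; apply/eqP.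
apply: (@eq0_of_le_div _ _ (10 * (S + 1))) => K K0.
rewrite -(gconst_eq K); set c : R := 1 + K%:R; set A := c - a.
have k1 : 1 <= K%:R :> R by rewrite ler1n.
have c1 : 1 <= c by rewrite lerDl.
have [h1 h2] := ghyp_bounds c1.
have A1 : 1 < A by rewrite /A /c; lra.
have G : exists r, [/\ 0 < r, (A - 1) <= A * r, (A - 1) * r <= A &
   r = Gamma (c - a) ^+ 2 / (Gamma (c - 2 * a) * Gamma c)].
  have c0 : 0 < c by lra.
  have ca : 0 < c - a by lra.
  have c2a : 0 < c - 2 * a by lra.
  (* c and c - 2 a lie symmetrically around A = c - a, so both signs of a are covered by s = |a|. *)
  have sgn : (0 <= a /\ a < 1) \/ (0 <= - a /\ - a < 1).
    by have [a0|a0] := leP 0 a; [left|right]; split; lra.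
  exists (Gamma (c - a) ^+ 2 / (Gamma (c - 2 * a) * Gamma c)).
  have pc := Gamma_gt0 c0; have pca := Gamma_gt0 ca; have pc2 := Gamma_gt0 c2a.
  have B : (A - 1) * (Gamma (c - 2 * a) * Gamma c) <= A * Gamma (c - a) ^+ 2 /\
     (A - 1) * Gamma (c - a) ^+ 2 <= A * (Gamma (c - 2 * a) * Gamma c).
    case: sgn => [] [a0 a1'].
      have := Gamma_ratio_bounds A1 a0 a1'.
      have -> : A + a = c by rewrite /A; ring.
      have -> : A - a = c - 2 * a by rewrite /A; ring.
      by rewrite (mulrC (Gamma c)).
    have := Gamma_ratio_bounds A1 a0 a1'.
    have -> : A - - a = c by rewrite /A; ring.
    by have -> : A + - a = c - 2 * a by rewrite /A; ring.
  move: B pc pca pc2; move: (Gamma (c - a)) (Gamma (c - 2 * a)) (Gamma c).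
  move=> x y z [B1 B2] z0 x0 y0; have yz : 0 < y * z by rewrite mulr_gt0.
  split => //; first by rewrite divr_gt0// exprn_gt0.
    by rewrite mulrA ler_pdivlMr.
  by rewrite mulrA ler_pdivrMr.
case: G => r [r0 r1 r2]; rewrite /gconst => <-.
move: h1 h2; move: (ghyp c) => h h1 h2.
have AK : K%:R / 2 <= A - 1 by rewrite /A /c; lra.
have AK2 : A - 1 <= 2 * K%:R by rewrite /A /c; lra.
have S1' := S1.
have r3 : r <= 3.
  have : (A - 1) * r <= (A - 1) * 3 by apply: le_trans r2 _; lra.
  by rewrite ler_pM2l//; lra.
have K1 : (r - 1) * (A - 1) <= 1 by lra.
have K2 : (1 - r) * A <= 1 by lra.
have hK : (h - 1) * K%:R <= S - 1.
  have : (h - 1) * c <= S - 1 by lra.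
  apply: le_trans; apply: ler_wpM2l; first by rewrite subr_ge0.
  by rewrite /c; lra.
have -> : h * r - 1 = (h - 1) * r + (r - 1) by ring.
have T1 : `|(h - 1) * r| * K%:R <= 3 * (S - 1).
  rewrite ger0_norm ?mulr_ge0 ?subr_ge0// ?(ltW r0)// mulrAC mulrC.
  apply: ler_pM => //; first exact: ltW.
  by rewrite mulr_ge0// subr_ge0.
have T2 : `|r - 1| * K%:R <= 2.
  have [r1'|r1'] := leP 1 r.
    rewrite ger0_norm ?subr_ge0//.
    apply: (@le_trans _ _ ((r - 1) * (2 * (A - 1)))); last by lra.
    by apply: ler_wpM2l; [rewrite subr_ge0|lra].
  rewrite ltr0_norm ?subr_lt0// opprB.
  apply: (@le_trans _ _ ((1 - r) * A)); last by lra.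
  by apply: ler_wpM2l; [rewrite subr_ge0 ltW|rewrite /A /c; lra].
have := ler_wpM2r (ler0n R K) (ler_normD ((h - 1) * r) (r - 1)).
by rewrite [X in _ <= X]mulrDl; lra.
Qed.

Lemma gauss_sum : S = Gamma (1 - 2 * a) / Gamma (1 - a) ^+ 2.
Proof.
have ha1 := a1; have ha2 := a2; have x0 : 0 < 1 - a by lra.
have y0 : 0 < 1 - 2 * a by lra.
have hS : ghyp 1 = S by apply/cvg_lim.
have := gconst1; rewrite /gconst hS Gamma1 mulr1.
have := Gamma_gt0 x0; have := Gamma_gt0 y0.
move: (Gamma (1 - a)) (Gamma (1 - 2 * a)) => x y yp xp E.
have E' : S * x ^+ 2 = y.
  by rewrite -[RHS]mul1r -E mulrA divfK// gt_eqF.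
by rewrite -E' mulfK// expf_neq0// gt_eqF.
Qed.

End gauss_sum.

(** * The closed form for alpha <> 1 *)

Section disc_energy_value.
Variable R : realType.
Variable alpha : R.
Hypotheses (al0 : 0 < alpha) (al1 : alpha < 3 / 2).
Local Notation b := (bcoef alpha).
Local Notation a := (alpha - 1).

(** With alpha = a + 1 one has (a)_(n+1) = a (alpha)_n: the energy series is the Gauss series
    without its initial 1, divided by a^2, whence the separate treatment of alpha = 1. *)
Let gterm_bcoef n : gterm a 1 n.+1 = a ^+ 2 * (b n / n.+1%:R) ^+ 2.
Proof.
elim: n => [|n IH]; first by rewrite /= !addr0; field.
rewrite [gterm _ _ _]/= -/(gterm a 1 n.+1) IH /=.
have n1 : n.+1%:R != 0 :> R by rewrite pnatr_eq0.
have n2 : n.+2%:R != 0 :> R by rewrite pnatr_eq0.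
have -> : 1 + n.+1%:R = n.+2%:R :> R by rewrite addrC natr1.
have -> : a + n.+1%:R = alpha + n%:R by rewrite -natr1; ring.
by move: (n.+1%:R : R) (n.+2%:R : R) n1 n2 => p q p0 q0; field; rewrite p0 q0.
Qed.

Let e := fine (kernel_energy 0 alpha).

Let eE : kernel_energy 0 alpha = e%:E.
Proof.
rewrite /e fineK// ge0_fin_numE; last first.
  by rewrite kernel_energy_series//; apply: nneseries_ge0 => n _ _; rewrite lee_fin sqr_ge0.
by apply: kernel_energy_lty; move: al1; lra.
Qed.

Lemma kernel_energy_cvg :
  (fun N => \sum_(n < N) (b n / n.+1%:R) ^+ 2) @ \oo --> fine (kernel_energy 0 alpha).
Proof.
have sE N : (\sum_(0 <= n < N) ((b n / n.+1%:R) ^+ 2)%:E)%E =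
    (\sum_(n < N) (b n / n.+1%:R) ^+ 2)%:E by rewrite big_mkord sumEFin.
have : (fun N => (\sum_(0 <= n < N) ((b n / n.+1%:R) ^+ 2)%:E)%E) @ \oo --> e%:E.
  rewrite -eE kernel_energy_series//.
  by apply: is_cvg_nneseries => n _ _; rewrite lee_fin sqr_ge0.
move=> /fine_cvgP[_]; apply: cvg_trans; apply: near_eq_cvg; apply: nearW => N /=.
by rewrite sE.
Qed.

Lemma kernel_energy_gauss : alpha != 1 -> kernel_energy 0 alpha =
  (1 / (alpha - 1) ^+ 2 * (Gamma (3 - 2 * alpha) / Gamma (2 - alpha) ^+ 2 - 1))%:E.
Proof.
move=> alN; have aN : a != 0 by rewrite subr_eq0.
have a1 : -1 < a by move: al0; lra.
have a2 : a < 1 / 2 by move: al1; lra.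
rewrite eE; congr EFin.
have gE N : gsum a 1 N.+1 = 1 + a ^+ 2 * \sum_(n < N) (b n / n.+1%:R) ^+ 2.
  rewrite /gsum big_ord_recl /= mulr_sumr; congr (_ + _); apply: eq_bigr => n _.
  exact: gterm_bcoef.
have C : gsum a 1 @ \oo --> 1 + a ^+ 2 * e.
  rewrite -cvg_shiftS /= (_ : (fun n => gsum a 1 n.+1) =
     (fun N => 1 + a ^+ 2 * \sum_(n < N) (b n / n.+1%:R) ^+ 2)); last exact/funext.
  apply: cvgD; first exact: cvg_cst.
  by apply: cvgM; [exact: cvg_cst|exact: kernel_energy_cvg].
have U N : gsum a 1 N <= 1 + a ^+ 2 * e.
  rewrite -(cvg_lim _ C)//; apply: nondecreasing_cvgn_le; last exact: cvgP C.
  apply/nondecreasing_seqP => n; rewrite /gsum big_ord_recr /= lerDl.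
  by case: n => [|n]//; rewrite gterm_bcoef mulr_ge0// sqr_ge0.
have := gauss_sum a1 a2 U C.
have -> : 1 - 2 * a = 3 - 2 * alpha by ring.
have -> : 1 - a = 2 - alpha by ring.
by move=> <-; rewrite addrAC subrr add0r mulrA mul1r mulVf ?mul1r// expf_neq0.
Qed.

End disc_energy_value.

(** * The Basel sum *)

Section basel.
Variable R : realType.
Implicit Types x : R.

Let sin_bounds x : 0 < x -> x < pi / 2 ->
  [/\ 0 < sin x, sin x <= x & x * cos x <= sin x].
Proof.
move=> x0 xp; have pp := pi_gt0 R.
have [c + E] : exists2 c, c \in `](0:R), x[%R & sin x - sin 0 = cos c * (x - 0).
  by apply: MVT => //; apply: continuous_subspaceT => t; exact: continuous_sin.
rewrite in_itv /= => /andP[c0 cx]; move: E; rewrite sin0 !subr0 => E; split.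
- by apply: sin_gt0_pi; rewrite x0 /=; lra.
- by rewrite E -[leRHS]mul1r; apply: ler_wpM2r; [exact: ltW|exact: cos_le1].
- rewrite E mulrC; apply: ler_wpM2r; first exact: ltW.
  by rewrite ltW// ltr_cos// in_itv /=; apply/andP; split; lra.
Qed.

(** 1 / sin^2 - 1 is cot^2, so these are the inequalities sin x <= x <= tan x, squared and
    inverted. *)
Let inv_sin2 x : 0 < x -> x < pi / 2 ->
  (sin x)^-2 - 1 <= x^-2 /\ x^-2 <= (sin x)^-2.
Proof.
move=> x0 xp; have [s0 sx xs] := sin_bounds x0 xp.
have c0 : 0 <= cos x.
  by rewrite ltW// cos_gt0_pihalf// xp andbT; have := pi_gt0 R; lra.
split.
  have -> : (sin x)^-2 - 1 = cos x ^+ 2 / sin x ^+ 2.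
    by rewrite cos2sin2; field; rewrite gt_eqF.
  rewrite ler_pdivrMr ?exprn_gt0// mulrC ler_pdivlMr ?exprn_gt0// -exprMn mulrC.
  by rewrite lerXn2r// nnegrE ?mulr_ge0// ltW.
rewrite lef_pV2 ?posrE ?exprn_gt0//.
by rewrite lerXn2r// nnegrE ltW.
Qed.

Let ang n (k : nat) : R := k.*2.+1%:R * pi / 2 ^+ n.+2.

Let angP n k : (k < 2 ^ n)%N -> 0 < ang n k /\ ang n k < pi / 2.
Proof.
move=> kn; have pp := pi_gt0 R; split.
  by rewrite /ang !mulr_gt0// ?invr_gt0 ?exprn_gt0.
rewrite /ang ltr_pdivrMr ?exprn_gt0// mulrC -mulrA ltr_pM2l//.
rewrite exprS mulKf ?pnatr_eq0// -natrX ltr_nat expnS mul2n.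
by move: kn; rewrite -leq_double; lia.
Qed.

(* Iteration of 4 / sin^2 (2y) = 1 / sin^2 y + 1 / sin^2 (pi / 2 - y). *)
Let sin_sum n : \sum_(k < 2 ^ n) (sin (ang n k))^-2 = 2 * 4 ^+ n.
Proof.
elim: n => [|n IH].
  rewrite big_ord1 /ang /= double0 mul1r expr0 mulr1.
  have -> : pi / 2 ^+ 2 = pi / 4 :> R by congr (_ / _); ring.
  have sc : sin (pi / 4) = cos (pi / 4) :> R.
    have -> : pi / 4 = pi / 2 - pi / 4 :> R by field.
    rewrite {1}sinB sin_pihalf cos_pihalf mul1r mul0r subr0.
    by congr cos; field.
  have := cos2Dsin2 (pi / 4 : R); rewrite -sc => E.
  have -> : sin (pi / 4) ^+ 2 = 2^-1 :> R by lra.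
  by rewrite invrK.
rewrite exprS mulrCA -IH mulr_sumr.
have E2 : (2 ^ n.+1 = 2 ^ n + 2 ^ n)%N by rewrite expnS mul2n addnn.
rewrite E2 big_split_ord /= [X in _ + X](reindex_inj rev_ord_inj) /= -big_split /=.
apply: eq_bigr => k _; have kn := ltn_ord k.
have k1 : (k < 2 ^ n.+1)%N by rewrite E2 (ltn_addr _ kn).
set y := ang n.+1 k.
have [y0 yp] := angP k1; rewrite -/y in y0 yp.
have xE : ang n k = y *+ 2.
  rewrite /y /ang (exprS _ n.+2) -mulr_natr; field.
  by rewrite expf_neq0.
have -> : ang n.+1 (2 ^ n + (2 ^ n - k.+1)) = pi / 2 - y.
  have -> : pi / 2 = (2 ^ n.+2)%:R * pi / 2 ^+ n.+3 :> R.
    by rewrite natrX (exprS _ n.+2); field; rewrite expf_neq0.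
  rewrite /y /ang -mulrBl -mulrBl -natrB.
    by congr (_%:R * _ / _); rewrite !expnS; lia.
  by rewrite !expnS; lia.
rewrite sinB sin_pihalf cos_pihalf mul1r mul0r subr0 xE sin_mulr2n.
have s0 : 0 < sin y by apply: sin_gt0_pi; rewrite y0 /=; have := pi_gt0 R; lra.
have c0 : 0 < cos y by apply: cos_gt0_pihalf; rewrite yp andbT; have := pi_gt0 R; lra.
have := cos2Dsin2 y; move: (sin y) (cos y) s0 c0 => s c s0 c0 E.
rewrite -(mulr_natr (c * s)).
have sn : s != 0 by rewrite gt_eqF.
have cn : c != 0 by rewrite gt_eqF.
have -> : 4 * (c * s * 2%:R)^-2 = (c ^+ 2 + s ^+ 2) / (c ^+ 2 * s ^+ 2).
  by rewrite E; field; rewrite sn cn.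
by field; rewrite sn cn.
Qed.

Let odd_sum (M : nat) : R := \sum_(k < M) (k.*2.+1%:R)^-2.

(** Summing [inv_sin2] over the 2^n angles leaves an error of at most 2^n against the exact sum 2 *
    4^n, a relative error of order 2^(-n). *)
Let odd_sum_bounds n :
  8 * odd_sum (2 ^ n) <= pi ^+ 2 /\ pi ^+ 2 <= 8 * odd_sum (2 ^ n) + pi ^+ 2 / 2 ^+ n.
Proof.
have pp := pi_gt0 R; have pn : pi != 0 :> R by rewrite gt_eqF.
have E : \sum_(k < 2 ^ n) (ang n k)^-2 = 16 * 4 ^+ n / pi ^+ 2 * odd_sum (2 ^ n).
  rewrite /odd_sum mulr_sumr; apply: eq_bigr => k _.
  have -> : (4 : R) ^+ n = (2 ^+ n) ^+ 2 by rewrite -exprM mulnC exprM; congr (_ ^+ _); ring.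
  have kn : k.*2.+1%:R != 0 :> R by rewrite pnatr_eq0.
  have qn : (2 : R) ^+ n != 0 by rewrite expf_neq0.
  rewrite /ang !exprS; move: (2 ^+ n : R) (k.*2.+1%:R : R) (pi : R) kn qn pn.
  by move=> q m p m0 q0 p0; field; rewrite m0 q0 p0.
have U : \sum_(k < 2 ^ n) (ang n k)^-2 <= 2 * 4 ^+ n.
  rewrite -sin_sum; apply: ler_sum => k _; have [h1 h2] := angP (ltn_ord k).
  by case: (inv_sin2 h1 h2).
have L : 2 * 4 ^+ n - 2 ^+ n <= \sum_(k < 2 ^ n) (ang n k)^-2.
  have -> : 2 ^+ n = \sum_(k < 2 ^ n) (1 : R) by rewrite sumr_const card_ord natrX.
  rewrite -sin_sum -sumrB; apply: ler_sum => k _; have [h1 h2] := angP (ltn_ord k).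
  by case: (inv_sin2 h1 h2).
move: U L; rewrite E; move: (odd_sum _) => o.
have -> : (4 : R) ^+ n = (2 ^+ n) ^+ 2 by rewrite -exprM mulnC exprM; congr (_ ^+ _); ring.
have q0 : 0 < (2 : R) ^+ n by rewrite exprn_gt0.
move: (2 ^+ n : R) q0 => q q0.
have p2 : 0 < (pi : R) ^+ 2 by rewrite exprn_gt0.
move: ((pi : R) ^+ 2) p2 => p p0 U L.
have q2 : 0 < q ^+ 2 by rewrite exprn_gt0.
have E1 : 16 * q ^+ 2 / p * o = (2 * q ^+ 2 / p) * (8 * o) by ring.
have k0 : 0 < 2 * q ^+ 2 / p by rewrite divr_gt0// mulr_gt0.
split.
  rewrite -(ler_pM2l k0) -E1; apply: le_trans U _.
  by rewrite divfK// gt_eqF.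
rewrite -(ler_pM2l k0) mulrDr -E1 divfK ?gt_eqF//.
have -> : 2 * q ^+ 2 / p * (p / q) = 2 * q by field; rewrite !gt_eqF.
lra.
Qed.

Let basel_sum (N : nat) : R := \sum_(n < N) (n.+1%:R)^-2.

Let basel_sum_double M : basel_sum M.*2 = odd_sum M + basel_sum M / 4.
Proof.
rewrite /basel_sum /odd_sum; elim: M => [|M IH]; first by rewrite !big_ord0 mul0r addr0.
rewrite doubleS !big_ord_recr /= IH mulrDl.
have -> : (M.*2.+2%:R : R) ^- 2 = M.+1%:R ^- 2 / 4.
  have -> : M.*2.+2%:R = 2 * M.+1%:R :> R by rewrite -natrM mul2n doubleS.
  have : (M.+1%:R : R) != 0 by rewrite pnatr_eq0.
  by move: (M.+1%:R : R) => m m0; field.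
by rewrite -!addrA; congr (_ + _); rewrite addrCA.
Qed.

(** The even terms reproduce a quarter of the sum, so the odd ones tend to e - e / 4, which the
    squeeze identifies with pi^2 / 8. Partial sums are taken along powers of 2, where [sin_sum]
    applies. *)
Lemma basel_eq (e : R) : basel_sum @ \oo --> e -> e = pi ^+ 2 / 6.
Proof.
move=> ce; pose p2 n := (2 ^ n)%N.
have c1 : (fun n => basel_sum (2 ^ n)%N) @ \oo --> e.
  apply: cvg_comp ce => A [N _ NA]; exists N => // n /= Nn; apply: NA => /=.
  by apply: leq_trans Nn _; rewrite ltnW// ltn_expl.
have c2 : (fun n => basel_sum (2 ^ n).*2) @ \oo --> e.
  have := c1; rewrite -cvg_shiftS; apply: cvg_trans; apply: near_eq_cvg; apply: nearW => n /=.
  by rewrite expnS mul2n.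
have c3 : (fun n => odd_sum (2 ^ n)) @ \oo --> e - e / 4.
  have E : (fun n => odd_sum (2 ^ n)) =
      (fun n => basel_sum (2 ^ n).*2 - basel_sum (2 ^ n) * 4^-1).
    by apply/funext => n; rewrite basel_sum_double addrK.
  by rewrite E; apply: cvgB c2 _; apply: cvgM c1 _; exact: cvg_cst.
have c4 : (fun n => odd_sum (2 ^ n)) @ \oo --> (pi : R) ^+ 2 / 8.
  apply: (@squeeze_cvgr _ _ _ _ (fun n => pi ^+ 2 / 8 - geometric (pi ^+ 2 / 8) 2^-1 n)
      (cst (pi ^+ 2 / 8))).
  - apply: nearW => n; have [b1 b2] := odd_sum_bounds n.
    rewrite /geometric /= exprVn; apply/andP; split; last by lra.
    by move: b2; set z := pi ^+ 2 / 2 ^+ n; rewrite (_ : pi ^+ 2 / 8 / 2 ^+ n = z / 8); [lra|by rewrite /z mulrAC].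
  - rewrite -[X in _ --> X]subr0; apply: cvgB; first exact: cvg_cst.
    by apply: cvg_geometric; rewrite gtr0_norm ?invr_gt0// invf_lt1// ltr1n.
  - exact: cvg_cst.
have : e - e / 4 = pi ^+ 2 / 8 by apply: (@cvg_unique _ _ _ _ _ _ c3 c4).
lra.
Qed.

End basel.

Lemma kernel_energy_basel (R : realType) : kernel_energy 0 (1 : R) = (pi ^+ 2 / 6)%:E.
Proof.
have b1 n : bcoef (1 : R) n = 1.
  elim: n => //= n ->; rewrite mul1r addrC natr1 divff//; by rewrite pnatr_eq0.
have al1 : (1 : R) < 3 / 2 by lra.
have := kernel_energy_cvg ltr01 al1.
have -> : (fun N => \sum_(n < N) (bcoef (1 : R) n / n.+1%:R) ^+ 2) =
    (fun N => \sum_(n < N) (n.+1%:R)^-2).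
  by apply/funext => N; apply: eq_bigr => n _; rewrite b1 div1r exprVn.
move=> /basel_eq <-; rewrite fineK// ge0_fin_numE.
  by apply: kernel_energy_lty; lra.
rewrite kernel_energy_series//; apply: nneseries_ge0 => n _ _.
by rewrite lee_fin sqr_ge0.
Qed.

(** * The operator norm *)

Section operator_norm.
Variables (R : realType) (d' : nat).
Local Notation d := d'.+1.
Local Notation C := R[i].
Local Notation Cd := (d.-tuple C).
Local Notation B := (@unit_ball R d).
Local Notation vm := (@vbf R d).
Variable alpha : R.
Hypothesis alpha_lt : alpha < (d%:R + 2) / 2.
Implicit Types f g : Cd -> C.

Lemma LpNorm1E g : LpNorm 1%:E g = (\int[vm]_z (normc (rB g z))%:E)%E.
Proof.
rewrite /LpNorm Lnorm1; apply: eq_integral => z _; rewrite patchE.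
case: ifPn => [/set_mem zB|/negP zB].
  by rewrite rB_in// gee0_abs// lee_fin normc_ge0.
rewrite rB_out ?abse0//; last by move=> /mem_set.
by rewrite ComplexField.Normc.normc0.
Qed.

Lemma LpNormyE f : LpNorm +oo%E f = ess_sup vm (fun z => (normc (rB f z))%:E).
Proof.
(* The L^oo norm is an essential supremum only when the measure is nonzero; here the total mass is
   1. *)
rewrite /LpNorm unlock /Lnorm ifT; last by rewrite /= vball_setT vball_ball lte01.
congr ess_sup; apply/funext => z /=; rewrite patchE.
case: ifPn => [/set_mem zB|/negP zB].
  by rewrite rB_in// gee0_abs// lee_fin normc_ge0.
rewrite rB_out ?abse0//; last by move=> /mem_set.
by rewrite ComplexField.Normc.normc0.
Qed.

Let kB (p : Cd * Cd) : R := sqn (kerB (@kapC R d alpha) p).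

Let kB_ge0 p : 0 <= kB p. Proof. exact: sqn_ge0. Qed.

Let mkB : measurable_fun setT kB.
Proof. by apply: measurable_sqn; exact: (@measurable_kapC R d' alpha). Qed.

(** This identity of kernels is why the trace and the operator norm coincide. *)
Let kerB_kapN p : kerB (@kapN R d (2 * alpha)) p = (kB p)%:C%C.
Proof.
case: p => z w; rewrite /kB.
have [zB|zB] := pselect (B z); last by rewrite /kerB /= !rB_out// sqn0.
have [wB|wB] := pselect (B w); last first.
  by rewrite /kerB /= !(rB_in _ zB) !(rB_out _ wB) sqn0.
rewrite !kerB_in// sqn_kapC// kapN_real sqdE expr2; congr (_%:C)%C.
rewrite powRM ?normc_ge0// -powRD; first by congr (_ `^ _); ring.
by rewrite (gt_eqF (one_sub_hdot_gt0 zB wB)) implybT.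
Qed.

Let J z : \bar R := (\int[vm]_w (kB (z, w))%:E)%E.

Let mkBz z : measurable_fun setT (fun w => (kB (z, w))%:E).
Proof. by apply/measurable_EFinP; apply: (measurableT_comp mkB); exact: pair1_measurable. Qed.

Let J_ge0 z : (0 <= J z)%E.
Proof. by apply: integral_ge0 => w _; rewrite lee_fin. Qed.

Let mJ : measurable_fun setT J.
Proof.
apply: (measurable_fun_fubini_tonelli_F (fun p : Cd * Cd => (kB p)%:E)).
  by apply/measurable_EFinP; exact: mkB.
by move=> p; rewrite lee_fin.
Qed.

Let J_fin z : J z \is a fin_num.
Proof.
have [_ iJ] := kerB_section_L2 (@measurable_kapC R d' alpha) (@sqn_kapC R d alpha) z.
exact: integrable_fin_num iJ.
Qed.

Let h f z w : C := kerB (@kapN R d (2 * alpha)) (z, w) * rB f w.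

Let T_Kop f z : rB (Kalpha_plus (2 * alpha) f) z = Cint vm (h f z).
Proof. by rewrite -[LHS]/(rB (Kker (@kapN R d (2 * alpha)) f) z) rB_Kker. Qed.

Let normc_h f z w : normc (h f z w) = kB (z, w) * normc (rB f w).
Proof.
rewrite /h kerB_kapN ComplexField.Normc.normcM; congr (_ * _).
by rewrite /= expr0n addr0 sqrtr_sqr ger0_norm.
Qed.

Let measurable_h f : measurable_fun setT (rB f) ->
  measurable_fun setT (fun p : Cd * Cd => h f p.1 p.2).
Proof.
move=> mf; apply: measurable_cfunM; last exact: measurableT_comp mf measurable_snd.
rewrite (_ : (fun _ => _) = kerB (@kapN R d (2 * alpha))); first exact: measurable_kapN.
by apply/funext => -[].
Qed.

(** Fubini would ask for joint integrability; positive and negative parts with Tonelli give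
    measurability for every measurable [F], ahead of any estimate. *)
Let measurable_integral (F : Cd * Cd -> R) : measurable_fun setT F ->
  measurable_fun setT (fun z => \int[vm]_w F (z, w)).
Proof.
move=> mF; have mE : measurable_fun setT (EFin \o F) by exact/measurable_EFinP.
rewrite /Rintegral; apply: (measurableT_comp (@fine_measurable R setT measurableT)).
rewrite (_ : (fun z => _) = (fun z => \int[vm]_w ((EFin \o F)^\+ (z, w)) -
    \int[vm]_w ((EFin \o F)^\- (z, w)))%E); last first.
  apply/funext => z; rewrite integralE; congr (_ - _)%E; apply: eq_integral => w _.
    by rewrite !funeposE.
  by rewrite !funenegE.
apply: emeasurable_funB.
  apply: (measurable_fun_fubini_tonelli_F ((EFin \o F)^\+)%E); first exact: measurable_funepos.
  by move=> p; exact: funepos_ge0.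
apply: (measurable_fun_fubini_tonelli_F ((EFin \o F)^\-)%E); first exact: measurable_funeneg.
by move=> p; exact: funeneg_ge0.
Qed.

Let measurable_T f : measurable_fun setT (rB f) ->
  measurable_fun setT (rB (Kalpha_plus (2 * alpha) f)).
Proof.
move=> /measurable_h mh; rewrite (_ : rB _ = fun z => Cint vm (h f z)); last exact/funext/T_Kop.
have /measurable_fun_complexP[mr mi] := mh.
apply/measurable_fun_complexP; split.
- exact: (@measurable_integral (fun p => complex.Re (h f p.1 p.2))).
- exact: (@measurable_integral (fun p => complex.Im (h f p.1 p.2))).
Qed.

Lemma LpNorm1_Kalpha_plus_le f : in_Lp +oo%E f ->
  (LpNorm 1%:E (Kalpha_plus (2 * alpha) f) <=
    LpNorm +oo%E f * kernel_energy d' alpha)%E.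
Proof.
move=> [/measurable_rB mf fN].
have N0 : (0 <= LpNorm +oo%E f)%E by exact: Lnorm_ge0.
have Nfin : LpNorm +oo%E f \is a fin_num by rewrite ge0_fin_numE.
set N := fine (LpNorm +oo%E f).
have NE : LpNorm +oo%E f = N%:E by rewrite /N fineK.
have N00 : 0 <= N by rewrite -lee_fin -NE.
have aeN : {ae vm, forall z, (normc (rB f z) <= N)}.
  have := @ess_sup_ge _ _ _ vm (fun z => (normc (rB f z))%:E).
  by rewrite -LpNormyE NE; apply: filterS => z; rewrite lee_fin.
have mh := measurable_h mf.
have mhz z : measurable_fun setT (h f z).
  exact: (measurableT_comp mh (@pair1_measurable _ _ _ _ z)).
have hle z : (\int[vm]_w (normc (h f z w))%:E <= N%:E * J z)%E.
  rewrite -ge0_integralZl//; last by move=> w _; rewrite lee_fin.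
  apply: ae_ge0_le_integral => //.
  - by move=> w _; rewrite lee_fin normc_ge0.
  - exact/measurable_EFinP/measurable_normc.
  - by move=> w _; rewrite mule_ge0// lee_fin.
  - by apply: emeasurable_funM => //; exact: measurable_cst.
  apply: filterS aeN => w wN _; rewrite normc_h -EFinM lee_fin mulrC.
  exact: ler_wpM2r.
have hi z : cintegrable vm (h f z).
  apply: (dominated_cintegrable (g := fun w => normc (h f z w))) => //.
  apply/integrableP; split; first exact/measurable_EFinP/measurable_normc.
  under eq_integral do rewrite gee0_abs ?lee_fin ?normc_ge0//.
  by apply: le_lt_trans (hle z) _; rewrite -(fineK (J_fin z)) -EFinM ltry.
rewrite LpNorm1E NE /kernel_energy -/J.
apply: (@le_trans _ _ (\int[vm]_z (N%:E * J z))%E); last first.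
  have N0' : (0 <= N%:E)%E by rewrite lee_fin.
  by rewrite (ge0_integralZl vm measurableT mJ (fun z _ => J_ge0 z) N0').
apply: ge0_le_integral => //.
- by move=> z _; rewrite lee_fin normc_ge0.
- by apply/measurable_EFinP; apply: measurable_normc; exact: (measurable_T mf).
- by apply: emeasurable_funM => //; exact: measurable_cst.
move=> z _; rewrite T_Kop; apply: le_trans (hle z).
apply: (@le_trans _ _ (\int[vm]_w normc (h f z w))%:E).
  by rewrite lee_fin; exact: normc_Cint.
rewrite /Rintegral fineK//; apply: integrable_fin_num => //.
exact: cintegrable_normc.
Qed.

Lemma opnorm_Kalpha_plus :
  opnorm +oo%E 1%E (Kalpha_plus (d := d) (2 * alpha)) = kernel_energy d' alpha.
Proof.
have Efin := kernel_energy_lty alpha_lt.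
have E0 : (0 <= kernel_energy d' alpha)%E by apply: integral_ge0 => z _; exact: J_ge0.
rewrite /opnorm asboolT; last first.
  move=> f Lf; split.
    have [mf _] := Lf; apply/measurable_rB; apply: measurable_T; exact/measurable_rB.
  apply: le_lt_trans (LpNorm1_Kalpha_plus_le Lf) _.
  have [_ fN] := Lf; apply: lte_mul_pinfty => //; first exact: Lnorm_ge0.
  by rewrite ge0_fin_numE// Lnorm_ge0.
apply/eqP; rewrite eq_le; apply/andP; split.
  apply: ge_ereal_sup => _ [f [Lf f1] <-].
  apply: le_trans (LpNorm1_Kalpha_plus_le Lf) _.
  by rewrite -[leRHS]mul1e; apply: lee_wpmul2r.
pose u : Cd -> C := fun=> 1.
have mu1 : measurable_fun setT (rB u).
  exact/measurable_rB/measurable_cst.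
have u1 : (LpNorm +oo%E u <= 1)%E.
  rewrite LpNormyE; apply/ess_supP; apply: nearW => z; rewrite lee_fin.
  have [zB|zB] := pselect (B z); first by rewrite rB_in// /u ComplexField.Normc.normc1.
  by rewrite rB_out// ComplexField.Normc.normc0.
have Lu : in_Lp +oo%E u.
  by split; [exact/measurable_rB|apply: le_lt_trans u1 _; rewrite ltry].
apply: ereal_sup_ge; exists (LpNorm 1%:E (Kalpha_plus (2 * alpha) u)); first by exists u.
rewrite LpNorm1E le_eqVlt; apply/orP; left; apply/eqP.
rewrite /kernel_energy; apply: eq_integral => z _; rewrite T_Kop -/(J z).
have hE : h u z = fun w => (kB (z, w))%:C%C.
  apply/funext => w; rewrite /h kerB_kapN.
  have [wB|wB] := pselect (B w); first by rewrite rB_in// /u mulr1.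
  rewrite rB_out// mulr0 /kB /kerB /=.
  have [zB|zB] := pselect (B z); last by rewrite rB_out// sqn0.
  by rewrite rB_in// rB_out// sqn0.
rewrite hE /Cint /= /Rintegral integral0 /= expr0n addr0 sqrtr_sqr ger0_norm.
  exact: esym (fineK (J_fin z)).
by apply: fine_ge0; exact: J_ge0.
Qed.

End operator_norm.

Theorem theorem5 (R : realType) (d : nat) (alpha : R)
    (d_ge1 : (1 <= d)%N) (alpha_lt : alpha < (d%:R + 2) / 2) :
  (hilbert_schmidt (Kalpha (d := d) alpha) /\
   hilbert_schmidt (Kalpha_plus (d := d) alpha)) /\
  (d = 1%N -> 0 < alpha -> alpha < 3 / 2 ->
   let t : R :=
     if alpha == 1 then pi ^+ 2 / 6
     else 1 / (alpha - 1) ^+ 2 *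
          (Gamma (3 - 2 * alpha) / Gamma (2 - alpha) ^+ 2 - 1) in
   has_trace (adjoint (Kalpha (d := d) alpha) \o Kalpha (d := d) alpha) t%:C%C /\
   opnorm +oo%E 1%E (Kalpha_plus (d := d) (2 * alpha)) = t%:E).
Proof.
case: d d_ge1 alpha_lt => // d' _ alpha_lt; split.
  by split; [exact: Kalpha_hilbert_schmidt|exact: Kalpha_plus_hilbert_schmidt].
move=> [d0] al0 al1 t; subst d'.
have tE : kernel_energy 0 alpha = t%:E.
  rewrite /t; case: eqVneq => [->|al_neq1]; first exact: kernel_energy_basel.
  exact: kernel_energy_gauss.
split; last by rewrite opnorm_Kalpha_plus.
by have := Kalpha_has_trace alpha_lt; rewrite tE.
Qed.
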